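(* Let $\pi=\exp(-U)\,\mathrm{d}x$ be a probability measure on $\mathbb{R}^d=\mathbb{R}^{d_1}\times\cdots\times\mathbb{R}^{d_M}$ satisfying the block-wise convexity/smoothness assumption (given in the context) with constants $L_1,\dots,L_M>0$, $\lambda^*>0$, and let $\kappa^*=1/\lambda^*$. Let $P^{\mathrm{GS}}$ be the random-scan Gibbs sampler kernel targeting $\pi$. Then $$\mathrm{Gap}(P^{\mathrm{GS}})\ge\frac{1}{\kappa^* M}.$$ Equivalently, if $X\sim\pi$ and $f\in L^2(\pi)$, then $$\sum_{m=1}^M\mathbb{E}\big(\mathrm{Var}(f(X)\,|\,X_{-m})\big)\ge\frac{1}{\kappa^*}\mathrm{Var}(f(X)).$$
   Context: Setting: $d=d_1+\dots+d_M$, $\mathcal{X}_m=\mathbb{R}^{d_m}$, $\mathbb{R}^d=\mathcal{X}_1\times\dots\times\mathcal{X}_M$. For $x=(x_1,\dots,x_M)$, $x_{-m}=(x_1,\dots,x_{m-1},x_{m+1},\dots,x_M)\in\mathcal{X}_{-m}=\prod_{i\ne m}\mathcal{X}_i$, and $(y_m,x_{-m})$ denotes $x$ with its $m$-th block replaced by $y_m$. $\pi(\cdot|x_{-m})$ is the conditional law of $X_m$ given $X_{-m}=x_{-m}$ under $X\sim\pi$. Gibbs sampler kernel: $P_m(x,A)=\int_{\mathcal{X}_m}\mathbf{1}_A(y_m,x_{-m})\,\pi(\mathrm{d}y_m|x_{-m})$ and $P^{\mathrm{GS}}=\frac1M\sum_{m=1}^M P_m$. Spectral gap: for a $\pi$-reversible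 Markov kernel $P$, with $Pf(x)=\int f(y)P(x,\mathrm{d}y)$ and $\langle f,g\rangle_\pi=\int fg\,\mathrm{d}\pi$, $\mathrm{Gap}(P)=\inf_f\frac{\langle f,(\mathrm{Id}-P)f\rangle_\pi}{\mathrm{Var}_\pi(f)}$, the infimum being over $f\in L^2(\pi)$ (with $\mathrm{Var}_\pi(f)>0$). Block-wise convexity/smoothness assumption: $\pi$ has Lebesgue density $\exp(-U)$, with $U:\mathbb{R}^d\to\mathbb{R}$ of the form $U(x)=U_0(x)+\sum_{m=1}^M U_m(x_m)$, where each $U_m:\mathcal{X}_m\to\mathbb{R}$ is convex, $U_0$ is of class $C^1$, and (i) for every $m$ and every $\bar x_{-m}\in\mathcal{X}_{-m}$, the map $x_m\mapsto\nabla_m U_0(x_m,\bar x_{-m})$ is $L_m$-Lipschitz ($\nabla_m$ is the gradient in the block $x_m$); (ii) $x\mapsto U_0(x)-\frac{\lambda^*}{2}\|x\|_L^2$ is convex, where $\|x\|_L^2=\sum_{m=1}^M L_m\|x_m\|^2$ and $\lambda^*>0$. One sets $\kappa^*=1/\lambda^*$. *)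

(* Defs.v *)
From HB Require Import structures.
From mathcomp Require Import all_boot all_order all_algebra.
From mathcomp Require Import all_classical all_reals all_analysis.
From mathcomp Require Import measurable_realfun.
Set Implicit Arguments.
Unset Strict Implicit.
Unset Printing Implicit Defensive.
Import Order.TTheory GRing.Theory Num.Theory.
Import numFieldNormedType.Exports.
Local Open Scope classical_set_scope.
Local Open Scope ring_scope.

(* R^n is 'rV[R]_n, which MathComp-Analysis equips with a topology but not with
   a sigma-algebra. We take the product one, generated by the coordinates; on
   R^n it is the Borel sigma-algebra. *)
Section rV_measurable.
Context (R : realType) (n : nat).

Let coors : 'I_n -> 'rV[R]_n -> R := fun i v => v ord0 i.

Let rV_set0 : g_sigma_preimage coors set0.
Proof. exact: sigma_algebra0. Qed.

Let rV_setC A : g_sigma_preimage coors A -> g_sigma_preimage coors (~` A).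
Proof. exact: sigma_algebraC. Qed.

Let rV_bigcup (F : (set 'rV[R]_n)^nat) :
  (forall i, g_sigma_preimage coors (F i)) ->
  g_sigma_preimage coors (\bigcup_i (F i)).
Proof. exact: sigma_algebra_bigcup. Qed.

HB.instance Definition _ := @isMeasurable.Build default_measure_display
  'rV[R]_n (g_sigma_preimage coors) rV_set0 rV_setC rV_bigcup.

Lemma measurable_rV_coord (i : 'I_n) :
  measurable_fun [set: 'rV[R]_n] (fun v : 'rV[R]_n => v ord0 i).
Proof.
move=> _ Y mY; rewrite setTI; apply: sub_sigma_algebra => /=.
rewrite -bigcup_seq/=; exists i => /=; first by rewrite mem_index_enum.
by exists Y => //; rewrite setTI.
Qed.

End rV_measurable.

Lemma measurable_fun_rVP (R : realType) (n : nat) d (T : measurableType d)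
    (f : T -> 'rV[R]_n) :
  measurable_fun [set: T] f <->
  forall i, measurable_fun [set: T] (fun x => f x ord0 i).
Proof.
split=> [mf i|mf].
  exact: (measurableT_comp (measurable_rV_coord i) mf).
suff prefS : g_sigma_preimage
    (fun i => (fun v : 'rV[R]_n => v ord0 i) \o f) `<=` measurable.
  rewrite g_sigma_preimage_comp in prefS.
  by move=> _ A mA; apply: prefS; exists A.
apply: smallest_sub; first exact: sigma_algebra_measurable.
case: n => [|n] in f mf *; first by rewrite big_ord0.
rewrite -bigcup_mkord_ord; apply: bigcup_sub => i Ii.
by move=> A [B mB <-]; exact: mf.
Qed.

Definition rV_cons (R : realType) (n : nat) (p : R * 'rV[R]_n) :
  'rV[R]_n.+1 := row_mx (p.1)%:M p.2.

Lemma rV_cons0 (R : realType) (n : nat) (p : R * 'rV[R]_n) :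
  rV_cons p ord0 ord0 = p.1.
Proof.
have := @row_mxEl R 1 1 n (p.1)%:M p.2 ord0 ord0.
rewrite [RHS]mxE mulr1n => <-; congr (row_mx _ _ _ _); exact: val_inj.
Qed.

Lemma rV_consS (R : realType) (n : nat) (p : R * 'rV[R]_n) (j : 'I_n) :
  rV_cons p ord0 (lift ord0 j) = p.2 ord0 j.
Proof.
rewrite -(@row_mxEr R 1 1 n (p.1)%:M p.2 ord0 j).
by congr (row_mx _ _ _ _); exact: val_inj.
Qed.

Lemma measurable_rV_cons (R : realType) (n : nat) :
  measurable_fun [set: R * 'rV[R]_n] (@rV_cons R n).
Proof.
apply/measurable_fun_rVP => i; case: (unliftP ord0 i) => [j|] ->.
  under eq_fun do rewrite rV_consS.
  exact: (measurableT_comp (measurable_rV_coord j) measurable_snd).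
by under eq_fun do rewrite rV_cons0; exact: measurable_fst.
Qed.

(* Lebesgue measure on R^n, by recursion on n: the pushforward of the product
   measure by R * R^n -> R^(n+1). Lemma lebesgue_rV_box below gives its value on
   boxes. *)
Section lebesgue_rV_step.
Local Open Scope ereal_scope.
Context (R : realType) (n : nat).
Variable mu : {sigma_finite_measure set 'rV[R]_n -> \bar R}.

Definition lebesgue_rV_step : set 'rV[R]_n.+1 -> \bar R :=
  pushforward (@lebesgue_measure R \x mu) (@rV_cons R n).

Let step0 : lebesgue_rV_step set0 = 0.
Proof. by rewrite /lebesgue_rV_step /pushforward preimage_set0 measure0. Qed.

Let step_ge0 A : 0 <= lebesgue_rV_step A.
Proof. rewrite /lebesgue_rV_step /pushforward; exact: measure_ge0. Qed.

Let step_sigma_additive : semi_sigma_additive lebesgue_rV_step.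
Proof.
move=> F mF tF mUF; rewrite /lebesgue_rV_step /pushforward preimage_bigcup.
have mpre A : measurable A -> measurable (@rV_cons R n @^-1` A).
  by move=> mA; rewrite -[X in measurable X]setTI; exact: measurable_rV_cons.
apply: measure_semi_sigma_additive.
- by move=> k; exact: mpre.
- apply/trivIsetP => /= i j _ _ ij; rewrite -preimage_setI.
  by move/trivIsetP : tF => /(_ _ _ _ _ ij) ->//; rewrite preimage_set0.
- by rewrite -preimage_bigcup; exact: mpre.
Qed.

HB.instance Definition _ := isMeasure.Build _ _ _ lebesgue_rV_step
  step0 step_ge0 step_sigma_additive.

Let step_sigma_finite : sigma_finite setT lebesgue_rV_step.
Proof.
have /sigma_finiteP[F [TF ndF Foo]] := sigma_finiteT (@lebesgue_measure R).
have /sigma_finiteP[G [TG ndG Goo]] := sigma_finiteT mu.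
pose g (v : 'rV[R]_n.+1) : R * 'rV[R]_n :=
  (v ord0 ord0, \row_j v ord0 (lift ord0 j)).
have gK : cancel (@rV_cons R n) g.
  move=> [a u]; rewrite /g rV_cons0; congr pair.
  by apply/rowP => j; rewrite mxE rV_consS.
have mg : measurable_fun [set: 'rV[R]_n.+1] g.
  apply: measurable_fun_pair; first exact: measurable_rV_coord.
  apply/measurable_fun_rVP => i.
  by under eq_fun do rewrite mxE; exact: measurable_rV_coord.
exists (fun k => g @^-1` (F k `*` G k)).
  rewrite -preimage_bigcup (_ : \bigcup_k _ = setT) ?preimage_setT//.
  apply/seteqP; split=> // -[x y] _.
  have [j _ Fx] : (\bigcup_k F k) x by rewrite -TF.
  have [k _ Gy] : (\bigcup_k G k) y by rewrite -TG.
  exists (maxn j k) => //; split => /=.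
    by move: x Fx; exact/subsetPset/ndF/leq_maxl.
  by move: y Gy; exact/subsetPset/ndG/leq_maxr.
move=> k; have [mF Fk] := Foo k; have [mG Gk] := Goo k; split.
  by rewrite -[X in measurable X]setTI; apply: mg => //; exact: measurableX.
rewrite /lebesgue_rV_step /pushforward -comp_preimage.
rewrite (_ : g \o _ = id); last by apply/funext => p; exact: gK.
by rewrite preimage_id product_measure1E// lte_mul_pinfty// ge0_fin_numE.
Qed.

HB.instance Definition _ := Measure_isSigmaFinite.Build _ _ _
  lebesgue_rV_step step_sigma_finite.

End lebesgue_rV_step.

Fixpoint lebesgue_rV (R : realType) (n : nat) :
    {sigma_finite_measure set 'rV[R]_n -> \bar R} :=
  match n with
  | 0 => dirac (0 : 'rV[R]_0)
  | n'.+1 => lebesgue_rV_step (lebesgue_rV R n')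
  end.

Lemma lebesgue_rV_box (R : realType) (n : nat) (A : 'I_n -> set R) :
  (forall i, measurable (A i)) ->
  lebesgue_rV R n [set v | forall i, A i (v ord0 i)] =
  (\prod_(i < n) lebesgue_measure (A i))%E.
Proof.
elim: n => [|n IH] in A * => mA.
  by rewrite big_ord0 /= diracE mem_set// => -[].
rewrite big_ord_recl -(IH (fun i => A (lift ord0 i)))//=.
set B := (X in (_ * lebesgue_rV R n X)%E).
have mB : measurable B.
  rewrite (_ : B = \bigcap_(i in [set: 'I_n])
      ((fun v : 'rV[R]_n => v ord0 i) @^-1` A (lift ord0 i))); last first.
    by apply/seteqP; split=> [v H i _|v H i]; exact: H.
  apply: fin_bigcap_measurable => // i _.
  by rewrite -[X in measurable X]setTI; exact: measurable_rV_coord.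
rewrite /lebesgue_rV_step /pushforward -product_measure1E//; last exact: (mA ord0).
congr (_ _); apply/seteqP; split=> [p /= H|p /= [H1 H2] i].
  split; first by have := H ord0; rewrite rV_cons0.
  by move=> i; have := H (lift ord0 i); rewrite rV_consS.
by case: (unliftP ord0 i) => [j|] ->; rewrite ?rV_cons0 ?rV_consS.
Qed.

Section euclidean.
Context (R : realType).

(* The library norm on 'rV[R]_n is the sup norm. *)
Definition norm2 (n : nat) (v : 'rV[R]_n) : R :=
  Num.sqrt (\sum_(i < n) v ord0 i ^+ 2).

Definition gradient (n : nat) (f : 'rV[R]_n -> R) (x : 'rV[R]_n) : 'rV[R]_n :=
  \row_j 'D_(delta_mx ord0 j) f x.

Definition class_C1 (n : nat) (f : 'rV[R]_n -> R) : Prop :=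
  (forall x, differentiable f x) /\ continuous (gradient f).

Definition convex_rV (n : nat) (f : 'rV[R]_n -> R) : Prop :=
  convex_function [set: convex_lmodType 'rV[R]_n] f.

End euclidean.

(* A point of R^d, with d = \sum_m d_m, is a row of M blocks; its m-th block is
   [submxrow x m]. *)
Section blocks.
Context (R : realType) (M : nat) (d : 'I_M -> nat).
Notation X := 'rV[R]_(\sum_m d m).

Definition others (m : 'I_M) : 'I_M.-1 -> nat := fun j => d (lift m j).

(* x_{-m} *)
Definition drop_block (m : 'I_M) (x : X) : 'rV[R]_(\sum_j others m j) :=
  \mxrow_j submxrow x (lift m j).

(* (y, x_{-m}) *)
Definition set_block (m : 'I_M) (x : X) (y : 'rV[R]_(d m)) : X :=
  \mxrow_i dfwith (fun j => submxrow x j) m y i.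

Definition block_gradient (m : 'I_M) (f : X -> R) (x : X) : 'rV[R]_(d m) :=
  submxrow (gradient f x) m.

Definition block_normsq (L : 'I_M -> R) (x : X) : R :=
  \sum_m L m * norm2 (submxrow x m) ^+ 2.

Definition block_convex_smooth (L : 'I_M -> R) (lambda : R) (U : X -> R) :
    Prop :=
  exists (U0 : X -> R) (Um : forall m, 'rV[R]_(d m) -> R),
    [/\ forall x, U x = U0 x + \sum_m Um m (submxrow x m),
        forall m, convex_rV (Um m),
        class_C1 U0,
        forall m (x : X) (y z : 'rV[R]_(d m)),
          norm2 (block_gradient m U0 (set_block x y)
                 - block_gradient m U0 (set_block x z))
          <= L m * norm2 (y - z) &
        convex_rV (fun x => U0 x - lambda / 2 * block_normsq L x)].

Lemma measurable_submxrow (m : 'I_M) :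
  measurable_fun [set: X] (fun x : X => submxrow x m).
Proof.
apply/measurable_fun_rVP => i; under [X in measurable_fun _ X]eq_fun do rewrite mxE.
exact: measurable_rV_coord.
Qed.

Lemma measurable_drop_block (m : 'I_M) :
  measurable_fun [set: X] (@drop_block m).
Proof.
apply/measurable_fun_rVP => i; under [X in measurable_fun _ X]eq_fun do rewrite mxE mxE.
exact: measurable_rV_coord.
Qed.

Lemma measurable_set_block (m : 'I_M) :
  measurable_fun [set: X * 'rV[R]_(d m)] (fun p => set_block p.1 p.2).
Proof.
have key k (j : 'I_(d k)) :
    measurable_fun [set: X * 'rV[R]_(d m)]
      (fun p => dfwith (fun i => submxrow p.1 i) m p.2 k ord0 j).
  have [e|ne] := eqVneq m k.
    case: k / e j => j.
    under [X in measurable_fun _ X]eq_fun do rewrite dfwithin.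
    exact: (measurableT_comp (measurable_rV_coord j) measurable_snd).
  under [X in measurable_fun _ X]eq_fun do rewrite dfwithout// mxE.
  exact: (measurableT_comp (measurable_rV_coord _) measurable_fst).
apply/measurable_fun_rVP => i.
by under [X in measurable_fun _ X]eq_fun do rewrite mxE; exact: key.
Qed.

End blocks.

Definition has_density (R : realType) (n : nat) (mu : set 'rV[R]_n -> \bar R)
    (f : 'rV[R]_n -> R) : Prop :=
  forall A, measurable A -> mu A = (\int[lebesgue_rV R n]_(x in A) (f x)%:E)%E.

Section gibbs.
Local Open Scope ereal_scope.
Context (R : realType) (M : nat) (d : 'I_M -> nat).
Notation X := 'rV[R]_(\sum_m d m).
Notation block m := 'rV[R]_(d m).
Notation rest m := 'rV[R]_(\sum_j others d m j).

(* K is a version of the conditional law of X_m given X_{-m} under X ~ mu. *)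
Definition conditional_law (mu : probability X R) (m : 'I_M)
    (K : R.-pker (rest m) ~> (block m)) : Prop :=
  forall (A : set (rest m)) (B : set (block m)), measurable A -> measurable B ->
    mu [set x | A (drop_block m x) /\ B (submxrow x m)] =
    \int[mu]_(x in drop_block m @^-1` A) K (drop_block m x) B.

Variable K : forall m, R.-pker (rest m) ~> (block m).

(* P_m *)
Definition gibbs_block (m : 'I_M) (x : X) (A : set X) : \bar R :=
  \int[K m (drop_block m x)]_y (\1_A (set_block x y))%:E.

(* P^GS, made into a kernel by [gibbs_kernel] below *)
Definition gibbs (x : X) (A : set X) : \bar R :=
  (M%:R^-1)%:E * \sum_(m < M) gibbs_block m x A.

Let set_blockT m (x : X) (A : set X) : measurable A ->
  measurable (@set_block R M d m x @^-1` A).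
Proof.
move=> mA; rewrite -[X in measurable X]setTI.
have mf := measurableT_comp (@measurable_set_block R M d m) (pair1_measurable x).
exact: (mf measurableT _ mA).
Qed.

Let gibbs_blockE m x A : measurable A ->
  gibbs_block m x A = K m (drop_block m x) (@set_block R M d m x @^-1` A).
Proof.
move=> mA; rewrite -[X in K m _ X]setIT -integral_indic//.
exact: set_blockT.
Qed.

Let gibbs_block0 m x : gibbs_block m x set0 = 0.
Proof. by rewrite gibbs_blockE// preimage_set0 measure0. Qed.

Let gibbs_block_ge0 m x A : 0 <= gibbs_block m x A.
Proof. by apply: integral_ge0 => y _; rewrite lee_fin. Qed.

Let gibbs_block_sigma_additive m x : semi_sigma_additive (gibbs_block m x).
Proof.
move=> F mF tF mUF; rewrite gibbs_blockE//.
under eq_fun do under eq_bigr do rewrite gibbs_blockE//.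
rewrite preimage_bigcup; apply: measure_semi_sigma_additive.
- by move=> k; exact: set_blockT.
- apply/trivIsetP => /= i j _ _ ij; rewrite -preimage_setI.
  by move/trivIsetP : tF => /(_ _ _ _ _ ij) ->//; rewrite preimage_set0.
- by rewrite -preimage_bigcup; exact: set_blockT.
Qed.

HB.instance Definition _ m x := isMeasure.Build _ _ _ (gibbs_block m x)
  (gibbs_block0 m x) (gibbs_block_ge0 m x) (@gibbs_block_sigma_additive m x).

Let gibbs0 x : gibbs x set0 = 0.
Proof. by rewrite /gibbs big1 ?mule0// => m _; exact: measure0. Qed.

Let gibbs_ge0 x A : 0 <= gibbs x A.
Proof.
by rewrite /gibbs mule_ge0 ?lee_fin ?invr_ge0//; apply: sume_ge0 => m _.
Qed.

Let gibbs_sigma_additive x : semi_sigma_additive (gibbs x).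
Proof.
have r0 : (0 <= M%:R^-1 :> R)%R by rewrite invr_ge0.
pose mu_ (k : nat) : {measure set X -> \bar R} :=
  if insub k is Some m then gibbs_block m x else mzero.
have -> : gibbs x = mscale (NngNum r0) (msum mu_ M).
  apply/funext => A; rewrite /gibbs /mscale /msum/=; congr (_ * _).
  by apply: eq_bigr => m _; rewrite /mu_ valK.
exact: measure_semi_sigma_additive.
Qed.

HB.instance Definition _ x := isMeasure.Build _ _ _ (gibbs x)
  (gibbs0 x) (gibbs_ge0 x) (@gibbs_sigma_additive x).

Definition gibbs_kernel : X -> {measure set X -> \bar R} := gibbs.

Definition block_kernel m (x : X) : {measure set (block m) -> \bar R} :=
  K m (drop_block m x).

Let measurable_block_kernel m B : measurable B ->
  measurable_fun [set: X] (block_kernel m ^~ B).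
Proof.
move=> mB; have mf := measurableT_comp
  (measurable_kernel (K m) B mB) (@measurable_drop_block R M d m).
exact: mf.
Qed.

HB.instance Definition _ m := isKernel.Build _ _ _ _ _ (@block_kernel m)
  (@measurable_block_kernel m).

Let block_kernelT m x : block_kernel m x setT = 1.
Proof. exact: prob_kernel. Qed.

HB.instance Definition _ m := Kernel_isProbability.Build _ _ _ _ _
  (@block_kernel m) (@block_kernelT m).

Let measurable_gibbs A : measurable A ->
  measurable_fun [set: X] (gibbs_kernel ^~ A).
Proof.
move=> mA; rewrite /gibbs_kernel/= /gibbs.
apply: measurable_funeM; apply: emeasurable_fun_sum => m.
have mf : measurable_fun [set: X * block m]
    (fun p => (\1_A (set_block p.1 p.2))%:E : \bar R).
  apply/measurable_EFinP.
  exact: (measurableT_comp (measurable_indic mA) (@measurable_set_block R M d m)).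
have f0 (p : X * block m) : 0 <= (\1_A (set_block p.1 p.2))%:E :> \bar R.
  by rewrite lee_fin.
exact: (measurable_fun_integral_finite_kernel _ (block_kernel m) f0 mf).
Qed.

HB.instance Definition _ := isKernel.Build _ _ _ _ _ gibbs_kernel
  measurable_gibbs.

Lemma gibbs_kernel_setT x : (0 < M)%N -> gibbs_kernel x [set: X] = 1.
Proof.
move=> M0; rewrite /gibbs_kernel/= /gibbs.
rewrite [X in _ * X](eq_bigr (fun=> 1%:E)) => [|m _]; last first.
  by rewrite gibbs_blockE// preimage_setT prob_kernel.
rewrite sumEFin -EFinM sumr_const card_ord mulVf// pnatr_eq0; exact: lt0n_neq0.
Qed.

(* [K m z], packaged as a probability so that 'V_(_)[_] applies to it. *)
Definition cond_prob (m : 'I_M) (z : rest m) : set (block m) -> \bar R := K m z.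

HB.instance Definition _ m z := Measure.on (@cond_prob m z).

Let cond_probT m z : @cond_prob m z setT = 1.
Proof. exact: prob_kernel. Qed.

HB.instance Definition _ m z :=
  Measure_isProbability.Build _ _ _ (@cond_prob m z) (@cond_probT m z).

(* Var(f(X) | X_{-m}) at X = x: the variance of f(., x_{-m}) under the
   conditional law of X_m given X_{-m} = x_{-m}. *)
Definition cond_variance (m : 'I_M) (f : X -> R) (x : X) : \bar R :=
  'V_(cond_prob (drop_block m x))[fun y => f (set_block x y)].

End gibbs.

Section spectral_gap.
Context d (T : measurableType d) (R : realType).
Variables (mu : probability T R) (P : R.-ker T ~> T).

Definition kernel_op (f : T -> R) (x : T) : R := \int[P x]_y f y.

Definition inner (f g : T -> R) : R := \int[mu]_x (f x * g x).

(* The infimum is taken in \bar R: it is +oo when mu is a Dirac mass. *)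
Definition Gap : \bar R :=
  ereal_inf [set (inner f (f \- kernel_op f) / fine 'V_mu[f])%:E |
             f in [set f : T -> R | f \in Lfun mu 2%:E /\ (0 < 'V_mu[f])%E]].

End spectral_gap.

(* Main.v *)
Require Import Defs.
From HB Require Import structures.
From mathcomp Require Import all_boot all_order all_algebra.
From mathcomp Require Import all_classical all_reals all_analysis.
From mathcomp Require Import measurable_realfun.
From mathcomp Require Import unstable finmap ring lra.
Set Implicit Arguments.
Unset Strict Implicit.
Unset Printing Implicit Defensive.
Import Order.TTheory GRing.Theory Num.Theory.
Import numFieldNormedType.Exports.
Local Open Scope classical_set_scope.
Local Open Scope ring_scope.

(* Let h > 0 have pi-mean 1, and let T be the Knothe-Rosenblatt map (triangular
   and increasing) from h pi to pi, with Jacobian product of the J_i > 0. For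
   each m let S_m x be x with its m-th block replaced by (1 - lambda) x_m +
   lambda (T x)_m. Smoothness in each block, convexity of the U_m and strong
   convexity of U_0 give
     lambda (U x - U (T x)) <= sum_m (U x - U (S_m x)).
   If w_m > 0 depends on x_{-m} only, then
     Z_m = e^{-U(S_m x)} w_m(x) det(DS_m x) / (h e^{-U})(x)
   has integral E w_m against h pi, by the change of variables S_m.
   Summing ln Z_m <= Z_m - 1 and using concavity of ln in det(DS_m), we get
     E[h (sum_m (ln w_m - ln h) + lambda ln h)] + M <= sum_m E w_m,
   where the T-dependent terms have cancelled. Take h = 1 + eps g with g bounded
   and centred and w_m = 1 / (1 - eps E[g | X_{-m}]); the terms of order eps^2
   give sum_m E(E[g | X_{-m}]^2) <= (M - lambda) E g^2. Truncation extends this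
   to square-integrable functions. *)

(** * Integrals determined by indicators *)

(** The interpolation step equals the convexity constant because smoothness costs lambda^2/2 times
    the squared L-norm of T x - x, and lambda times the strong convexity inequality gains exactly
    this amount. A Knothe-Rosenblatt map is chosen rather than an optimal one because its triangular
    form survives mixing with one weight per coordinate: each S_m is a change of variables made
    coordinate by coordinate with increasing maps of the line, whose derivatives enter only in
    integrated form. For w_m = E[h | X_{-m}], the maximizer of E[h ln w_m] - E w_m, the entropy
    inequality reads lambda Ent(h) <= sum_m E Ent(h | X_{-m}); the gap is its linearization at h =
    1. With v = eps E[g | X_{-m}], the choice 1 / (1 - v) agrees with the maximizer 1 + v to first
    order, which suffices at a stationary point, and it turns the lower bound on ln w_m into an
    upper bound on ln (1 - v). To conclude, E Var(f | X_{-m}) = E f^2 - E(E[f | X_{-m}]^2), so the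
    conditional variances sum to at least lambda Var f, and the Dirichlet form of P^GS is 1 / M
    times this sum. *)

Section daniell_functional.
Local Open Scope ereal_scope.
Context d (T : measurableType d) (R : realType).
Import HBNNSimple.

(** These properties determine a positive functional from its values on indicators. They are
    packaged because the same extension is applied to functionals of different shapes: an integral,
    an integral with a density along a map, and an iterated integral against a kernel. Homogeneity
    is asked on indicators only, since a simple function is a sum of such terms. *)
Record daniell (I : (T -> \bar R) -> \bar R) : Prop := Daniell {
  daniell_indic (c : R) A : (0 <= c)%R -> measurable A ->
    I (fun x => (c * \1_A x)%:E) = c%:E * I (fun x => (\1_A x)%:E);
  daniellD f g : measurable_fun setT f -> measurable_fun setT g ->
    (forall x, 0 <= f x) -> (forall x, 0 <= g x) -> I (f \+ g) = I f + I g;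
  daniell_lim (g : (T -> \bar R)^nat) : (forall n, measurable_fun setT (g n)) ->
    (forall n x, 0 <= g n x) -> (forall x, nondecreasing_seq (g ^~ x)) ->
    I (fun x => limn (g ^~ x)) = limn (fun n => I (g n)) }.

Lemma daniell_unique I J : daniell I -> daniell J ->
  (forall A, measurable A ->
     I (fun x => (\1_A x)%:E) = J (fun x => (\1_A x)%:E)) ->
  forall f, measurable_fun setT f -> (forall x, 0 <= f x) -> I f = J f.
Proof.
move=> dI dJ IJ f mf f0.
pose g := nnsfun_approx measurableT mf.
have -> : f = (fun x => limn (fun n => (g n x)%:E)).
  by apply/funext => x; apply/esym/cvg_lim => //; exact: cvg_nnsfun_approx.
have mg n : measurable_fun setT (EFin \o g n) by exact/measurable_EFinP.
have g0 n x : 0 <= (EFin \o g n) x by rewrite lee_fin.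
have ndg x : nondecreasing_seq ((fun n => EFin \o g n) ^~ x).
  by move=> *; exact/lefP/nd_nnsfun_approx.
rewrite (daniell_lim dI mg g0 ndg) (daniell_lim dJ mg g0 ndg).
congr (limn _); apply/funext => n.
suff H (s : seq R) : all (fun k => 0 <= k)%R s ->
    I (fun x => \sum_(k <- s) (k * \1_(g n @^-1` [set k]) x)%:E) =
    J (fun x => \sum_(k <- s) (k * \1_(g n @^-1` [set k]) x)%:E).
  have -> : EFin \o g n = fun x =>
      \sum_(k <- fset_set (range (g n))) (k * \1_(g n @^-1` [set k]) x)%:E.
    by apply/funext => x /=; rewrite fimfunE sumEFin fsbig_finite.
  apply: H; apply/allP => k; rewrite in_fset_set// => /set_mem[x _ <-].
  exact: fun_ge0.
elim: s => [_|k s IH /= /andP[k0 s0]].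
  have e : (fun x : T => \sum_(k <- [::]) (k * \1_(g n @^-1` [set k]) x)%:E) =
         (fun x => (0 * \1_set0 x)%:E).
    by apply/funext => x; rewrite big_nil mul0r.
  by rewrite e (daniell_indic dI)// (daniell_indic dJ)// !mul0e.
have -> : (fun x => \sum_(j <- k :: s) (j * \1_(g n @^-1` [set j]) x)%:E) =
  (fun x => (k * \1_(g n @^-1` [set k]) x)%:E) \+
  (fun x => \sum_(j <- s) (j * \1_(g n @^-1` [set j]) x)%:E).
  by apply/funext => x; rewrite big_cons.
have mi j : measurable_fun setT (fun x => (j * \1_(g n @^-1` [set j]) x)%:E).
  exact/measurable_EFinP/measurable_funM.
have s0' : forall x, 0 <= \sum_(j <- s) (j * \1_(g n @^-1` [set j]) x)%:E.
  move=> x; rewrite big_seq; apply: sume_ge0 => j js.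
  by rewrite lee_fin mulr_ge0//; move/allP : s0; apply.
have k0' : forall x, 0 <= (k * \1_(g n @^-1` [set k]) x)%:E.
  by move=> x; rewrite lee_fin mulr_ge0.
rewrite (daniellD dI)//; last exact: emeasurable_sum.
rewrite (daniellD dJ)//; last exact: emeasurable_sum.
by rewrite IH// (daniell_indic dI)// (daniell_indic dJ)// IJ.
Qed.

Lemma daniell_integral (mu : {measure set T -> \bar R}) :
  daniell (fun f => \int[mu]_x f x).
Proof.
split.
- move=> c A c0 mA; under eq_integral do rewrite EFinM.
  by rewrite ge0_integralZl//; exact/measurable_EFinP.
- by move=> f g mf mg f0 g0; rewrite ge0_integralD.
- by move=> g mg g0 ndg; rewrite monotone_convergence.
Qed.

End daniell_functional.

Section daniell_change.
Local Open Scope ereal_scope.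
Context d d' (T : measurableType d) (T' : measurableType d') (R : realType).
Variables (mu : {measure set T -> \bar R}) (nu : {measure set T' -> \bar R}).

Lemma daniell_density (phi : T -> T') (w : T -> R) :
  measurable_fun setT phi -> measurable_fun setT w -> (forall x, 0 <= w x)%R ->
  daniell (fun f : T' -> \bar R => \int[mu]_x (f (phi x) * (w x)%:E)).
Proof.
move=> mphi mw w0.
have mwE : measurable_fun setT (EFin \o w) by exact/measurable_EFinP.
have mcomp (f : T' -> \bar R) : measurable_fun setT f ->
    measurable_fun setT (fun x => f (phi x) * (w x)%:E).
  move=> mf; apply: emeasurable_funM => //.
  exact: (measurableT_comp mf mphi).
split.
- move=> c A c0 mA; under eq_integral do rewrite EFinM -muleA.
  rewrite ge0_integralZl//.
    apply: (mcomp (fun x => (\1_A x)%:E)); exact/measurable_EFinP.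
  by move=> x _; rewrite mule_ge0// lee_fin.
- move=> f g mf mg f0 g0; rewrite -ge0_integralD//=.
  + by apply: eq_integral => x _; rewrite ge0_muleDl.
  + by move=> x _; rewrite mule_ge0// lee_fin.
  + exact: mcomp.
  + by move=> x _; rewrite mule_ge0// lee_fin.
  + exact: mcomp.
- move=> g mg g0 ndg; rewrite -monotone_convergence//=.
  + apply: eq_integral => x _.
    rewrite muleC -limeMl//; last exact: ereal_nondecreasing_is_cvgn.
    by congr (limn _); apply/funext => n; rewrite muleC.
  + by move=> n; exact: mcomp.
  + by move=> n x _; rewrite mule_ge0// lee_fin.
  + by move=> x _ m n mn; rewrite lee_wpmul2r ?lee_fin//; exact: ndg.
Qed.

(** One statement covers image measures ([w] constant 1), densities ([phi] the identity) and changes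
    of variables ([mu] and [nu] both Lebesgue). *)
Lemma ge0_integral_density (phi : T -> T') (w : T -> R) :
  measurable_fun setT phi -> measurable_fun setT w -> (forall x, 0 <= w x)%R ->
  (forall A, measurable A -> nu A = \int[mu]_(x in phi @^-1` A) (w x)%:E) ->
  forall f, measurable_fun setT f -> (forall x, 0 <= f x) ->
  \int[nu]_y f y = \int[mu]_x (f (phi x) * (w x)%:E).
Proof.
move=> mphi mw w0 nuE.
apply: (daniell_unique (daniell_integral nu) (daniell_density mphi mw w0)).
move=> A mA; rewrite integral_indic// setIT nuE// integral_mkcond.
apply: eq_integral => x _; rewrite patchE indicE.
have -> : (x \in phi @^-1` A) = (phi x \in A) by apply/idP/idP => /set_mem h; exact/mem_set.
by case: ifPn => _; rewrite ?mul1e ?mul0e.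
Qed.

End daniell_change.

Section push_density.
Local Open Scope ereal_scope.
Context d d' (T : measurableType d) (T' : measurableType d') (R : realType).
Variables (mu : {measure set T -> \bar R}) (phi : T -> T') (w : T -> R).

(* The proofs are arguments so that the measure instance below needs no
   hypothesis. *)
Definition push_density (_ : measurable_fun setT phi)
    (_ : measurable_fun setT w) (_ : forall x, (0 <= w x)%R) :
    set T' -> \bar R :=
  fun A => \int[mu]_(x in phi @^-1` A) (w x)%:E.

Hypotheses (mphi : measurable_fun setT phi) (mw : measurable_fun setT w).
Hypothesis w0 : forall x, (0 <= w x)%R.
Local Notation nu := (push_density mphi mw w0).

Let nu0 : nu set0 = 0.
Proof. by rewrite /push_density preimage_set0 integral_set0. Qed.

Let nu_ge0 A : 0 <= nu A.
Proof. by apply: integral_ge0 => x _; rewrite lee_fin. Qed.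

Let nu_sigma_additive : semi_sigma_additive nu.
Proof.
move=> F mF tF mUF; rewrite /push_density preimage_bigcup.
have mpre A : measurable A -> measurable (phi @^-1` A).
  by move=> mA; rewrite -[X in measurable X]setTI; exact: mphi.
rewrite ge0_integral_bigcup//=.
- apply: is_cvg_ereal_nneg_natsum_cond => n _ _.
  by apply: integral_ge0 => x _; rewrite lee_fin.
- by move=> k; exact: mpre.
- by apply/measurable_EFinP; exact: measurable_funTS.
- by move=> x _; rewrite lee_fin.
- apply/trivIsetP => /= i j _ _ ij; rewrite -preimage_setI.
  by move/trivIsetP : tF => /(_ _ _ _ _ ij) ->//; rewrite preimage_set0.
Qed.

HB.instance Definition _ := isMeasure.Build _ _ _ nu
  nu0 nu_ge0 nu_sigma_additive.

End push_density.

Lemma measurable_fun_inv_gt0 d (T : measurableType d) (R : realType)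
    (f : T -> R) : (forall x, 0 < f x) -> measurable_fun setT f ->
  measurable_fun setT (fun x => (f x)^-1).
Proof.
move=> f0 mf.
have ml : measurable_fun setT (fun x => - ln (f x)).
  apply: measurable_funN.
  exact: (@measurableT_comp _ _ _ _ _ _ (@ln R) _ f (@measurable_ln R) mf).
rewrite (_ : (fun x => (f x)^-1) = @expR R \o (fun x => - ln (f x))).
  exact: (@measurableT_comp _ _ _ _ _ _ (@expR R) _ _ (@measurable_expR R) ml).
by apply/funext => x; rewrite /= expRN lnK// posrE.
Qed.

Lemma integral_positive_gt0 d (T : measurableType d) (R : realType)
    (mu : {measure set T -> \bar R}) (f : T -> R) (A : set T) :
  measurable_fun setT f -> (forall x, 0 < f x) -> measurable A ->
  (0 < mu A)%E -> (0 < \int[mu]_(x in A) (f x)%:E)%E.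
Proof.
move=> mf f0 mA A0; rewrite lt0e; apply/andP; split; last first.
  by apply: integral_ge0 => x _; rewrite lee_fin ltW.
apply/eqP => i0; move: A0.
have mfE : measurable_fun A (EFin \o f).
  by apply/measurable_EFinP; exact: measurable_funTS.
have : (\int[mu]_(x in A) `|(EFin \o f) x| = 0)%E.
  by rewrite -i0; apply: eq_integral => x _ /=; rewrite ger0_norm// ltW.
move=> /(proj1 (ae_eq_integral_abs mu mA mfE)) [N [mN N0 sub]].
rewrite (@subset_measure0 _ _ _ mu A N)// ?ltxx// => x Ax; apply: sub => /= /(_ Ax) [].
by apply/eqP; rewrite gt_eqF.
Qed.

(** * Monotone rearrangement on the line *)

Section distribution_function.
Local Open Scope ereal_scope.
Context (R : realType).
Variable nu : {measure set (measurableTypeR R) -> \bar R}.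
Hypothesis nu1 : forall x, nu [set x] = 0.
Hypothesis nuoo : nu setT < +oo.
Local Notation F x := (nu (`]-oo, x]%classic : set R)).

Let F_le (x y : R) : (x <= y)%R -> F x <= F y.
Proof.
move=> xy; apply: le_measure; [exact: mem_set|exact: mem_set|move=> z /=].
by rewrite !in_itv/= => /le_trans; apply.
Qed.

Let nu_fin (A : set R) : measurable A -> nu A < +oo.
Proof.
by move=> mA; apply: le_lt_trans nuoo; apply: le_measure => //; exact: mem_set.
Qed.

(** An intermediate value argument: without atoms the distribution function is continuous, and the
    preimage is the supremum of the x with [F x <= v]. This set is nonempty and bounded because F
    tends to 0 and to the total mass at the two ends. *)
Lemma distribution_function_surj (v : \bar R) : 0 < v -> v < nu setT ->
  exists y, F y = v.
Proof.
move=> v0 vnu.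
pose A := [set x | F x <= v].
have A0 : A !=set0.
  apply/not_existsP => An; move: v0; rewrite ltNge => /negP; apply.
  have cF : F (- n%:R)%R @[n --> \oo] --> 0.
    rewrite -(measure0 nu).
    have -> : set0 = \bigcap_n (`]-oo, (- n%:R)%R]%classic : set R).
      apply/esym; rewrite -subset0 => t /(_ (Num.bound t) I).
      by rewrite /= in_itv/= leNgt => /negP; apply; rewrite ltrNl ltrNbound.
    apply: nonincreasing_cvg_mu => //=.
    - exact: nu_fin.
    - exact: bigcap_measurable.
    - move=> m n mn; apply/subsetPset => x/=; rewrite !in_itv => /le_trans; apply.
      by rewrite lerN2 ler_nat.
  apply: (cvge_ge _ cF); apply: nearW => n.
  by rewrite leNgt; apply/negP => /ltW; exact: An.
have [n vn] : exists n, v < F n%:R.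
  apply/not_existsP => An; move: vnu; rewrite ltNge => /negP; apply.
  have cF : F n%:R @[n --> \oo] --> nu setT.
    have <- : \bigcup_n (`]-oo, n%:R]%classic : set R) = setT.
      rewrite -subTset => t _/=.
      by exists (Num.bound t); rewrite //= in_itv/= ltW// ltr_bound.
    apply: nondecreasing_cvg_mu => //; first exact: bigcup_measurable.
    move=> n m nm; apply/subsetPset => x/=; rewrite !in_itv/= => /le_trans.
    by apply; rewrite ler_nat.
  apply: (cvge_le _ cF); apply: nearW => n.
  by rewrite leNgt; apply/negP; exact: An.
have ubA : has_ubound A.
  exists n%:R => x Ax; rewrite leNgt; apply/negP => nx.
  by move: (lt_le_trans vn (le_trans (F_le (ltW nx)) Ax)); rewrite ltxx.
pose y := sup A.
have inv_dec (m k : nat) : (m <= k)%N -> (k.+1%:R^-1 <= m.+1%:R^-1 :> R)%R.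
  by move=> mn; rewrite lef_pV2 ?posrE// ler_nat.
exists y; apply/eqP; rewrite eq_le; apply/andP; split.
(* The absence of atoms replaces the closed ray by the open one, which is the increasing limit of
   rays whose mass is at most [v]. *)
- have -> : F y = nu (`]-oo, y[%classic : set R).
    rewrite -(@setUitv1 _ _ -oo%O y true)//= measureU//; last first.
      by rewrite -subset0 => x /= [] /[swap] ->; rewrite in_itv/= ltxx.
    by rewrite [X in _ + X](nu1 y) adde0.
  have cF : F (y - k.+1%:R^-1)%R @[k --> \oo] --> nu (`]-oo, y[%classic : set R).
    have <- : \bigcup_k (`]-oo, (y - k.+1%:R^-1)%R]%classic : set R) = `]-oo, y[%classic.
      apply/seteqP; split=> [x [k _]|x] /=; rewrite !in_itv/=.
        by move=> /le_lt_trans; apply; rewrite ltrBlDr ltrDl invr_gt0.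
      move=> /ltr_add_invr [k xk]; exists k => //=.
      by rewrite in_itv/= lerBrDr ltW.
    apply: nondecreasing_cvg_mu => //; first exact: bigcup_measurable.
    move=> m1 m2 m12; apply/subsetPset => x/=; rewrite !in_itv/= => /le_trans.
    by apply; rewrite lerD2l lerN2 inv_dec.
  apply: (cvge_le _ cF); apply: nearW => k.
  have [x Ax yx] : exists2 x, A x & (y - k.+1%:R^-1 < x)%R.
    by apply: sup_adherent => //; rewrite ?invr_gt0.
  by apply: le_trans Ax; apply: F_le; exact: ltW.
(* Continuity from the right: the rays beyond the supremum have mass above [v] and decrease to the
   ray at [y]. *)
- have cF : F (y + k.+1%:R^-1)%R @[k --> \oo] --> F y.
    rewrite (itvNycEbigcap false y).
    apply: nonincreasing_cvg_mu => //=.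
    - exact: nu_fin.
    - exact: bigcap_measurable.
    - move=> m1 m2 m12; apply/subsetPset => x/=; rewrite !in_itv/= => /le_trans.
      by apply; rewrite lerD2l inv_dec.
  apply: (cvge_ge _ cF); apply: nearW => k.
  rewrite leNgt; apply/negP => /ltW Ak.
  have : (y + k.+1%:R^-1 <= y)%R by exact: ub_le_sup.
  by rewrite leNgt ltrDl invr_gt0 ltr0n.
Qed.
End distribution_function.

Section cumulative_integral.
Local Open Scope ereal_scope.
Context (R : realType).
Local Notation leb := (@lebesgue_measure R).

Definition cumul (f : R -> R) (x : R) : \bar R :=
  \int[leb]_(s in (`]-oo, x]%classic : set R)) (f s)%:E.

Variable f : R -> R.
Hypotheses (mf : measurable_fun setT f) (f0 : forall x, (0 < f x)%R).

Let mfE (A : set R) : measurable_fun A (EFin \o f).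
Proof. by apply/measurable_EFinP; exact: measurable_funTS. Qed.

Lemma integral_positive_lt (A B : set R) : measurable A -> measurable B ->
  A `<=` B -> 0 < leb (B `\` A) -> \int[leb]_(x in B) (f x)%:E < +oo ->
  \int[leb]_(x in A) (f x)%:E < \int[leb]_(x in B) (f x)%:E.
Proof.
move=> mA mB AB BA Boo.
have mBA : measurable (B `\` A) by exact: measurableD.
have e : \int[leb]_(x in B) (f x)%:E =
    \int[leb]_(x in A) (f x)%:E + \int[leb]_(x in B `\` A) (f x)%:E.
  rewrite -{1}(setDUK AB); apply: ge0_integral_setU => //.
  - exact: mfE.
  - by move=> x _; rewrite lee_fin ltW.
  - by rewrite disj_set2E setDIK.
rewrite e lteDl ?integral_positive_gt0// ge0_fin_numE.
  by apply: le_lt_trans Boo; rewrite e leeDl// integral_ge0// => x _; rewrite lee_fin ltW.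
by apply: integral_ge0 => x _; rewrite lee_fin ltW.
Qed.

Hypothesis foo : \int[leb]_x (f x)%:E < +oo.

Let ioo (A : set R) : measurable A -> \int[leb]_(x in A) (f x)%:E < +oo.
Proof.
move=> mA; apply: le_lt_trans foo; apply: ge0_subset_integral => //.
  exact: mfE.
by move=> x _; rewrite lee_fin ltW.
Qed.

Lemma cumul_gt0 x : 0 < cumul f x.
Proof.
by apply: integral_positive_gt0 => //; rewrite /= lebesgue_measure_itv/= ltNyr addey// ltry.
Qed.

Lemma cumul_lt_total x : cumul f x < \int[leb]_x (f x)%:E.
Proof.
apply: integral_positive_lt => //.
by rewrite setTD setCitvl/= lebesgue_measure_itv/= ltry addye// ltry.
Qed.

Lemma cumul_lt : {mono (cumul f) : x y / (x < y)%R >-> x < y}.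
Proof.
have h x y : (x < y)%R -> cumul f x < cumul f y.
  move=> xy; apply: integral_positive_lt => //; last exact: ioo.
    by move=> z /=; rewrite !in_itv/= => /le_trans; apply; exact: ltW.
  have -> : `]-oo, y]%classic `\` `]-oo, x]%classic = `]x, y]%classic :> set R.
    apply/seteqP; split => z /=; rewrite !in_itv/=.
      by move=> [-> /negP]; rewrite -ltNge => ->.
    by move=> /andP[xz ->]; split => //; apply/negP; rewrite -ltNge.
  by rewrite lebesgue_measure_itv/= lte_fin xy -EFinB lte_fin subr_gt0.
move=> x y; have [xy|xy|->] := ltgtP x y; first exact: h.
  by apply/negbTE; rewrite -leNgt; apply/ltW/h.
by rewrite ltxx.
Qed.

Lemma cumul_surj v : 0 < v -> v < \int[leb]_x (f x)%:E ->
  exists y, cumul f y = v.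
Proof.
move=> v0 voo.
have f0' x : (0 <= f x)%R by exact: ltW.
have m1 x : push_density leb (@measurable_id _ _ setT) mf f0' [set x] = 0.
  by rewrite /push_density preimage_id integral_set1.
have [] := @distribution_function_surj R (push_density leb (@measurable_id _ _ setT) mf f0') m1 _ v v0.
- exact: foo.
- exact: voo.
- by move=> y <-; exists y.
Qed.

End cumulative_integral.

Section monotone_transport.
Local Open Scope ereal_scope.
Context (R : realType).
Local Notation leb := (@lebesgue_measure R).
Variables (f p T : R -> R).
Hypotheses (mf : measurable_fun setT f) (f0 : forall x, (0 < f x)%R).
Hypotheses (mp : measurable_fun setT p) (p0 : forall x, (0 < p x)%R).
Hypothesis foo : \int[leb]_x (f x)%:E < +oo.
Hypothesis fp : \int[leb]_x (f x)%:E = \int[leb]_x (p x)%:E.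
Hypothesis TE : forall x, cumul p (T x) = cumul f x.

Let poo : \int[leb]_x (p x)%:E < +oo. Proof. by rewrite -fp. Qed.
Let f0' x : (0 <= f x)%R. Proof. exact: ltW. Qed.
Let p0' x : (0 <= p x)%R. Proof. exact: ltW. Qed.

(** By [TE], T is the increasing rearrangement of [f] into [p], the quantile function of [p]
    composed with the distribution function of [f]; both are strictly increasing since the densities
    are positive. *)
Lemma transport_lt : {mono T : x y / (x < y)%R}.
Proof. by move=> x y; rewrite -(cumul_lt mp p0 poo) !TE (cumul_lt mf f0 foo). Qed.

Lemma transport_le : {mono T : x y / (x <= y)%R}.
Proof. by move=> x y; rewrite !leNgt transport_lt. Qed.

Lemma transport_surj y : exists x, T x = y.
Proof.
have [||x xy] := cumul_surj mf f0 foo (v := cumul p y).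
- exact: cumul_gt0.
- by rewrite fp; exact: cumul_lt_total.
exists x; apply/eqP; rewrite eq_le !leNgt -!(cumul_lt mp p0 poo) !TE xy.
by rewrite ltxx.
Qed.

Lemma measurable_transport : measurable_fun setT T.
Proof. by apply: nondecreasing_measurable => // x y; rewrite transport_le. Qed.

(** Both sides are finite measures of A. On the ray ending at x = T z they agree, by monotonicity
    and [TE]; hence they agree on half-open intervals, which generate. *)
Lemma transport_push (A : set R) : measurable A ->
  \int[leb]_(x in A) (p x)%:E = \int[leb]_(x in T @^-1` A) (f x)%:E.
Proof.
move=> mA.
pose m1 : {measure set (measurableTypeR R) -> \bar R} :=
  push_density leb (@measurable_id _ _ setT) mp p0'.
pose m2 : {measure set (measurableTypeR R) -> \bar R} :=
  @push_density _ _ _ (measurableTypeR R) R leb T f measurable_transport mf f0'.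
suff: m1 A = m2 A by [].
have m1T (B : set R) : measurable B -> m1 B < +oo.
  move=> mB; apply: le_lt_trans poo; apply: ge0_subset_integral => //.
    exact/measurable_EFinP.
  by move=> x _; rewrite lee_fin.
have ray x : m1 `]-oo, x]%classic = m2 `]-oo, x]%classic.
  have [z zx] := transport_surj x.
  rewrite /m2/= /push_density (_ : T @^-1` _ = `]-oo, z]%classic).
    by rewrite -/(cumul f z) -TE zx.
  apply/seteqP; split=> y /=; rewrite !in_itv/= -zx transport_le//.
have itvD a b : `]a, b]%classic = `]-oo, b]%classic `\` `]-oo, a]%classic :> set R.
  apply/seteqP; split => y /=; rewrite !in_itv/=.
    by move=> /andP[ay ->]; split => //; apply/negP; rewrite -ltNge.
  by move=> [-> /negP]; rewrite -ltNge => ->.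
have H := (@measure_unique _ R (measurableTypeR R) (@ocitv R) (fun n => `](- n%:R)%R, n%:R]%classic)); apply: (H _ _ _ _ m1 m2) => //.
clear H.
- exact: ocitvI.
- by move=> n; exact: is_ocitv.
- apply/seteqP; split => // x _; exists (Num.bound x) => //=.
  by rewrite in_itv/= ltrNl ltrNbound ltW// ltr_bound.
- move=> _ [[a b] _ <-] /=.
  (* The members of [ocitv] include intervals with b < a; the minimum keeps the formula valid for
     these empty ones. *)
  have dif (m : {measure set (measurableTypeR R) -> \bar R}) :
      m `]-oo, b]%classic < +oo -> m `]a, b]%classic =
        m `]-oo, b]%classic - m `]-oo, Num.min b a]%classic.
    move=> mb; rewrite itvD measureD//.
    congr (_ - m _); apply/seteqP; split => y /=; rewrite !in_itv/= le_min.
      by move=> /andP.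
    by move=> /andP.
  by rewrite (dif m1) ?m1T// (dif m2) -?ray ?m1T.
- by move=> n; exact: m1T.
Qed.

(** The quotient plays the part of the derivative of T, in integrated form, so T is never
    differentiated. The proof integrates 1 / p over the image interval against the measure of
    density [p], once along T and once directly. *)
Lemma transport_jacobian (a b : R) : (a <= b)%R ->
  \int[leb]_(x in (`]a, b]%classic : set R)) (f x / p (T x))%:E = (T b - T a)%:E.
Proof.
move=> ab.
pose g (y : R) : \bar R := ((\1_(`]T a, T b]%classic : set R) y) / p y)%:E.
have mg : measurable_fun setT g.
  apply/measurable_EFinP; apply: measurable_funM => //.
  exact: measurable_fun_inv_gt0.
have g0 y : 0 <= g y by rewrite lee_fin divr_ge0.
transitivity (\int[leb]_x (g (T x) * (f x)%:E)).
  rewrite integral_mkcond; apply: eq_integral => x _.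
  rewrite patchE /g indicE.
  have -> : (T x \in (`]T a, T b]%classic : set R)) = (x \in (`]a, b]%classic : set R)).
    by apply/idP/idP => /set_mem /=; rewrite in_itv/= ?transport_lt ?transport_le => h;
      apply/mem_set; rewrite /= in_itv/= ?transport_lt ?transport_le.
  case: ifP => _; last by rewrite mul0r mul0e.
  by rewrite mul1r -EFinM mulrC.
pose m1 : {measure set (measurableTypeR R) -> \bar R} :=
  push_density leb (@measurable_id _ _ setT) mp p0'.
rewrite -(@ge0_integral_density _ _ _ _ _ leb m1 T f measurable_transport mf)//; last first.
  by move=> A mA; rewrite -transport_push.
rewrite (@ge0_integral_density _ _ _ _ _ leb m1 id p)//.
transitivity (\int[leb]_x (\1_(`]T a, T b]%classic : set R) x)%:E).
  by apply: eq_integral => x _; rewrite /g -EFinM divfK// gt_eqF.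
rewrite integral_indic// setIT/= lebesgue_measure_itv/= lte_fin.
by case: ltgtP => //; [rewrite ltNge transport_le ab|move=> ->; rewrite subrr].
Qed.

Lemma measurable_transport_jacobian :
  measurable_fun setT (fun x => f x / p (T x))%R.
Proof.
apply: measurable_funM => //; apply: measurable_fun_inv_gt0 => //.
exact: (measurableT_comp mp measurable_transport).
Qed.

Let S (t x : R) := ((1 - t) * x + t * T x)%R.

Let S_lt (t : R) : (0 <= t <= 1)%R -> {mono S t : x y / (x < y)%R}.
Proof.
move=> /andP[t0 t1].
have h x y : (x < y)%R -> (S t x < S t y)%R.
  move=> xy; have Txy : (T x < T y)%R by rewrite transport_lt.
  rewrite /S; have [->|tn0] := eqVneq t 0%R; first by rewrite !mul0r subr0 !mul1r !addr0.
  by rewrite ler_ltD ?ler_wpM2l ?subr_ge0 ?(ltW xy)// ltr_pM2l// lt0r tn0.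
move=> x y; have [xy|xy|->] := ltgtP x y; first exact: h.
  by apply/negbTE; rewrite -leNgt; apply/ltW/h.
by rewrite ltxx.
Qed.

Let S_le (t : R) : (0 <= t <= 1)%R -> {mono S t : x y / (x <= y)%R}.
Proof. by move=> t01 x y; rewrite !leNgt S_lt. Qed.

Let continuous_S t a b : {within `[a, b], continuous (S t)}.
Proof.
have cT : {within `[a, b], continuous T}.
  apply: segment_inc_surj_continuous => [x y _ _|y /=]; first exact: transport_le.
  have [x <-] := transport_surj y.
  by rewrite !in_itv/= !transport_le => xab; exists x => //=; rewrite in_itv.
have cid : {within `[a, b], continuous (id : R -> R)}.
  by apply: continuous_subspaceT => x; exact: cvg_id.
move=> x; apply: cvgD.
  by apply: cvgM; [exact: cvg_cst|exact: cid].
by apply: cvgM; [exact: cvg_cst|exact: cT].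
Qed.

(** If T x = y, then T y lies on the other side of y from x, so the values of [S t] at x and at y
    enclose y, and the intermediate value theorem applies between x and y. *)
Let S_surj (t y : R) : (0 <= t <= 1)%R -> exists x, S t x = y.
Proof.
move=> t01; have /andP[t0 t1] := t01.
have [x Tx] := transport_surj y.
have [xy|/ltW yx] := leP x y.
- have [|c _ cy] := @IVT R (S t) x y y xy (@continuous_S t x y); last by exists c.
  have Ty : (y <= T y)%R by rewrite -[leLHS]Tx transport_le.
  by rewrite ge_min le_max /S Tx; apply/andP; split; apply/orP; [left|right]; nra.
- have [|c _ cy] := @IVT R (S t) y x y yx (@continuous_S t y x); last by exists c.
  have Ty : (T y <= y)%R by rewrite -[leRHS]Tx transport_le.
  by rewrite ge_min le_max /S Tx; apply/andP; split; apply/orP; [left|right]; nra.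
Qed.

(** The weight is the integrated derivative of [S t]: by [transport_jacobian], the image under [S t]
    of Lebesgue measure with this weight gives each half-open interval its length, so it is Lebesgue
    measure. At t = 1 this is the change of variables along T itself. *)
Lemma transport_change (t : R) (F : R -> \bar R) : (0 <= t <= 1)%R ->
  measurable_fun setT F -> (forall x, 0 <= F x) ->
  \int[leb]_x (F ((1 - t) * x + t * T x)%R * ((1 - t) + t * (f x / p (T x)))%:E) =
  \int[leb]_x F x.
Proof.
move=> t01 mF F0; have /andP[t0 t1] := t01.
pose w x := ((1 - t) + t * (f x / p (T x)))%R.
have mw : measurable_fun setT w.
  by apply: measurable_funD => //; apply: measurable_funM => //; exact: measurable_transport_jacobian.
have w0 x : (0 <= w x)%R.
  by rewrite addr_ge0 ?subr_ge0// mulr_ge0// divr_ge0.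
have mS : measurable_fun setT (S t).
  by apply: nondecreasing_measurable => // x y; rewrite S_le.
rewrite -(@ge0_integral_density _ _ _ (measurableTypeR R) R leb leb (S t) w mS mw w0)//.
move=> A mA.
pose m := @push_density _ _ _ (measurableTypeR R) R leb (S t) w mS mw w0.
apply: (@lebesgue_measure_unique R m) => // _ [[a b] _ <-] /=.
have [a' Sa] := S_surj a t01; have [b' Sb] := S_surj b t01.
rewrite /m /push_density lebesgue_measure_itv/= lte_fin -Sa -Sb S_lt//.
rewrite (_ : _ @^-1` _ = `]a', b']%classic); last first.
  by apply/seteqP; split => x /=; rewrite !in_itv/= S_lt// S_le.
case: ifPn => [ab|]; last first.
  by rewrite -leNgt => ba; rewrite set_itv_ge ?bnd_simp -?leNgt// integral_set0.
under eq_integral do rewrite EFinD EFinM.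
rewrite ge0_integralD//=; last 3 first.
- by move=> x _; rewrite lee_fin subr_ge0.
- by move=> x _; rewrite -EFinM lee_fin mulr_ge0// divr_ge0.
- apply/measurable_EFinP; apply: measurable_funTS; apply: measurable_funM => //.
  exact: measurable_transport_jacobian.
rewrite integral_cst//= ge0_integralZl//=; last 2 first.
- by apply/measurable_EFinP; apply: measurable_funTS; exact: measurable_transport_jacobian.
- by move=> x _; rewrite lee_fin divr_ge0.
rewrite transport_jacobian ?ltW// lebesgue_measure_itv/= lte_fin ab.
rewrite -?EFinB -?EFinM -?EFinD. by congr (_%:E); rewrite /S; ring.
Qed.

End monotone_transport.

Lemma measurable_fun_integral_param d d' (Th : measurableType d)
    (T : measurableType d') (R : realType)
    (mu : {sigma_finite_measure set T -> \bar R}) (f : Th * T -> \bar R) :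
  measurable_fun setT f -> (forall z, 0 <= f z)%E ->
  measurable_fun setT (fun th => \int[mu]_x f (th, x))%E.
Proof. by move=> mf f0; exact: measurable_fun_fubini_tonelli_F. Qed.

Section measurable_integral.
Local Open Scope ereal_scope.
Context d (Th : measurableType d) (R : realType).

(** Joint measurability in the parameter and the endpoint: the moving domain is absorbed into an
    indicator, and Tonelli applies on the whole line. *)
Lemma measurable_cumul_param (f : Th * R -> R) :
  measurable_fun setT f -> (forall z, (0 <= f z)%R) ->
  measurable_fun setT (fun z => cumul (fun x => f (z.1, x)) z.2).
Proof.
move=> mf f0.
pose g (z : (Th * R) * R) : \bar R :=
  (f (z.1.1, z.2) * \1_[set u : (Th * R) * R | (u.2 <= u.1.2)%R] z)%:E.
rewrite (_ : (fun z => _) = fun z => \int[@lebesgue_measure R]_x g (z, x)); last first.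
  apply/funext => -[th y]; rewrite /cumul integral_mkcond.
  apply: eq_integral => x _; rewrite patchE /g indicE/=.
  have -> : (x \in (`]-oo, y]%classic : set R)) = (((th, y), x) \in [set u : (Th * R) * R | (u.2 <= u.1.2)%R]).
    by apply/idP/idP => /set_mem /=; rewrite ?in_itv/= => h; apply/mem_set; rewrite /= ?in_itv.
  by case: ifP => _; rewrite ?mulr1 ?mulr0.
apply: (@measurable_fun_integral_param _ _ _ (measurableTypeR R) _ (@lebesgue_measure R) g); last first.
  by move=> z; rewrite lee_fin mulr_ge0.
apply/measurable_EFinP; apply: measurable_funM.
  apply: (measurableT_comp mf).
  apply: measurable_fun_pair => //; exact: measurableT_comp.
apply: measurable_indic.
rewrite -[X in measurable X]setTI.
have := @measurable_fun_ler _ _ R setT (fun u : (Th * R) * R => u.2) (fun u => u.1.2).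
move=> /(_ _ _ measurableT [set true]) H.
have e : (fun x : Th * R * R => (x.2 <= x.1.2)%R) @^-1` [set true] =
  [set u : (Th * R) * R | (u.2 <= u.1.2)%R] by [].
rewrite -e; apply: H => //; exact: measurableT_comp.
Qed.

End measurable_integral.

(** * Monotone rearrangement depending measurably on a parameter *)

Section rearrangement.
Local Open Scope ereal_scope.
Context d (Th : measurableType d) (R : realType).
Local Notation leb := (@lebesgue_measure R).

(** Boolean, so that maps can be defined by cases on it. In the recursion on coordinates the
    functions to be transported have equal finite masses for almost every parameter only, while the
    maps must exist for all of them. *)
Definition same_mass d' (T : measurableType d')
    (mu : {measure set T -> \bar R}) (f p : Th * T -> R) (th : Th) : bool :=
  (\int[mu]_x (f (th, x))%:E == \int[mu]_x (p (th, x))%:E) &&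
  (\int[mu]_x (f (th, x))%:E < +oo).

Lemma measurable_same_mass d' (T : measurableType d')
    (mu : {sigma_finite_measure set T -> \bar R}) (f p : Th * T -> R) :
  measurable_fun setT f -> measurable_fun setT p ->
  (forall z, (0 <= f z)%R) -> (forall z, (0 <= p z)%R) ->
  measurable_fun setT (same_mass mu f p).
Proof.
move=> mf mp f0 p0.
have mi (h : Th * T -> R) : measurable_fun setT h -> (forall z, (0 <= h z)%R) ->
    measurable_fun setT (fun th => \int[mu]_x (h (th, x))%:E).
  move=> mh h0; apply: (@measurable_fun_integral_param _ _ _ T _ mu (EFin \o h)).
    exact/measurable_EFinP.
  by move=> z; rewrite lee_fin.
apply: measurable_and; first by apply: measurable_fun_eqe; exact: mi.
by apply: measurable_fun_lte => //; exact: mi.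
Qed.

Lemma monotone_rearrangement (f p : Th * R -> R) :
  measurable_fun setT f -> measurable_fun setT p ->
  (forall z, (0 < f z)%R) -> (forall z, (0 < p z)%R) ->
  exists T J : Th * R -> R, [/\ measurable_fun setT T, measurable_fun setT J,
    forall z, (0 < J z)%R,
    forall th x, same_mass leb f p th -> f (th, x) = (p (th, T (th, x)) * J (th, x))%R &
    forall th (t : R) (F : R -> \bar R), (0 <= t <= 1)%R ->
      measurable_fun setT F -> (forall x, 0 <= F x) ->
      \int[leb]_x (F ((1 - t) * x + t * T (th, x))%R * ((1 - t) + t * J (th, x))%:E) =
      \int[leb]_x F x].
Proof.
move=> mf mp f0 p0.
have mfst (h : Th * R -> R) th : measurable_fun setT h -> measurable_fun setT (fun x => h (th, x)).
  by move=> mh; exact: (measurableT_comp mh (pair1_measurable th)).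
pose cf (z : Th * R) := cumul (fun x => f (z.1, x)) z.2.
pose cp (z : Th * R) := cumul (fun x => p (z.1, x)) z.2.
have mcf : measurable_fun setT cf by apply: measurable_cumul_param => // z; exact: ltW.
have mcp : measurable_fun setT cp by apply: measurable_cumul_param => // z; exact: ltW.
pose good th := same_mass leb f p th.
have mgood : measurable_fun setT good.
  by apply: measurable_same_mass => // z; exact: ltW.
(* For a bad parameter T is the identity and J is 1, so that the change of variables in the last
   clause holds for every parameter. *)
pose T (z : Th * R) : R :=
  if good z.1 then xget 0%R [set y | cp (z.1, y) = cf z] else z.2.
pose J (z : Th * R) : R := if good z.1 then (f z / p (z.1, T z))%R else 1%R.
have TE th x : good th -> cp (th, T (th, x)) = cf (th, x).
  move=> gth; rewrite /T /= gth; case: xgetP => [y -> //|noy].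
  have /andP[/eqP fp foo] := gth.
  have poo : \int[leb]_x (p (th, x))%:E < +oo by rewrite -fp.
  have [||y cy] := cumul_surj (mfst p th mp) (fun x => p0 (th, x)) poo (v := cf (th, x)).
  - exact: (cumul_gt0 (mfst f th mf) (fun x => f0 (th, x))).
  - rewrite -fp; exact: (cumul_lt_total (mfst f th mf) (fun x => f0 (th, x)) foo).
  - by case: (noy y).
have mT : measurable_fun setT T.
  apply: (measurability (@RGenCInfty.G R)) => [|/= _ [_] [b] -> <-].
    exact: RGenCInfty.measurableE.
  (* Measurability of the selection [xget] is not examined directly: for a good parameter, T >= b is
     equivalent to an inequality between the two distribution functions, which are jointly
     measurable. *)
  pose B (z : Th * R) := if good z.1 then (cp (z.1, b) <= cf z) else (b <= z.2)%R.
  have -> : T @^-1` `[b, +oo[ = B @^-1` [set true].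
    apply/seteqP; rewrite -eqEsubset; apply/funext => -[th x].
    rewrite /B /= in_itv/= andbT; apply/propext; case: ifPn => gth; last first.
      by rewrite /T /= (negbTE gth).
    have /andP[/eqP fp foo] := gth.
    have poo : \int[leb]_x (p (th, x))%:E < +oo by rewrite -fp.
    by rewrite -TE// !leNgt (cumul_lt (mfst p th mp) (fun x => p0 (th, x)) poo).
  have mB : measurable_fun setT B.
    apply: measurable_fun_ifT.
    - exact: (measurableT_comp mgood measurable_fst).
    - apply: measurable_fun_lee => //; apply: (measurableT_comp mcp).
      exact: measurable_fun_pair.
    - exact: measurable_fun_ler.
  exact: mB.
have mpT : measurable_fun setT (fun z : Th * R => p (z.1, T z)).
  by apply: (measurableT_comp mp); apply: measurable_fun_pair.
exists T, J; split => //.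
- apply: measurable_fun_ifT => //.
    exact: (measurableT_comp mgood measurable_fst).
  by apply: measurable_funM => //; apply: measurable_fun_inv_gt0.
- by move=> z; rewrite /J; case: ifP => // _; rewrite divr_gt0.
- move=> th x; rewrite -/(good th) => gth; rewrite /J /= gth mulrCA divff ?mulr1// gt_eqF//.
- move=> th t F t01 mF F0.
  have [gth|gth] := boolP (good th); last first.
    apply: eq_integral => x _.
    rewrite /J /T /= (negbTE gth) mulr1 subrK mule1; congr F; ring.
  have /andP[/eqP fp foo] := gth.
  rewrite -[RHS](transport_change (mfst f th mf) (fun x => f0 (th, x))
    (mfst p th mp) (fun x => p0 (th, x)) foo fp (fun x => TE th x gth) t01 mF F0).
  by apply: eq_integral => x _; rewrite /J /= gth.
Qed.
End rearrangement.

(** * The Knothe-Rosenblatt map *)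

Section rV_cons_integral.
Local Open Scope ereal_scope.
Context (R : realType) (n : nat).
Local Notation leb := (@lebesgue_measure R).

Definition rV_tail (x : 'rV[R]_n.+1) : 'rV[R]_n := \row_j x ord0 (lift ord0 j).

Lemma rV_tail_cons (a : R) (v : 'rV[R]_n) : rV_tail (rV_cons (a, v)) = v.
Proof. by apply/rowP => j; rewrite mxE rV_consS. Qed.

Lemma rV_consK (x : 'rV[R]_n.+1) : rV_cons (x ord0 ord0, rV_tail x) = x.
Proof.
apply/rowP => i; case: (unliftP ord0 i) => [j|] ->.
  by rewrite rV_consS mxE.
by rewrite rV_cons0.
Qed.

Lemma measurable_rV_tail : measurable_fun setT rV_tail.
Proof.
apply/measurable_fun_rVP => i; under eq_fun do rewrite mxE.
exact: measurable_rV_coord.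
Qed.

Lemma measurable_fun_rV_cons d (T : measurableType d) (a : T -> R)
    (v : T -> 'rV[R]_n) : measurable_fun setT a -> measurable_fun setT v ->
  measurable_fun setT (fun x => rV_cons (a x, v x)).
Proof.
move=> ma mv; apply: (measurableT_comp (@measurable_rV_cons R n)).
exact: measurable_fun_pair.
Qed.

Lemma ge0_integral_rV_cons (F : 'rV[R]_n.+1 -> \bar R) :
  measurable_fun setT F -> (forall x, 0 <= F x) ->
  \int[lebesgue_rV R n.+1]_x F x =
  \int[leb]_a \int[lebesgue_rV R n]_v F (rV_cons (a, v)).
Proof.
move=> mF F0.
have mc := @measurable_rV_cons R n.
rewrite (@ge0_integral_density _ _ _ _ R (leb \x lebesgue_rV R n) (lebesgue_rV R n.+1) _ (cst 1%R) mc)//.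
  under eq_integral do rewrite mule1.
  by rewrite fubini_tonelli1//; apply: (measurableT_comp mF).
move=> A mA; rewrite (integral_cst _ _ 1%:E)/= ?mul1e//.
by rewrite -[X in measurable X]setTI; exact: mc.
Qed.

Lemma ae_rV_cons (P : set 'rV[R]_n.+1) : measurable P ->
  {ae leb, forall a, {ae lebesgue_rV R n, forall v, P (rV_cons (a, v))}} ->
  {ae lebesgue_rV R n.+1, forall x, P x}.
Proof.
move=> mP aeP; exists (~` P); split => //; first exact: measurableC.
have mPc : measurable (~` P) by exact: measurableC.
have m1 : measurable_fun setT (fun x => (\1_(~` P) x)%:E : \bar R).
  exact/measurable_EFinP/measurable_indic.
have -> : lebesgue_rV R n.+1 (~` P) = \int[lebesgue_rV R n.+1]_x (\1_(~` P) x)%:E.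
  by rewrite integral_indic// setIT.
rewrite ge0_integral_rV_cons//.
rewrite (@ae_eq_integral _ _ _ _ setT (cst 0))//.
- by rewrite integral_cst// mul0e.
- apply: (@measurable_fun_fubini_tonelli_F _ _ (measurableTypeR R) _ _ (lebesgue_rV R n)
    (fun z => (\1_(~` P) (rV_cons (z.1, z.2)))%:E)) => //.
  apply: (measurableT_comp m1); exact: measurable_fun_rV_cons.
- apply: (@filterS _ _ (ae_filter_ringOfSetsType (@lebesgue_measure R)) _ _ _ aeP) => a aePa _.
  rewrite (@ae_eq_integral _ _ _ _ setT (cst 0))//.
  + by rewrite integral_cst// mul0e.
  + by apply: (measurableT_comp m1); apply: measurable_fun_rV_cons.
  + by apply: filterS aePa => v Pv _; rewrite indicE memNset//=; apply: contrapT.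
Qed.

Lemma lebesgue_rV_setT_gt0 : 0 < lebesgue_rV R n setT.
Proof.
have := @lebesgue_rV_box R n (fun=> setT) (fun=> measurableT).
rewrite (_ : [set v | _] = setT); last by apply/seteqP; split.
move=> ->; apply: (big_ind (fun x : \bar R => 0 < x)) => [|x y|i _].
- exact: lte01.
- exact: mule_gt0.
- rewrite -set_itvNyy lebesgue_measure_itv/=; exact: ltry.
Qed.

End rV_cons_integral.

Section knothe_rosenblatt.
Local Open Scope ereal_scope.
Context (R : realType).
Local Notation leb := (@lebesgue_measure R).

(** A separate weight for each coordinate: the weight lambda on one block and 0 elsewhere produces
    S_m, and an induction on coordinates can peel off one weight at a time. *)
Definition mix n (t x y : 'rV[R]_n) : 'rV[R]_n :=
  \row_i ((1 - t ord0 i) * x ord0 i + t ord0 i * y ord0 i)%R.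

(** The determinant of the derivative of the mixed map when DT is triangular with diagonal [J]: the
    off-diagonal entries do not contribute. *)
Definition mix_jacobian n (t J : 'rV[R]_n) : R :=
  (\prod_i ((1 - t ord0 i) + t ord0 i * J ord0 i))%R.

Lemma mix_rV_cons n (t : 'rV[R]_n.+1) (a b : R) (x y : 'rV[R]_n) :
  mix t (rV_cons (a, x)) (rV_cons (b, y)) =
  rV_cons (((1 - t ord0 ord0) * a + t ord0 ord0 * b)%R, mix (rV_tail t) x y).
Proof.
apply/rowP => i; rewrite mxE; case: (unliftP ord0 i) => [j|] ->.
  by rewrite !rV_consS !mxE.
by rewrite !rV_cons0.
Qed.

Lemma mix_jacobian_rV_cons n (t : 'rV[R]_n.+1) (a : R) (J : 'rV[R]_n) :
  mix_jacobian t (rV_cons (a, J)) =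
  ((1 - t ord0 ord0 + t ord0 ord0 * a) * mix_jacobian (rV_tail t) J)%R.
Proof.
rewrite /mix_jacobian big_ord_recl rV_cons0; congr (_ * _)%R.
by apply: eq_bigr => i _; rewrite rV_consS mxE.
Qed.

(* J is the diagonal of the triangular Jacobian matrix of T. The last clause is
   the change of variables along x |-> (1 - t) x + t T x, with one t per
   coordinate. *)
Definition is_knothe d (Th : measurableType d) n
    (f p : Th * 'rV[R]_n -> R) (T J : Th * 'rV[R]_n -> 'rV[R]_n) :=
  [/\ measurable_fun setT T, measurable_fun setT J,
    forall z i, (0 < J z ord0 i)%R,
    forall th, same_mass (lebesgue_rV R n) f p th ->
      {ae lebesgue_rV R n, forall x,
        f (th, x) = (p (th, T (th, x)) * \prod_i J (th, x) ord0 i)%R} &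
    forall th (t : 'rV[R]_n) (F : 'rV[R]_n -> \bar R),
      (forall i, (0 <= t ord0 i <= 1)%R) ->
      measurable_fun setT F -> (forall x, 0 <= F x) ->
      \int[lebesgue_rV R n]_x
        (F (mix t x (T (th, x))) * (mix_jacobian t (J (th, x)))%:E) =
      \int[lebesgue_rV R n]_x F x].

Lemma measurable_mix d (T : measurableType d) n (t : 'rV[R]_n) (x y : T -> 'rV[R]_n) :
  measurable_fun setT x -> measurable_fun setT y ->
  measurable_fun setT (fun z => mix t (x z) (y z)).
Proof.
move=> mx my; apply/measurable_fun_rVP => i; under eq_fun do rewrite mxE.
by apply: measurable_funD; apply: measurable_funM => //;
  [exact: (measurableT_comp (measurable_rV_coord i) mx)
  |exact: (measurableT_comp (measurable_rV_coord i) my)].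
Qed.

Lemma measurable_mix_jacobian d (T : measurableType d) n (t : 'rV[R]_n) (J : T -> 'rV[R]_n) :
  measurable_fun setT J -> measurable_fun setT (fun z => mix_jacobian t (J z)).
Proof.
move=> mJ; apply: measurable_prod => i _; apply: measurable_funD => //.
by apply: measurable_funM => //; exact: (measurableT_comp (measurable_rV_coord i) mJ).
Qed.

Lemma mix_jacobian_ge0 n (t J : 'rV[R]_n) : (forall i, (0 <= t ord0 i <= 1)%R) ->
  (forall i, (0 < J ord0 i)%R) -> (0 <= mix_jacobian t J)%R.
Proof.
move=> t01 J0; apply: prodr_ge0 => i _; have /andP[t0 t1] := t01 i.
by rewrite addr_ge0 ?subr_ge0// mulr_ge0// ltW.
Qed.

(** Induction on the dimension. The first coordinate is moved by the monotone rearrangement of the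
    first marginals; the others are moved by the induction hypothesis, with the first coordinate
    joined to the parameter. This is why the statement carries an arbitrary parameter space. *)
Lemma knothe_rosenblatt n d (Th : measurableType d) (f p : Th * 'rV[R]_n -> R) :
  measurable_fun setT f -> measurable_fun setT p ->
  (forall z, (0 < f z)%R) -> (forall z, (0 < p z)%R) ->
  exists T J, is_knothe f p T J.
Proof.
elim: n d Th f p => [|n IH] d Th f p mf mp f0 p0.
  exists (fun=> 0%R), (fun=> 0%R); split => //.
  - by move=> z [].
  - move=> th; rewrite /same_mass => /andP[/eqP fp _]; apply: aeW => x.
    rewrite big_ord0 mulr1.
    have iE (h : Th * 'rV[R]_0 -> R) : measurable_fun setT h ->
        \int[lebesgue_rV R 0]_x (h (th, x))%:E = (h (th, x))%:E.
      move=> mh; rewrite /= integral_dirac// ?diracT ?mul1e ?(thinmx0 x)//.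
      by apply/measurable_EFinP; exact: (measurableT_comp mh (pair1_measurable th)).
    by move: fp; rewrite !iE// => -[->]; rewrite (thinmx0 x).
  - move=> th t F t01 mF F0; apply: eq_integral => x _.
    by rewrite /mix_jacobian big_ord0 mule1; congr F; rewrite thinmx0 [RHS]thinmx0.
have mfst d1 d2 d3 (X : measurableType d1) (Y : measurableType d2) (Z : measurableType d3)
    (h : X * Y -> Z) x : measurable_fun setT h -> measurable_fun setT (fun y => h (x, y)).
  by move=> mh; exact: (measurableT_comp mh (pair1_measurable x)).
pose marg (h : Th * 'rV[R]_n.+1 -> R) (z : Th * R) : \bar R :=
  \int[lebesgue_rV R n]_v (h (z.1, rV_cons (z.2, v)))%:E.
(* The value 1 where the marginal is infinite keeps the function real and positive for every
   parameter. *)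
pose margr h z : R := if marg h z < +oo then fine (marg h z) else 1%R.
have mhc (h : Th * 'rV[R]_n.+1 -> R) : measurable_fun setT h ->
    measurable_fun setT (fun z : (Th * R) * 'rV[R]_n => h (z.1.1, rV_cons (z.1.2, z.2))).
  move=> mh; apply: (measurableT_comp mh); apply: measurable_fun_pair.
    exact: (measurableT_comp measurable_fst measurable_fst).
  apply: measurable_fun_rV_cons => //.
  exact: (measurableT_comp measurable_snd measurable_fst).
have marg_gt0 (h : Th * 'rV[R]_n.+1 -> R) z : measurable_fun setT h -> (forall z, (0 < h z)%R) -> 0 < marg h z.
  move=> mh h0; apply: integral_positive_gt0 => //; last exact: lebesgue_rV_setT_gt0.
  exact: (mfst _ _ _ _ _ _ _ z (mhc h mh)).
have margrE (h : Th * 'rV[R]_n.+1 -> R) z : measurable_fun setT h -> (forall z, (0 < h z)%R) ->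
    marg h z < +oo -> (margr h z)%:E = marg h z.
  move=> mh h0 hoo; rewrite /margr hoo fineK// ge0_fin_numE//.
  exact/ltW/marg_gt0.
have margr_gt0 (h : Th * 'rV[R]_n.+1 -> R) z : measurable_fun setT h -> (forall z, (0 < h z)%R) -> (0 < margr h z)%R.
  move=> mh h0; rewrite -lte_fin; have [hoo|hoo] := boolP (marg h z < +oo).
    by rewrite margrE// marg_gt0.
  by rewrite /margr (negbTE hoo) lte_fin.
have mmarg (h : Th * 'rV[R]_n.+1 -> R) : measurable_fun setT h -> (forall z, (0 < h z)%R) -> measurable_fun setT (marg h).
  move=> mh h0.
  apply: (@measurable_fun_integral_param _ _ _ _ _ (lebesgue_rV R n)
    (fun z : (Th * R) * 'rV[R]_n => (h (z.1.1, rV_cons (z.1.2, z.2)))%:E)).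
    by apply/measurable_EFinP; exact: mhc.
  by move=> z; rewrite lee_fin ltW.
have mmargr (h : Th * 'rV[R]_n.+1 -> R) : measurable_fun setT h -> (forall z, (0 < h z)%R) -> measurable_fun setT (margr h).
  move=> mh h0; apply: measurable_fun_ifT => //.
    by apply: measurable_fun_lte => //; exact: mmarg.
  apply: (measurableT_comp (fine_measurable _)) => //; exact: mmarg.
have [T0 [J0 [mT0 mJ0 J0_gt0 T0E T0S]]] := monotone_rearrangement
  (mmargr f mf f0) (mmargr p mp p0)
  (fun z => margr_gt0 f z mf f0) (fun z => margr_gt0 p z mp p0).
(* The conditional densities of the tail given the first coordinate, cross-multiplied by the other
   marginal instead of divided by their own: where the marginals are finite, both have the product
   of the two marginals as total mass. *)
pose f' (z : (Th * R) * 'rV[R]_n) : R :=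
  (f (z.1.1, rV_cons (z.1.2, z.2)) * margr p (z.1.1, T0 z.1))%R.
pose p' (z : (Th * R) * 'rV[R]_n) : R :=
  (p (z.1.1, rV_cons (T0 z.1, z.2)) * margr f z.1)%R.
have mf' : measurable_fun setT f'.
  apply: measurable_funM; first exact: mhc.
  apply: (measurableT_comp (mmargr p mp p0)); apply: measurable_fun_pair.
    exact: (measurableT_comp measurable_fst measurable_fst).
  exact: (measurableT_comp mT0 measurable_fst).
have mp' : measurable_fun setT p'.
  apply: measurable_funM.
    apply: (measurableT_comp mp); apply: measurable_fun_pair.
      exact: (measurableT_comp measurable_fst measurable_fst).
    apply: measurable_fun_rV_cons => //.
    exact: (measurableT_comp mT0 measurable_fst).
  exact: (measurableT_comp (mmargr f mf f0) measurable_fst).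
have f'0 z : (0 < f' z)%R by rewrite mulr_gt0// margr_gt0.
have p'0 z : (0 < p' z)%R by rewrite mulr_gt0// margr_gt0.
have [T' [J' [mT' mJ' J'_gt0 T'E T'S]]] := IH _ _ f' p' mf' mp' f'0 p'0.
pose split (z : Th * 'rV[R]_n.+1) := ((z.1, z.2 ord0 ord0), rV_tail z.2).
have msplit1 : measurable_fun setT (fun z => (split z).1).
  apply: measurable_fun_pair => //.
  exact: (measurableT_comp (measurable_rV_coord _) measurable_snd).
have msplit : measurable_fun setT split.
  apply: measurable_fun_pair => //.
  exact: (measurableT_comp (@measurable_rV_tail _ _) measurable_snd).
pose T z := rV_cons (T0 (split z).1, T' (split z)).
pose J z := rV_cons (J0 (split z).1, J' (split z)).
have splitE th a v : split (th, rV_cons (a, v)) = ((th, a), v).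
  by rewrite /split/= rV_cons0 rV_tail_cons.
have mT : measurable_fun setT T.
  apply: measurable_fun_rV_cons; [exact: (measurableT_comp mT0)|exact: (measurableT_comp mT')].
have mJ : measurable_fun setT J.
  apply: measurable_fun_rV_cons; [exact: (measurableT_comp mJ0)|exact: (measurableT_comp mJ')].
exists T, J; split => //.
- move=> z i; rewrite /J; case: (unliftP ord0 i) => [j|] ->.
    by rewrite rV_consS; exact: J'_gt0.
  by rewrite rV_cons0; exact: J0_gt0.
- move=> th gth; have /andP[/eqP fp foo] := gth.
  have aeL := ae_filter_ringOfSetsType (@lebesgue_measure R).
  have poo : \int[lebesgue_rV R n.+1]_x (p (th, x))%:E < +oo by rewrite -fp.
  have tot (h : Th * 'rV[R]_n.+1 -> R) : measurable_fun setT h -> (forall z, (0 < h z)%R) ->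
      \int[lebesgue_rV R n.+1]_x (h (th, x))%:E = \int[leb]_a marg h (th, a).
    move=> mh h0; rewrite ge0_integral_rV_cons//.
      by apply/measurable_EFinP; exact: mfst.
    by move=> x; rewrite lee_fin ltW.
  have fin_ae (h : Th * 'rV[R]_n.+1 -> R) : measurable_fun setT h -> (forall z, (0 < h z)%R) ->
      \int[lebesgue_rV R n.+1]_x (h (th, x))%:E < +oo ->
      {ae leb, forall a, marg h (th, a) < +oo}.
    move=> mh h0 hoo.
    have ih : leb.-integrable setT (fun a => marg h (th, a)).
      apply/integrableP; split; first exact: (mfst _ _ _ _ _ _ _ th (mmarg h mh h0)).
      rewrite (_ : \int[leb]_a `|marg h (th, a)| = \int[leb]_a marg h (th, a)) -?tot//.
      by rewrite tot//; apply: eq_integral => a _; rewrite gee0_abs// ltW// marg_gt0.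
    apply: (@filterS _ _ aeL _ _ _ (integrable_ae measurableT ih)) => a /(_ I).
    by rewrite ge0_fin_numE// ltW// marg_gt0.
  have totr (h : Th * 'rV[R]_n.+1 -> R) : measurable_fun setT h -> (forall z, (0 < h z)%R) ->
      \int[lebesgue_rV R n.+1]_x (h (th, x))%:E < +oo ->
      \int[leb]_a (margr h (th, a))%:E = \int[leb]_a marg h (th, a).
    move=> mh h0 hoo; apply: ge0_ae_eq_integral => //.
    - by apply/measurable_EFinP; exact: (mfst _ _ _ _ _ _ _ th (mmargr h mh h0)).
    - exact: (mfst _ _ _ _ _ _ _ th (mmarg h mh h0)).
    - by move=> a _; rewrite lee_fin ltW// margr_gt0.
    - by move=> a _; rewrite ltW// marg_gt0.
    - by apply: (@filterS _ _ aeL _ _ _ (fin_ae h mh h0 hoo)) => a ha _; exact: margrE.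
  have g0 : same_mass leb (margr f) (margr p) th.
    by rewrite /same_mass !totr// -!tot// fp eqxx.
  (* The marginal of [p] is finite almost everywhere, but it is needed at T0 a. The change of
     variables with t = 1 gives the preimage of the exceptional set zero integral against J0, and J0
     > 0, so the preimage is null. *)
  have aepT : {ae leb, forall a, marg p (th, T0 (th, a)) < +oo}.
    pose N := [set y | marg p (th, y) < +oo].
    have mN : measurable N.
      rewrite -[X in measurable X]setTI.
      have mb : measurable_fun setT (fun y => marg p (th, y) < +oo).
        by apply: measurable_fun_lte => //; exact: (mfst _ _ _ _ _ _ _ th (mmarg p mp p0)).
      exact: (mb measurableT [set true]).
    have mNc : measurable (~` N) by exact: measurableC.
    have N0 : leb (~` N) = 0.
      by apply: measure_negligible => //; exact: fin_ae.
    have m1 : measurable_fun setT (fun y : R => (\1_(~` N) y)%:E : \bar R).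
      exact/measurable_EFinP/measurable_indic.
    pose h (a : R) : \bar R := (\1_(~` N) (T0 (th, a)) * J0 (th, a))%:E.
    have mh : measurable_fun setT h.
      apply/measurable_EFinP; apply: measurable_funM.
        apply: (measurableT_comp (measurable_indic mNc)); exact: mfst.
      exact: mfst.
    have : \int[leb]_a `|h a| = 0.
      transitivity (\int[leb]_y (\1_(~` N) y)%:E : \bar R).
        have F0N y : 0 <= (\1_(~` N) y)%:E :> \bar R by rewrite lee_fin.
        have t01 : (0 <= (1 : R) <= 1)%R by rewrite ler01 lexx.
        rewrite -(T0S th 1%R _ t01 m1 F0N).
        apply: eq_integral => a _; rewrite subrr mul0r mul1r !add0r mul1r -EFinM.
        by rewrite gee0_abs// lee_fin mulr_ge0// ltW.
      by rewrite integral_indic// setIT.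
    move=> /(proj1 (ae_eq_integral_abs leb measurableT mh)) h0.
    apply: (@filterS _ _ aeL _ _ _ h0) => a /(_ I) /=.
    rewrite /h => -[] /eqP; rewrite mulf_eq0 (gt_eqF (J0_gt0 _)) orbF indicE.
    have [_|] := boolP (T0 (th, a) \in ~` N); first by rewrite oner_eq0.
    by rewrite notin_setE => /contrapT.
  pose P := [set x | f (th, x) = (p (th, T (th, x)) * \prod_i J (th, x) ord0 i)%R].
  have mJi i : measurable_fun setT (fun x => J (th, x) ord0 i).
    exact: (measurableT_comp (measurable_rV_coord i) (mfst _ _ _ _ _ _ _ th mJ)).
  have mpT : measurable_fun setT (fun x => p (th, T (th, x))).
    exact: (measurableT_comp (mfst _ _ _ _ _ _ _ th mp) (mfst _ _ _ _ _ _ _ th mT)).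
  have mP : measurable P.
    rewrite -[X in measurable X]setTI.
    have -> : P = (fun x => f (th, x) == (p (th, T (th, x)) * \prod_i J (th, x) ord0 i)%R) @^-1` [set true].
      by apply/seteqP; split => x /= /eqP.
    apply: measurable_fun_eqr => //; first exact: (mfst _ _ _ _ _ _ _ th mf).
    by apply: measurable_funM => //; apply: measurable_prod => i _.
  suff : {ae lebesgue_rV R n.+1, forall x, P x} by [].
  apply: (ae_rV_cons mP).
  apply: (@filterS2 _ _ aeL _ _ _ _ aepT (fin_ae f mf f0 foo)) => a pa fa.
  have ga : same_mass (lebesgue_rV R n) f' p' (th, a).
    have iE (h : Th * 'rV[R]_n.+1 -> R) b (c : R) : measurable_fun setT h ->
        (forall z, (0 < h z)%R) -> (0 < c)%R -> marg h (th, b) < +oo ->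
        \int[lebesgue_rV R n]_v (h (th, rV_cons (b, v)) * c)%:E = (margr h (th, b) * c)%:E.
      move=> mh h0 c0 hoo; under eq_integral do rewrite mulrC EFinM.
      rewrite ge0_integralZl//.
      - by rewrite mulrC EFinM margrE.
      - by apply/measurable_EFinP; exact: (mfst _ _ _ _ _ _ _ (th, b) (mhc h mh)).
      - by move=> v _; rewrite lee_fin ltW.
      - by rewrite lee_fin ltW.
    rewrite /same_mass /f' /p' /= !iE ?margr_gt0// ltry andbT.
    by rewrite mulrC.
  apply: (@filterS _ _ (ae_filter_ringOfSetsType (lebesgue_rV R n)) _ _ _ (T'E _ ga)) => v.
  rewrite /f' /p' /P /= (T0E _ _ g0) /T /J splitE big_ord_recl rV_cons0.
  under [X in _ -> _ = (_ * (_ * X))%R]eq_bigr do rewrite rV_consS.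
  move=> e; apply: (@mulIf _ (margr p (th, T0 (th, a)))).
    by rewrite gt_eqF// margr_gt0.
  rewrite e /=; ring.
- move=> th t F t01 mF F0.
  have mw : measurable_fun setT (fun x => (mix_jacobian t (J (th, x)))%:E).
    apply/measurable_EFinP; apply: measurable_mix_jacobian; exact: (mfst _ _ _ _ _ _ _ th mJ).
  have mixS : measurable_fun setT (fun x => mix t x (T (th, x))).
    by apply: measurable_mix => //; exact: (mfst _ _ _ _ _ _ _ th mT).
  have J_gt0 z i : (0 < J z ord0 i)%R.
    rewrite /J; case: (unliftP ord0 i) => [j|] ->.
      by rewrite rV_consS; exact: J'_gt0.
    by rewrite rV_cons0; exact: J0_gt0.
  have w0 x : (0 <= mix_jacobian t (J (th, x)))%R by exact: mix_jacobian_ge0.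
  rewrite ge0_integral_rV_cons; last 2 first.
  + by apply: emeasurable_funM => //; exact: (measurableT_comp mF).
  + by move=> x; rewrite mule_ge0// lee_fin.
  rewrite [RHS]ge0_integral_rV_cons//.
  (* Triangularity at work: T0 does not see the tail. The first coordinate is changed in the
     integral of G, and then the tail inside, with the first coordinate frozen. *)
  pose G (y : R) := \int[lebesgue_rV R n]_v F (rV_cons (y, v)).
  have mG : measurable_fun setT G.
    apply: (@measurable_fun_integral_param _ _ R _ _ (lebesgue_rV R n)
      (fun z => F (rV_cons (z.1, z.2)))) => //.
    by apply: (measurableT_comp mF); exact: measurable_fun_rV_cons.
  rewrite -(T0S th (t ord0 ord0) G)//; last first.
    by move=> y; exact: integral_ge0.
  apply: eq_integral => a _.
  rewrite /G.
  pose Fa y := F (rV_cons (((1 - t ord0 ord0) * a + t ord0 ord0 * T0 (th, a))%R, y)).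
  rewrite -(T'S (th, a) (rV_tail t) Fa); last 3 first.
  + by move=> i; rewrite mxE.
  + by apply: (measurableT_comp mF); apply: measurable_fun_rV_cons.
  + by move=> y; exact: F0.
  rewrite muleC -ge0_integralZl//.
  + apply: eq_integral => v _.
    rewrite /T /J splitE mix_rV_cons mix_jacobian_rV_cons EFinM /Fa.
    by rewrite muleCA.
  + apply: emeasurable_funM.
      apply: (measurableT_comp mF); apply: measurable_fun_rV_cons => //.
      by apply: measurable_mix => //; exact: (mfst _ _ _ _ _ _ _ (th, a) mT').
    apply/measurable_EFinP; apply: measurable_mix_jacobian.
    exact: (mfst _ _ _ _ _ _ _ (th, a) mJ').
  + move=> v _; apply: mule_ge0; first exact: F0.
    by rewrite lee_fin; apply: mix_jacobian_ge0 => // i; rewrite mxE.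
  + have /andP[t0 t1] := t01 ord0.
    by rewrite lee_fin addr_ge0 ?subr_ge0// mulr_ge0// ltW.
Qed.

End knothe_rosenblatt.

(** * Convexity along blocks *)

Section euclidean_blocks.
Context (R : realType).

Definition dotp n (u v : 'rV[R]_n) : R := \sum_i u ord0 i * v ord0 i.

Lemma norm2_sqr n (v : 'rV[R]_n) : norm2 v ^+ 2 = dotp v v.
Proof.
rewrite /norm2 sqr_sqrtr; first by apply: eq_bigr => i _; rewrite expr2.
by apply: sumr_ge0 => i _; rewrite sqr_ge0.
Qed.

Lemma dotpZr n (c : R) (u v : 'rV[R]_n) : dotp u (c *: v) = c * dotp u v.
Proof. by rewrite mulr_sumr; apply: eq_bigr => i _; rewrite mxE; ring. Qed.

Lemma dotpZl n (c : R) (u v : 'rV[R]_n) : dotp (c *: u) v = c * dotp u v.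
Proof. by rewrite mulr_sumr; apply: eq_bigr => i _; rewrite mxE; ring. Qed.

Lemma dotpBl n (u v w : 'rV[R]_n) : dotp (u - v) w = dotp u w - dotp v w.
Proof. by rewrite -sumrB; apply: eq_bigr => i _; rewrite !mxE; ring. Qed.

Lemma dotpp_ge0 n (u : 'rV[R]_n) : 0 <= dotp u u.
Proof. by apply: sumr_ge0 => i _; rewrite -expr2 sqr_ge0. Qed.

(** Expand the squared length of u - c v, which is nonnegative. *)
Lemma dotp_le n (u v : 'rV[R]_n) (c : R) : 0 < c ->
  dotp u u <= c ^+ 2 * dotp v v -> dotp u v <= c * dotp v v.
Proof.
move=> c0 uv2.
have : 0 <= dotp (u - c *: v) (u - c *: v) by exact: dotpp_ge0.
have -> : dotp (u - c *: v) (u - c *: v) = dotp u u - 2 * c * dotp u v + c ^+ 2 * dotp v v.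
  rewrite /dotp !mulr_sumr -sumrB -big_split/=.
  by apply: eq_bigr => i _; rewrite !mxE; ring.
nra.
Qed.

Lemma norm2_le_dotp n (u v : 'rV[R]_n) (c : R) : 0 <= c ->
  norm2 u <= c * norm2 v -> dotp u u <= c ^+ 2 * dotp v v.
Proof.
by move=> c0 uv; rewrite -!norm2_sqr -exprMn ler_sqr// nnegrE ?mulr_ge0 ?sqrtr_ge0.
Qed.

Lemma gradientE n (f : 'rV[R]_n -> R) (x v : 'rV[R]_n) :
  differentiable f x -> 'd f x v = dotp (gradient f x) v.
Proof.
move=> df; rewrite [in LHS](row_sum_delta v) linear_sum.
by apply: eq_bigr => i _; rewrite linearZ/= mxE deriveE// mulrC.
Qed.

Lemma is_derive_line n (f : 'rV[R]_n -> R) (x v : 'rV[R]_n) (s : R) :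
  (forall x, differentiable f x) ->
  is_derive s 1 (fun s => f (x + s *: v)) (dotp (gradient f (x + s *: v)) v).
Proof.
move=> df; pose y := x + s *: v.
have e : (fun h : R => h^-1 *: (((fun s => f (x + s *: v)) \o shift s) (h *: (1 : R)) - f y)) =
    (fun h : R => h^-1 *: ((f \o shift y) (h *: v) - f y)).
  apply/funext => h /=; congr (_ *: (f _ - _)).
  by rewrite /y [h *: 1]mulr1 scalerDl addrCA.
split; first by rewrite /derivable e; exact: diff_derivable.
by rewrite /derive e -[lim _]/('D_v f y) deriveE// gradientE.
Qed.

Variables (M : nat) (d : 'I_M -> nat).
Notation X := 'rV[R]_(\sum_m d m).

Lemma sum_blocks (V : zmodType) (F : 'I_(\sum_m d m) -> V) :
  \sum_i F i = \sum_m \sum_(j < d m) F (tagnat.Rank m j).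
Proof.
rewrite sig_big_dep/= (reindex _ tagnat.sig_bij_on)/=.
by apply: eq_bigr => i _; rewrite -[in LHS](tagnat.sig2K i).
Qed.

Lemma dotp_blocks (x y : X) :
  dotp x y = \sum_m dotp (submxrow x m) (submxrow y m).
Proof.
rewrite /dotp sum_blocks; apply: eq_bigr => m _; apply: eq_bigr => j _.
by rewrite !mxE.
Qed.

Lemma submxrow_set_block (m k : 'I_M) (x : X) (y : 'rV[R]_(d m)) :
  submxrow (set_block x y) k = dfwith (fun j => submxrow x j) m y k.
Proof. by rewrite /set_block mxrowK. Qed.

Lemma eq_blocks (x y : X) : (forall m, submxrow x m = submxrow y m) -> x = y.
Proof.
by move=> xy; rewrite -(submxrowK x) -(submxrowK y); apply: eq_mxrow.
Qed.



Lemma submxrowD (x y : X) m : submxrow (x + y) m = submxrow x m + submxrow y m.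
Proof. by apply/rowP => j; rewrite !mxE. Qed.

Lemma submxrowB (x y : X) m : submxrow (x - y) m = submxrow x m - submxrow y m.
Proof. by apply/rowP => j; rewrite !mxE. Qed.

Lemma submxrowZ (c : R) (x : X) m : submxrow (c *: x) m = c *: submxrow x m.
Proof. by apply/rowP => j; rewrite !mxE. Qed.

Lemma set_blockD (x : X) m (u w : 'rV[R]_(d m)) :
  set_block x (u + w) = set_block x u + set_block 0 w.
Proof.
apply: eq_blocks => k; rewrite submxrowD !submxrow_set_block.
have [<-|mk] := eqVneq m k; first by rewrite !dfwithin.
by rewrite !dfwithout// submxrow0 addr0.
Qed.

Lemma set_block_submxrow (x : X) m : set_block x (submxrow x m) = x.
Proof.
apply: eq_blocks => k; rewrite submxrow_set_block.
by have [<-|mk] := eqVneq m k; rewrite ?dfwithin ?dfwithout.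
Qed.

Lemma scale_set_block0 m (c : R) (w : 'rV[R]_(d m)) :
  c *: set_block 0 w = set_block (0 : X) (c *: w).
Proof.
apply: eq_blocks => k; rewrite submxrowZ !submxrow_set_block.
have [<-|mk] := eqVneq m k; first by rewrite !dfwithin.
by rewrite !dfwithout// submxrow0 scaler0.
Qed.

Lemma set_block_shift (x : X) m (w : 'rV[R]_(d m)) :
  set_block x (submxrow x m + w) = x + set_block 0 w.
Proof. by rewrite set_blockD set_block_submxrow. Qed.

Lemma dotp_set_block0 (g : X) m (w : 'rV[R]_(d m)) :
  dotp g (set_block 0 w) = dotp (submxrow g m) w.
Proof.
rewrite dotp_blocks (bigD1 m)//= [X in _ + X]big1 => [|k km].
  by rewrite [LHS]addr0 submxrow_set_block dfwithin.
rewrite submxrow_set_block dfwithout 1?eq_sym// submxrow0 /dotp big1// => i _.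
by rewrite [X in _ * X]mxE mulr0.
Qed.

Lemma convex_rV_le n (f : 'rV[R]_n -> R) (x y : 'rV[R]_n) (s : R) :
  convex_rV f -> 0 <= s <= 1 ->
  f ((1 - s) *: x + s *: y) <= (1 - s) * f x + s * f y.
Proof.
move=> cf /andP[s0 s1].
have := cf (Itv01 s0 s1) y x (in_setT _) (in_setT _).
by rewrite [X in f X <= _ -> _]addrC [X in _ <= X -> _]addrC.
Qed.

(** The descent lemma within one block. Subtracting the linear term and the quadratic majorant from
    U0 along the segment leaves [psi], whose derivative is nonpositive on (0, 1) by the Lipschitz
    bound; the mean value theorem concludes. *)
Lemma block_descent (U0 : X -> R) m (Lm : R) (x : X) (w : 'rV[R]_(d m)) :
  0 < Lm -> (forall x, differentiable U0 x) ->
  (forall (x : X) (y z : 'rV[R]_(d m)),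
     norm2 (block_gradient m U0 (set_block x y) - block_gradient m U0 (set_block x z))
       <= Lm * norm2 (y - z)) ->
  U0 (x + set_block 0 w) <= U0 x + dotp (block_gradient m U0 x) w + Lm / 2 * dotp w w.
Proof.
move=> L0 dU lip; pose e : X := set_block 0 w.
pose D s := dotp (gradient U0 (x + s *: e)) e.
pose psi (s : R) := U0 (x + s *: e) - (s * D 0 + s ^+ 2 * (Lm / 2 * dotp w w)).
have dpsi (s : R) : is_derive s 1 psi (D s - (D 0 + s * (Lm * dotp w w))).
  have H := @is_derive_line _ U0 x e s dU; rewrite -/(D s) in H.
  have H2 : is_derive s 1 (fun s : R => s * D 0 + s ^+ 2 * (Lm / 2 * dotp w w))
      (D 0 + s * (Lm * dotp w w)).
    by apply: is_derive_eq; rewrite /GRing.scale/=; field.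
  exact: is_deriveB.
have [|c] := @MVT R psi (fun s => D s - (D 0 + s * (Lm * dotp w w))) 0 1 ltr01.
  apply: continuous_subspaceT => s; apply: differentiable_continuous.
  apply/derivable1_diffP; exact: (@ex_derive _ _ _ _ _ _ _ (dpsi s)).
rewrite in_itv/= => /andP[c0 c1].
rewrite /psi scale0r scale1r addr0 mul0r expr1n expr0n mul0r addr0 !mul1r subr0 subr0 mulr1.
move=> psiE.
have Dc : D c - D 0 <= c * (Lm * dotp w w).
  rewrite /D -dotpBl /e scale0r addr0 dotp_set_block0 submxrowB.
  rewrite mulrA; apply: dotp_le; first exact: mulr_gt0.
  have := lip x (submxrow x m + c *: w) (submxrow x m).
  rewrite set_block_shift -scale_set_block0 set_block_submxrow [_ + _ - _]addrC addKr.
  move=> /(norm2_le_dotp (ltW L0)); rewrite dotpZl dotpZr => h.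
  suff -> : (c * Lm) ^+ 2 * dotp w w = Lm ^+ 2 * (c * (c * dotp w w)) by [].
  ring.
have D0E : D 0 = dotp (block_gradient m U0 x) w.
  by rewrite /D scale0r addr0 /e dotp_set_block0.
rewrite -D0E /e; lra.
Qed.


Lemma block_normsq_mix (L : 'I_M -> R) (x y : X) (s : R) :
  block_normsq L ((1 - s) *: x + s *: y) =
  (1 - s) * block_normsq L x + s * block_normsq L y
  - s * (1 - s) * block_normsq L (y - x).
Proof.
rewrite /block_normsq !mulr_sumr -big_split -sumrB/=; apply: eq_bigr => m _.
rewrite !norm2_sqr /dotp !mulr_sumr -big_split -sumrB/=; apply: eq_bigr => j _.
by rewrite !mxE; ring.
Qed.

(** The convexity inequality between x and y at time s, divided by s, in the limit s -> 0+. By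
    [block_normsq_mix] the quadratic term comes with the factor 1 - s; its s-dependent part is moved
    into [q], so that the bound on [q] is constant. *)
Lemma strong_convex_gradient (L : 'I_M -> R) (lambda : R) (U0 : X -> R) (x y : X) :
  (forall x, differentiable U0 x) ->
  convex_rV (fun x => U0 x - lambda / 2 * block_normsq L x) ->
  U0 x + dotp (gradient U0 x) (y - x) + lambda / 2 * block_normsq L (y - x) <= U0 y.
Proof.
move=> dU cU; pose v := y - x; pose D := dotp (gradient U0 x) v.
pose q (s : R) := s^-1 *: (U0 (x + s *: v) - U0 x) - s * (lambda / 2 * block_normsq L v).
have qD : q s @[s --> (0:R)^'+] --> D.
  have -> : D = D - 0 * (lambda / 2 * block_normsq L v) by rewrite mul0r subr0.
  apply: cvgB; last first.
    by apply: cvgM; [apply: cvg_within_filter; exact: cvg_id|exact: cvg_cst].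
  have H := @is_derive_line _ U0 x v 0 dU.
  have H1 := @ex_derive _ _ _ _ _ _ _ H; have H2 := @derive_val _ _ _ _ _ _ _ H.
  rewrite scale0r addr0 -/D /derive in H2.
  apply: cvg_dnbhs_at_right; rewrite -H2.
  rewrite (_ : (fun s => _) = (fun h : R => h^-1 *:
    (((fun s => U0 (x + s *: v)) \o shift (0 : R)) (h *: (1 : R)) - U0 (x + (0 : R) *: v)))) //.
  by apply/funext => h /=; rewrite scale0r !addr0 [h *: 1]mulr1.
suff : D <= U0 y - U0 x - lambda / 2 * block_normsq L v by rewrite /D /v; lra.
apply: (cvgr_to_le qD); near=> s.
have s0 : 0 < s by [].
have s1 : s <= 1.
  near: s; exact: nbhs_right_le.
rewrite /q /GRing.scale/= -(ler_pM2l s0) mulrBr mulVKf ?gt_eqF//.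
have := convex_rV_le x y cU (s := s); rewrite (ltW s0) s1 => /(_ isT).
rewrite block_normsq_mix -/v (_ : (1 - s) *: x + s *: y = x + s *: v); last first.
  by rewrite /v scalerBr scalerBl scale1r addrAC -addrA.
by lra.
Unshelve. all: by end_near. Qed.

(** A step of length lambda in block m costs lambda^2 L_m / 2 times the squared displacement, by
    [block_descent]. Summed over the blocks, this is exactly lambda times the quadratic gain in
    [strong_convex_gradient], and the linear terms match because the gradient is the row of its
    blocks. The U_m enter through convexity alone, at a step lambda in [0, 1]. *)
Lemma block_mix_energy (L : 'I_M -> R) (lambda : R) (U : X -> R) (x y : X) :
  (forall m, 0 < L m) -> 0 < lambda -> lambda <= 1 ->
  block_convex_smooth L lambda U ->
  lambda * (U x - U y) <=
  \sum_m (U x - U (set_block x ((1 - lambda) *: submxrow x m + lambda *: submxrow y m))).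
Proof.
move=> L0 l0 l1 [U0 [Um [UE cUm [dU _] lip cU]]].
pose v := y - x.
pose z m := set_block x ((1 - lambda) *: submxrow x m + lambda *: submxrow y m).
have zE m : z m = x + set_block 0 (lambda *: submxrow v m).
  rewrite -set_block_shift /z /v submxrowB; congr set_block.
  by rewrite scalerBr scalerBl scale1r addrAC addrA.
have smooth m : U0 (z m) - U0 x <=
    lambda * dotp (block_gradient m U0 x) (submxrow v m)
    + lambda ^+ 2 * (L m / 2 * norm2 (submxrow v m) ^+ 2).
  have := @block_descent U0 m (L m) x (lambda *: submxrow v m) (L0 m) dU (lip m).
  by rewrite -zE norm2_sqr !dotpZr dotpZl; lra.
have nonsmooth m : \sum_k Um k (submxrow (z m) k) - \sum_k Um k (submxrow x k) <=
    lambda * (Um m (submxrow y m) - Um m (submxrow x m)).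
  rewrite (bigD1 m)//= [X in _ - X](bigD1 m)//= submxrow_set_block dfwithin.
  rewrite [X in _ + X - _](eq_bigr (fun k => Um k (submxrow x k))); last first.
    by move=> k km; rewrite submxrow_set_block dfwithout// eq_sym.
  have := convex_rV_le (submxrow x m) (submxrow y m) (cUm m) (s := lambda).
  by rewrite (ltW l0) l1 => /(_ isT); lra.
have cvx := strong_convex_gradient x y dU cU.
rewrite -/v dotp_blocks /block_normsq in cvx.
have sm : \sum_m (U (z m) - U x) <=
  lambda * (\sum_m dotp (submxrow (gradient U0 x) m) (submxrow v m))
  + lambda ^+ 2 / 2 * (\sum_m L m * norm2 (submxrow v m) ^+ 2)
  + lambda * (\sum_m Um m (submxrow y m) - \sum_m Um m (submxrow x m)).
  rewrite -sumrB !mulr_sumr -!big_split/=; apply: ler_sum => m _.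
  by rewrite !UE; have := smooth m; have := nonsmooth m; rewrite /block_gradient; lra.
have -> : \sum_m (U x - U (z m)) = - \sum_m (U (z m) - U x).
  by rewrite -sumrN; apply: eq_bigr => m _; rewrite opprB.
rewrite lerNr (le_trans sm)// !UE; nra.
Qed.

(** Along a nonzero displacement inside one block, the quadratic lower bound with factor lambda L_m
    lies under the quadratic upper bound with factor L_m. The positive dimension provides such a
    displacement. *)
Lemma block_convexity_le1 (L : 'I_M -> R) (lambda : R) (U : X -> R) (m : 'I_M) :
  (0 < d m)%N -> (forall m, 0 < L m) -> block_convex_smooth L lambda U -> lambda <= 1.
Proof.
move=> dm L0 [U0 [Um [UE cUm [dU _] lip cU]]].
pose w : 'rV[R]_(d m) := const_mx 1.
have w0 : 0 < dotp w w.
  rewrite /dotp (eq_bigr (fun=> 1)) => [|i _]; last by rewrite !mxE mulr1.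
  by rewrite sumr_const card_ord ltr0n.
have h1 := @block_descent U0 m (L m) 0 w (L0 m) dU (lip m).
have nE : block_normsq L (set_block 0 w) = L m * dotp w w.
  rewrite /block_normsq (bigD1 m)//= [X in _ + X]big1 => [|k km].
    by rewrite [LHS]addr0 submxrow_set_block dfwithin norm2_sqr.
  rewrite submxrow_set_block dfwithout 1?eq_sym// submxrow0 norm2_sqr /dotp big1 ?mulr0// => i _.
  by rewrite [X in X * _]mxE mul0r.
have h2 := strong_convex_gradient 0 (set_block 0 w) dU cU.
rewrite subr0 dotp_set_block0 nE in h2.
move: h1; rewrite add0r /block_gradient => h1.
have Lw : 0 < L m * dotp w w by rewrite mulr_gt0.
nra.
Qed.

End euclidean_blocks.

(** * Measurability of convex functions *)

Section caratheodory_function.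
Context d (T : measurableType d) (R : realType).

Definition grid (k : nat) (a : R) : R :=
  (Num.floor (k.+1%:R * a))%:~R / k.+1%:R.

Lemma grid_itv k a : 0 <= a - grid k a <= k.+1%:R^-1.
Proof.
have k0 : 0 < k.+1%:R :> R by [].
have /andP[l1 l2] := floor_itv (k.+1%:R * a).
rewrite intrD in l2; rewrite /grid; set z := (_%:~R) in l1 l2 *.
have -> : a - z / k.+1%:R = (k.+1%:R * a - z) / k.+1%:R.
  by field; rewrite gt_eqF.
rewrite divr_ge0 ?subr_ge0 ?ler0n//= ler_pdivrMr// mulVf ?gt_eqF//.
by move: l2; rewrite mulr1z; lra.
Qed.

(** Rounding takes countably many values, and on each slab only measurability in the second variable
    is involved. *)
Lemma measurable_grid k (f : R * T -> R) :
  (forall a, measurable_fun setT (fun t => f (a, t))) ->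
  measurable_fun setT (fun z => f (grid k z.1, z.2)).
Proof.
move=> mf _ B mB; rewrite setTI.
pose A (z : int) := [set a : R | z%:~R <= k.+1%:R * a < (z + 1)%:~R] `*`
  (fun t => f (z%:~R / k.+1%:R, t)) @^-1` B.
have mA z : measurable (A z).
  apply: measurableX; last by rewrite -[X in measurable X]setTI; exact: mf.
  rewrite (_ : [set a | _] = `[z%:~R / k.+1%:R, (z + 1)%:~R / k.+1%:R[%classic).
    exact: measurable_itv.
  apply/seteqP; split=> a /=; rewrite in_itv/= ler_pdivrMr// ltr_pdivlMr//;
    by rewrite mulrC.
rewrite (_ : _ @^-1` B = \bigcup_n (A (Posz n)) `|` \bigcup_n (A (Negz n))).
  by apply: measurableU; apply: bigcup_measurable.
apply/seteqP; split => [[a t] /= fB|[a t] /=].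
  have := floor_itv (k.+1%:R * a); move: fB; rewrite /grid.
  by case: (Num.floor (k.+1%:R * a)) => n fB az; [left|right]; exists n.
by case=> -[n _ [/= h hB]]; rewrite -floor_eq in h; rewrite /grid (eqP h).
Qed.

End caratheodory_function.

Section convex_measurable.
Context (R : realType).

(** Convexity gives a one-sided Lipschitz bound at a: the chord to a - 1 bounds g (a - h) from
    above, the chord to a + 1 bounds it from below. Rounding down only approaches a from the left,
    at distance at most 1 / (k + 1). *)
Lemma convex1_grid_cvg (g : R -> R) (a : R) :
  (forall x y s, 0 <= s <= 1 ->
     g ((1 - s) * x + s * y) <= (1 - s) * g x + s * g y) ->
  g (grid k a) @[k --> \oo] --> g a.
Proof.
move=> cg; pose C := `|g (a - 1) - g a| + `|g (a + 1) - g a|.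
have bound h : 0 <= h <= 1 -> `|g a - g (a - h)| <= C * h.
  move=> /andP[h0 h1]; have h1' : 0 < 1 + h by lra.
  have u : g (a - h) <= (1 - h) * g a + h * g (a - 1).
    have -> : a - h = (1 - h) * a + h * (a - 1) by ring.
    by apply: cg; rewrite h0.
  (* The weight h / (1 + h) locates a on the segment from a - h to a + 1. *)
  have l : g a <= (1 - h / (1 + h)) * g (a - h) + h / (1 + h) * g (a + 1).
    have {1}-> : a = (1 - h / (1 + h)) * (a - h) + h / (1 + h) * (a + 1).
      by field; rewrite gt_eqF.
    apply: cg; rewrite divr_ge0 ?(ltW h1')//= ler_pdivrMr// mul1r; lra.
  have l' : (1 + h) * g a <= g (a - h) + h * g (a + 1).
    rewrite -(ler_pM2l h1') in l; apply: (le_trans l).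
    rewrite le_eqVlt; apply/orP; left; apply/eqP; field.
    by rewrite gt_eqF.
  have n1 := ler_norm (g (a - 1) - g a); have n2 := ler_norm (g (a + 1) - g a).
  have n1' := normr_ge0 (g (a - 1) - g a); have n2' := normr_ge0 (g (a + 1) - g a).
  by rewrite ler_norml /C; apply/andP; split; nra.
apply/cvgrPdist_le => e e0.
have C0 : 0 <= C by rewrite addr_ge0.
have : (fun k => C * harmonic k : R) @ \oo --> C * 0.
  by apply: cvgM; [exact: cvg_cst|exact: cvg_harmonic].
rewrite mulr0 => /cvgrPdist_le /(_ e e0); apply: filterS => k.
have Ck : 0 <= C * k.+1%:R^-1 by rewrite mulr_ge0// invr_ge0 ler0n.
rewrite sub0r normrN (ger0_norm Ck); apply: le_trans; have /andP[g0 g1] := grid_itv k a.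
have := bound (a - grid k a); rewrite subKr => h.
apply: (le_trans (h _)).
  rewrite g0 (le_trans g1)// invf_le1// ler1n//.
by rewrite ler_wpM2l.
Qed.

(* The sigma-algebra is generated by the coordinates, so continuity does not give
   measurability at once: f is the limit of its values with the first coordinate
   rounded down to a grid, and the other coordinates are handled by induction. *)
Lemma measurable_convex n (f : 'rV[R]_n -> R) :
  (forall x y s, 0 <= s <= 1 ->
     f ((1 - s) *: x + s *: y) <= (1 - s) * f x + s * f y) ->
  measurable_fun setT f.
Proof.
elim: n f => [|n IH] f cf.
  rewrite (_ : f = cst (f 0)); last first.
    by apply/funext => x; rewrite (thinmx0 x).
  exact: measurable_cst.
have consE (s a b : R) (v w : 'rV[R]_n) :
    (1 - s) *: rV_cons (a, v) + s *: rV_cons (b, w) =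
    rV_cons ((1 - s) * a + s * b, (1 - s) *: v + s *: w).
  apply/rowP => i; rewrite mxE [X in X + _]mxE [X in _ + X]mxE.
  case: (unliftP ord0 i) => [j|] ->; last by rewrite !rV_cons0.
  by rewrite !rV_consS /= !mxE.
suff mc : measurable_fun setT (f \o @rV_cons R n).
  rewrite (_ : f = (f \o @rV_cons R n) \o (fun x : 'rV[R]_n.+1 => (x ord0 ord0, rV_tail x))).
    apply: (measurableT_comp mc); apply: measurable_fun_pair.
      exact: measurable_rV_coord.
    exact: measurable_rV_tail.
  by apply/funext => x /=; rewrite rV_consK.
apply: (@measurable_fun_cvg _ _ _ setT
  (fun k (z : R * 'rV[R]_n) => f (rV_cons (grid k z.1, z.2)))) => //.
- move=> k; apply: (measurable_grid k (f := f \o @rV_cons R n)) => a.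
  apply: IH => x y s s01; apply: le_trans (cf _ _ _ s01).
  by rewrite consE /= -mulrDl subrK mul1r.
- move=> [a v] _ /=; apply: (convex1_grid_cvg (g := fun a => f (rV_cons (a, v)))).
  move=> x y s s01; apply: le_trans (cf _ _ _ s01).
  by rewrite consE -scalerDl subrK scale1r.
Qed.

(** Strong convexity presents U0 as a convex function plus a quadratic polynomial in the
    coordinates, so [measurable_convex] settles U0 as well as the U_m. *)
Lemma measurable_block_convex_smooth M (d : 'I_M -> nat) (L : 'I_M -> R)
    (lambda : R) (U : 'rV[R]_(\sum_m d m) -> R) :
  block_convex_smooth L lambda U -> measurable_fun setT U.
Proof.
move=> [U0 [Um [UE cUm _ _ cU]]].
have mN : measurable_fun setT (@block_normsq R M d L).
  apply: measurable_sum => m; apply: measurable_funM => //.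
  rewrite (_ : (fun x => _) = fun x => dotp (submxrow x m) (submxrow x m)); last first.
    by apply/funext => x; rewrite norm2_sqr.
  have mj (j : 'I_(d m)) : measurable_fun setT
      (fun x : 'rV[R]_(\sum_m d m) => submxrow x m ord0 j).
    exact: (measurableT_comp (measurable_rV_coord j) (@measurable_submxrow R M d m)).
  by apply: measurable_sum => j; exact: (measurable_funM (mj j) (mj j)).
rewrite (_ : U = fun x => (U0 x - lambda / 2 * block_normsq L x)
    + lambda / 2 * block_normsq L x + \sum_m Um m (submxrow x m)).
  apply: measurable_funD; first apply: measurable_funD.
  - by apply: measurable_convex => x y s; exact: (convex_rV_le x y cU).
  - exact: measurable_funM.
  - apply: measurable_sum => m; apply: (measurableT_comp _ (@measurable_submxrow R M d m)).
    by apply: measurable_convex => x y s; exact: (convex_rV_le x y (cUm m)).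
by apply/funext => x; rewrite UE subrK.
Qed.

End convex_measurable.

(** * Disintegration along a block *)

Section disintegration.
Local Open Scope ereal_scope.
Context (R : realType) (M : nat) (d : 'I_M -> nat).
Notation X := 'rV[R]_(\sum_m d m).
Notation block m := 'rV[R]_(d m).
Notation rest m := 'rV[R]_(\sum_j others d m j).
Variables (mu : probability X R) (K : forall m, R.-pker (rest m) ~> (block m)).
Variable m : 'I_M.

Lemma drop_block_set_block (x : X) (y : block m) :
  drop_block m (set_block x y) = drop_block m x.
Proof.
apply: eq_mxrow => j; rewrite submxrow_set_block dfwithout//.
exact: neq_lift.
Qed.

Lemma measurable_set_blockr (x : X) :
  measurable_fun setT (fun y : block m => set_block x y).
Proof. exact: (measurableT_comp (@measurable_set_block R M d m) (pair1_measurable x)). Qed.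

Lemma measurable_integral_block (F : X -> \bar R) :
  measurable_fun setT F -> (forall x, 0 <= F x) ->
  measurable_fun setT (fun x => \int[K m (drop_block m x)]_y F (set_block x y)).
Proof.
move=> mF F0.
apply: (@measurable_fun_integral_finite_kernel _ _ _ _ _ (fun p => F (set_block p.1 p.2)) (block_kernel K m)) => //.
exact: (measurableT_comp mF (@measurable_set_block R M d m)).
Qed.

Let mS (F : X -> \bar R) x : measurable_fun setT F ->
  measurable_fun setT (fun y => F (@set_block R M d m x y)).
Proof. by move=> mF; exact: (measurableT_comp mF (measurable_set_blockr x)). Qed.

Lemma daniell_block :
  daniell (fun F : X -> \bar R => \int[mu]_x \int[K m (drop_block m x)]_y F (set_block x y)).
Proof.
split.
- move=> c A c0 mA.
  have mi : measurable_fun setT (fun x : X => (\1_A x)%:E : \bar R).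
    exact/measurable_EFinP.
  rewrite -ge0_integralZl//; last 2 first.
  + by apply: (measurable_integral_block mi) => x; rewrite lee_fin.
  + by move=> x _; apply: integral_ge0 => y _; rewrite lee_fin.
  apply: eq_integral => x _; under eq_integral do rewrite EFinM.
  by rewrite ge0_integralZl//; exact: (mS x mi).
- move=> f g mf mg f0 g0; rewrite -ge0_integralD//;
    try exact: measurable_integral_block; try by move=> x _; exact: integral_ge0.
  by apply: eq_integral => x _; rewrite ge0_integralD//; exact: mS.
- move=> g mg g0 ndg; rewrite -monotone_convergence//; last 3 first.
  + by move=> n; exact: measurable_integral_block.
  + by move=> n x _; exact: integral_ge0.
  + move=> x _ k n kn; apply: ge0_le_integral => //; try exact: mS.
    by move=> y _; exact: ndg.
  apply: eq_integral => x _; rewrite monotone_convergence//.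
  by move=> n; exact: mS.
Qed.

(** The measure mu P_m, that is, the law after one Gibbs update of block m. *)
Definition resample (A : set X) : \bar R :=
  \int[mu]_x \int[K m (drop_block m x)]_y (\1_A (set_block x y))%:E.

Let resample0 : resample set0 = 0.
Proof.
rewrite /resample integral0_eq// => x _; rewrite integral0_eq// => y _.
by rewrite indic0.
Qed.

Let resample_ge0 A : 0 <= resample A.
Proof. by apply: integral_ge0 => x _; apply: integral_ge0 => y _; rewrite lee_fin. Qed.

Let resample_sigma_additive : semi_sigma_additive resample.
Proof.
move=> F mF tF mUF.
have -> : resample (\bigcup_n F n) = \sum_(i <oo) resample (F i).
  have mi n : measurable_fun setT (fun x : X => (\1_(F n) x)%:E : \bar R).
    exact/measurable_EFinP.
  have min := fun n => measurable_integral_block (mi n).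
  rewrite /resample -integral_nneseries//.
  - apply: eq_integral => x _; rewrite -integral_nneseries//; last first.
      by move=> n; exact: (mS x (mi n)).
    apply: eq_integral => y _.
    rewrite -[LHS]/(\d_(set_block x y) (\bigcup_n F n)) measure_bigcup//.
    by apply: eq_eseriesl => n; rewrite in_setT.
  - by move=> n; apply: min => x; rewrite lee_fin.
  - by move=> n x _; apply: integral_ge0 => y _; rewrite lee_fin.
by apply: is_cvg_ereal_nneg_natsum_cond => n _ _; exact: resample_ge0.
Qed.

HB.instance Definition _ := isMeasure.Build _ _ _ resample
  resample0 resample_ge0 resample_sigma_additive.

Let G : set (set X) := [set C | exists A B, [/\ measurable A, measurable B &
   C = [set x | A (drop_block m x) /\ B (submxrow x m)]]].

Let measurable_rect A B : measurable A -> measurable B ->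
  measurable [set x : X | A (drop_block m x) /\ B (submxrow x m)].
Proof.
move=> mA mB; apply: measurableI.
- by rewrite -[X in measurable X]setTI; exact: (@measurable_drop_block R M d m).
- by rewrite -[X in measurable X]setTI; exact: (@measurable_submxrow R M d m).
Qed.

(** Every coordinate of x is a coordinate either of its block m or of x_{-m}, so the rectangles in G
    make all coordinates measurable. *)
Let measurable_generated : measurable = <<s G>>.
Proof.
apply/seteqP; split; last first.
  apply: smallest_sub; first exact: sigma_algebra_measurable.
  by move=> _ [A [B [mA mB ->]]]; exact: measurable_rect.
pose X' := g_sigma_algebraType G.
have mid : measurable_fun [set: X'] (id : X' -> X).
  apply/measurable_fun_rVP => i.
  rewrite -(tagnat.sig2K i); move: (tagnat.sig1 i) (tagnat.sig2 i) => k j.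
  move=> _ B mB; rewrite setTI; apply: sub_sigma_algebra.
  have mBj n (l : 'I_n) : measurable [set y : 'rV[R]_n | B (y ord0 l)].
    by rewrite -[X in measurable X]setTI; exact: (measurable_rV_coord l).
  have [e|km] := eqVneq k m.
    exists setT, [set y : block m | B (y ord0 (cast_ord (congr1 d e) j))]; split => //.
    subst k; apply/seteqP; split => x /=; rewrite mxE cast_ord_id; tauto.
  have [k' e] : exists k', k = lift m k'.
    by case: (unliftP m k) => [k' ->|e]; [exists k'|rewrite e eqxx in km].
  subst k; exists [set y : rest m | B (y ord0 (tagnat.Rank k' j))], setT; split => //.
  have e (x : X) : x ord0 (tagnat.Rank (lift m k') j) =
      drop_block m x ord0 (tagnat.Rank k' j).
    have := mxrowK (fun j => submxrow x (lift m j)) k'.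
    by move=> /rowP /(_ j); rewrite !mxE => ->.
  by apply/seteqP; split => x /=; rewrite e; tauto.
by move=> A mA; have := mid measurableT A mA; rewrite setTI.
Qed.

(** Invariance of mu under P_m. Both sides are finite measures, and on the rectangles, which form a
    generating pi-system, the equality is the definition of the conditional law: an update of block
    m leaves x_{-m} fixed, so the indicator of its set leaves the inner integral. *)
Lemma conditional_law_resample A : conditional_law mu (K m) ->
  measurable A -> mu A = resample A.
Proof.
move=> cl mA.
apply: (@measure_unique _ R X G (fun=> setT)) => //.
- move=> _ _ [A1 [B1 [mA1 mB1 ->]]] [A2 [B2 [mA2 mB2 ->]]].
  exists (A1 `&` A2), (B1 `&` B2); split; try exact: measurableI.
  by apply/seteqP; split => x /=; tauto.
- by move=> _; exists setT, setT; split => //; apply/seteqP; split.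
- by rewrite bigcup_const//; exists 0%N.
- move=> _ [A1 [B1 [mA1 mB1 ->]]].
  rewrite [LHS](cl _ _ mA1 mB1) integral_mkcond.
  apply: eq_integral => x _; rewrite patchE.
  have eI y : (\1_[set x | A1 (drop_block m x) /\ B1 (submxrow x m)] (set_block x y))%:E
      = (\1_A1 (drop_block m x))%:E * (\1_B1 y)%:E :> \bar R.
    rewrite -EFinM !indicE -natrM mulnb; congr ((nat_of_bool _)%:R%:E).
    apply/idP/andP => [/set_mem /= []|[/set_mem a /set_mem b]].
      by rewrite drop_block_set_block submxrow_set_block dfwithin => a b; split; exact/mem_set.
    by apply/mem_set; rewrite /= drop_block_set_block submxrow_set_block dfwithin.
  under eq_integral do rewrite eI.
  rewrite ge0_integralZl//; last first.
    exact/measurable_EFinP/measurable_indic.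
  rewrite integral_indic// setIT indicE.
  have -> : (x \in drop_block m @^-1` A1) = (drop_block m x \in A1).
    by apply/idP/idP => /set_mem h; exact/mem_set.
  by case: ifP => _; rewrite ?mul1e ?mul0e.
- by move=> _; have := probability_setT mu => /= ->; rewrite ltry.
Qed.

Lemma disintegration (F : X -> \bar R) : conditional_law mu (K m) ->
  measurable_fun setT F -> (forall x, 0 <= F x) ->
  \int[mu]_x F x = \int[mu]_x \int[K m (drop_block m x)]_y F (set_block x y).
Proof.
move=> cl; apply: (daniell_unique (daniell_integral mu) daniell_block) => A mA.
by rewrite integral_indic// setIT; exact: conditional_law_resample.
Qed.

End disintegration.

(** * The entropy inequality *)

Section log_inequalities.
Context (R : realType).

Lemma ln_le_subr1 (x : R) : 0 < x -> ln x <= x - 1.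
Proof.
move=> x0; have := @le_ln1Dx R (x - 1); rewrite addrCA subrr addr0; apply.
by lra.
Qed.

Lemma ln_mix_ge (t J : R) : 0 <= t <= 1 -> 0 < J -> t * ln J <= ln (1 - t + t * J).
Proof.
move=> /andP[t0 t1] J0.
have := @concave_ln R (Itv01 t0 t1) J 1 J0 ltr01.
rewrite !convRE/= /onem ln1 mulr0 addr0 mulr1 => h.
by have -> : 1 - t + t * J = t * J + (1 - t) by ring.
Qed.

Lemma ln_prod (I : Type) (r : seq I) (a : I -> R) : (forall i, 0 < a i) ->
  ln (\prod_(i <- r) a i) = \sum_(i <- r) ln (a i).
Proof.
move=> a0; elim: r => [|i r IH]; first by rewrite !big_nil ln1.
by rewrite !big_cons lnM ?posrE// ?IH// prodr_gt0.
Qed.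

End log_inequalities.

Section block_mix.
Context (R : realType) (M : nat) (d : 'I_M -> nat).
Notation X := 'rV[R]_(\sum_m d m).
Variable lambda : R.

Definition block_weight (m : 'I_M) : X :=
  \row_i (if tagnat.sig1 i == m then lambda else 0).

Lemma mix_block_weight (m : 'I_M) (x y : X) :
  mix (block_weight m) x y =
  set_block x ((1 - lambda) *: submxrow x m + lambda *: submxrow y m).
Proof.
apply: eq_blocks => k; rewrite submxrow_set_block; apply/rowP => j.
rewrite !mxE tagnat.Rank1K.
have [<-|km] := eqVneq k m; first by rewrite dfwithin !mxE.
by rewrite dfwithout 1?eq_sym// !mxE subr0 mul1r mul0r addr0.
Qed.

Lemma mix_jacobian_gt0 n (t J : 'rV[R]_n) : (forall i, 0 <= t ord0 i <= 1) ->
  (forall i, 0 < J ord0 i) -> 0 < mix_jacobian t J.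
Proof.
move=> t01 J0; apply: prodr_gt0 => i _; have /andP[t0 t1] := t01 i; have := J0 i.
have [->|t1'] := eqVneq (t ord0 i) 1; first by lra.
have : t ord0 i < 1 by rewrite lt_neqAle t1'.
by nra.
Qed.

Lemma block_weight_itv (m : 'I_M) i : 0 <= lambda <= 1 ->
  0 <= block_weight m ord0 i <= 1.
Proof. by move=> l01; rewrite mxE; case: ifP => _ //; rewrite lexx ler01. Qed.

(** Each coordinate lies in exactly one block, so the double sum on the right keeps one term ln (1 -
    lambda + lambda J_i) per coordinate, at least lambda ln J_i by concavity. *)
Lemma ln_mix_jacobian_blocks (J : X) : 0 <= lambda <= 1 ->
  (forall i, 0 < J ord0 i) ->
  lambda * ln (\prod_i J ord0 i) <=
  \sum_m ln (mix_jacobian (block_weight m) J).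
Proof.
move=> l01 J0; rewrite ln_prod// mulr_sumr.
have jE m : ln (mix_jacobian (block_weight m) J) =
    \sum_i ln (1 - block_weight m ord0 i + block_weight m ord0 i * J ord0 i).
  rewrite /mix_jacobian ln_prod// => i; have /andP[t0 t1] := block_weight_itv m i l01.
  have := J0 i; have [->|t1'] := eqVneq (block_weight m ord0 i) 1; first by lra.
  have : block_weight m ord0 i < 1 by rewrite lt_neqAle t1'.
  by nra.
rewrite (eq_bigr _ (fun m _ => jE m)) exchange_big/=; apply: ler_sum => i _.
have pick (G : 'I_M -> R) j : (forall k, k != j -> G k = 0) -> \sum_k G k = G j.
  by move=> G0; rewrite (bigD1 j)//= big1 ?addr0.
rewrite (pick _ (tagnat.sig1 i)) => [|k ki].
  by rewrite mxE eqxx ln_mix_ge.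
by rewrite mxE eq_sym (negbTE ki) subr0 mul0r addr0 ln1.
Qed.

End block_mix.

Section entropy_inequality.
Local Open Scope ereal_scope.
Context (R : realType) (M : nat) (d : 'I_M -> nat).
Notation X := 'rV[R]_(\sum_m d m).
Local Notation leb := (lebesgue_rV R (\sum_m d m)).
Variables (L : 'I_M -> R) (lambda : R) (U : X -> R) (mu : probability X R).
Hypotheses (L0 : forall m, (0 < L m)%R) (l0 : (0 < lambda)%R) (l1 : (lambda <= 1)%R).
Hypothesis convex_smooth : block_convex_smooth L lambda U.
Hypothesis density : has_density mu (fun x => expR (- U x)).

Let mU : measurable_fun setT U.
Proof. exact: measurable_block_convex_smooth convex_smooth. Qed.

Let dens x := expR (- U x).

Let mdens : measurable_fun setT dens.
Proof.
by apply: (@measurableT_comp _ _ _ _ _ _ (@expR R) _ _ (@measurable_expR R)); exact: measurable_funN.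
Qed.

Lemma integral_has_density (F : X -> \bar R) : measurable_fun setT F ->
  (forall x, 0 <= F x) ->
  \int[mu]_x F x = \int[leb]_x (F x * (dens x)%:E).
Proof.
move=> mF F0; rewrite (@ge0_integral_density _ _ _ _ R leb mu id dens)//.
by move=> x; exact: expR_ge0.
Qed.

Lemma ae_has_density (P : X -> Prop) : {ae leb, forall x, P x} -> {ae mu, forall x, P x}.
Proof.
move=> [N [mN N0 sub]]; exists N; split => //.
rewrite [LHS]density// null_set_integral//.
by apply/measurable_EFinP; exact: measurable_funTS.
Qed.

(** Only the positive part of g is compared with G; the negative part, possibly of infinite
    integral, can only lower the left side. *)
Lemma ae_le_integral_nonneg (g G : X -> \bar R) : measurable_fun setT g ->
  measurable_fun setT G -> (forall x, 0 <= G x) ->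
  {ae mu, forall x, g x <= G x} -> \int[mu]_x g x <= \int[mu]_x G x.
Proof.
move=> mg mG G0 gG.
rewrite integralE; apply: (@le_trans _ _ (\int[mu]_x g^\+ x)).
  by rewrite geeDl// oppe_le0 integral_ge0.
apply: ae_ge0_le_integral => //; first exact: measurable_funepos.
apply: filterS gG => x gG _.
by rewrite funeposE ge_max gG G0.
Qed.

Variables (h : X -> R) (w : 'I_M -> X -> R).
Hypotheses (mh : measurable_fun setT h) (h0 : forall x, (0 < h x)%R).
Hypothesis h1 : \int[mu]_x (h x)%:E = 1.
Hypotheses (mw : forall m, measurable_fun setT (w m)) (w0 : forall m x, (0 < w m x)%R).
Hypothesis wE : forall m (x : X) (y : 'rV[R]_(d m)), w m (set_block x y) = w m x.

(* A minorant q of the integrand replaces it: no integrability of the logarithms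
   is then needed. *)
Lemma gibbs_entropy (q : X -> R) : measurable_fun setT q ->
  (forall x, q x <= h x * (\sum_m (ln (w m x) - ln (h x)) + lambda * ln (h x)) + M%:R * h x)%R ->
  \int[mu]_x (q x)%:E <= \sum_m \int[mu]_x (w m x)%:E.
Proof.
move=> mq qle.
have dens0 x : (0 < dens x)%R by exact: expR_gt0.
pose rho x := (h x * dens x)%R.
have mrho : measurable_fun setT rho by exact: measurable_funM.
have rho0 x : (0 < rho x)%R by rewrite mulr_gt0// expR_gt0.
(* The trivial parameter space [unit]: parameters serve the recursion on coordinates only. The
   source density is h e^{-U} and the target density e^{-U}. *)
have [T [J [mT mJ J0 TE TS]]] := @knothe_rosenblatt R _ _ unit
  (fun z => rho z.2) (fun z => dens z.2) (measurableT_comp mrho measurable_snd)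
  (measurableT_comp mdens measurable_snd) (fun z => rho0 z.2) (fun z => expR_gt0 _).
pose t m := block_weight d lambda m.
have l01 : (0 <= lambda <= 1)%R by rewrite ltW.
have t01 m i : (0 <= t m ord0 i <= 1)%R.
  exact: block_weight_itv.
pose S m x := mix (t m) x (T (tt, x)).
have mTx : measurable_fun setT (fun x => T (tt, x)).
  exact: (measurableT_comp mT (pair1_measurable tt)).
have mJx : measurable_fun setT (fun x => J (tt, x)).
  exact: (measurableT_comp mJ (pair1_measurable tt)).
have mS m : measurable_fun setT (S m) by exact: measurable_mix.
pose jac m x := mix_jacobian (t m) (J (tt, x)).
have mjac m : measurable_fun setT (jac m) by exact: measurable_mix_jacobian.
have jac0 m x : (0 < jac m x)%R.
  by apply: mix_jacobian_gt0 => //; exact: t01.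
pose Z m x := (dens (S m x) * w m x * jac m x / rho x)%R.
have Z0 m x : (0 < Z m x)%R
  by exact: (divr_gt0 (mulr_gt0 (mulr_gt0 (dens0 _) (w0 m x)) (jac0 m x)) (rho0 x)).
have mdS m : measurable_fun setT (dens \o S m) by exact: (measurableT_comp mdens (mS m)).
have mZ m : measurable_fun setT (Z m).
  apply: measurable_funM; last exact: measurable_fun_inv_gt0.
  exact: (measurable_funM (measurable_funM (mdS m) (mw m)) (mjac m)).
have iZ m : \int[mu]_x (Z m x * h x)%:E = \int[mu]_x (w m x)%:E.
  rewrite !integral_has_density; last 4 first.
  - exact/measurable_EFinP.
  - by move=> x; rewrite lee_fin ltW.
  - by apply/measurable_EFinP; exact: measurable_funM.
  - by move=> x; rewrite lee_fin ltW// mulr_gt0.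
  (* The change of variables along [S m], read from right to left; [S m] moves block m alone, so
     [w m] takes the same value at [S m x] and at x. *)
  rewrite -(TS tt (t m) (fun x => (w m x)%:E * (dens x)%:E))//; last 2 first.
  - by apply: emeasurable_funM; exact/measurable_EFinP.
  - by move=> x; rewrite -EFinM lee_fin ltW// mulr_gt0.
  apply: eq_integral => x _; rewrite -!EFinM; congr (_%:E).
  have e : w m (mix (t m) x (T (tt, x))) = w m x by rewrite /t mix_block_weight wE.
  rewrite e /Z /rho /jac /S; field.
  by rewrite (gt_eqF (h0 x)) (gt_eqF (dens0 x)).
have aeMA : {ae mu, forall x, rho x = (dens (T (tt, x)) * \prod_i J (tt, x) ord0 i)%R}.
  apply: ae_has_density; apply: (TE tt).
  have e1 : \int[leb]_x (rho x)%:E = 1.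
    rewrite -h1 integral_has_density//; last by move=> x; rewrite lee_fin ltW.
    exact/measurable_EFinP.
  have e2 : \int[leb]_x (dens x)%:E = 1.
    by rewrite -(probability_setT mu) density.
  by rewrite /same_mass /= e1 e2 eqxx ltry.
have -> : \sum_m \int[mu]_x (w m x)%:E = \int[mu]_x (\sum_m Z m x * h x)%:E.
  transitivity (\sum_m \int[mu]_x (Z m x * h x)%:E); first by apply: eq_bigr => m _; rewrite iZ.
  transitivity (\int[mu]_x \sum_m (Z m x * h x)%:E); last first.
    by apply: eq_integral => x _; rewrite sumEFin.
  apply/esym/ge0_integral_sum => // m.
    by apply/measurable_EFinP; exact: measurable_funM.
  by move=> x _; rewrite lee_fin ltW// mulr_gt0.
apply: ae_le_integral_nonneg.
- exact/measurable_EFinP.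
- by apply/measurable_EFinP; apply: measurable_sum => m; exact: measurable_funM.
- by move=> x; rewrite lee_fin sumr_ge0// => m _; rewrite ltW// mulr_gt0.
apply: filterS aeMA => x MA; rewrite lee_fin (le_trans (qle x))//.
have hx := h0 x.
suff : (\sum_m (ln (w m x) - ln (h x)) + lambda * ln (h x) <= \sum_m (Z m x - 1))%R.
  have -> : (\sum_m (Z m x - 1) = \sum_m Z m x - M%:R)%R.
    by rewrite sumrB sumr_const card_ord.
  move=> H; have : (h x * (\sum_m (ln (w m x) - ln (h x)) + lambda * ln (h x)) <=
      h x * (\sum_m Z m x - M%:R))%R by rewrite ler_pM2l.
  rewrite -mulr_suml mulrBr; lra.
have lnZ m : (ln (w m x) - ln (h x) + (U x - U (S m x)) + ln (jac m x) <= Z m x - 1)%R.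
  apply: le_trans (ln_le_subr1 (Z0 m x)).
  rewrite /Z /rho /dens ln_div ?posrE ?mulr_gt0 ?expR_gt0//.
  rewrite !lnM ?posrE ?mulr_gt0 ?expR_gt0// !expRK; lra.
(* The Jacobian equation in logarithmic form. Multiplied by lambda, its energy part is bounded by
   [block_mix_energy] and its determinant part by [ln_mix_jacobian_blocks]. *)
have lnh : ln (h x) = (U x - U (T (tt, x)) + ln (\prod_i J (tt, x) ord0 i))%R.
  have : ln (rho x) = ln (dens (T (tt, x)) * \prod_i J (tt, x) ord0 i)%R by rewrite MA.
  rewrite /rho /dens !lnM ?posrE ?expR_gt0 ?prodr_gt0// !expRK; lra.
apply: (@le_trans _ _ (\sum_m (ln (w m x) - ln (h x) + (U x - U (S m x)) + ln (jac m x)))%R); last first.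
  by apply: ler_sum => m _; exact: lnZ.
have -> : (\sum_m (ln (w m x) - ln (h x) + (U x - U (S m x)) + ln (jac m x)) =
    \sum_m (ln (w m x) - ln (h x)) + (\sum_m (U x - U (S m x)) + \sum_m ln (jac m x)))%R.
  by rewrite addrA -!big_split.
rewrite lerD2l {1}lnh mulrDr lerD//; last exact: ln_mix_jacobian_blocks.
apply: (le_trans (block_mix_energy x (T (tt, x)) L0 l0 l1 convex_smooth)).
rewrite le_eqVlt; apply/orP; left; apply/eqP.
by apply: eq_bigr => m _; rewrite /S mix_block_weight.
Qed.

End entropy_inequality.

(** * Conditional expectations and linearization *)

Section conditional_expectation.
Local Open Scope ereal_scope.
Context (R : realType) (M : nat) (d : 'I_M -> nat).
Notation X := 'rV[R]_(\sum_m d m).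
Notation block m := 'rV[R]_(d m).
Notation rest m := 'rV[R]_(\sum_j others d m j).
Variables (mu : probability X R) (K : forall m, R.-pker (rest m) ~> (block m)).
Hypothesis claw : forall m, conditional_law mu (K m).

(** The conditional expectation E[f(X) | X_{-m}], written as a function of the whole point x. Being
    a real-valued integral, it is 0 where the extended integral is infinite. *)
Definition cond m (f : X -> R) (x : X) : R :=
  (\int[K m (drop_block m x)]_y f (set_block x y))%R.

Lemma set_block_set_block m (x : X) (y z : block m) :
  set_block (set_block x y) z = set_block x z.
Proof.
apply: eq_blocks => k; rewrite !submxrow_set_block.
have [<-|mk] := eqVneq m k; first by rewrite !dfwithin.
by rewrite !dfwithout// submxrow_set_block dfwithout.
Qed.

Lemma cond_set_block m f x (y : block m) : cond m f (set_block x y) = cond m f x.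
Proof.
rewrite /cond drop_block_set_block; congr fine; apply: eq_integral => z _.
by rewrite set_block_set_block.
Qed.

Lemma measurable_set_block_fun m (F : X -> R) (x : X) : measurable_fun setT F ->
  measurable_fun setT (fun y : block m => F (set_block x y)).
Proof. by move=> mF; exact: (measurableT_comp mF (measurable_set_blockr x)). Qed.

Let inner m (F : X -> \bar R) x := \int[K m (drop_block m x)]_y F (set_block x y).

Let condE m f x : cond m f x = fine (inner m ((EFin \o f)^\+) x - inner m ((EFin \o f)^\-) x).
Proof.
rewrite /cond /Rintegral integralE; congr (fine (_ - _)); apply: eq_integral => y _.
  by rewrite !funeposE.
by rewrite !funenegE.
Qed.

Lemma measurable_cond m (f : X -> R) : measurable_fun setT f ->
  measurable_fun setT (cond m f).
Proof.
move=> mf; rewrite (_ : cond m f = fun x =>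
  fine (inner m ((EFin \o f)^\+) x - inner m ((EFin \o f)^\-) x)); last first.
  by apply/funext => x; exact: condE.
have mfE : measurable_fun setT (EFin \o f) by exact/measurable_EFinP.
apply: (measurableT_comp (fine_measurable _)) => //; apply: emeasurable_funB.
- by apply: measurable_integral_block => //; exact: measurable_funepos.
- by apply: measurable_integral_block => //; exact: measurable_funeneg.
Qed.

Lemma conditional_integrable m (f : X -> R) : mu.-integrable setT (EFin \o f) ->
  {ae mu, forall x, (K m (drop_block m x)).-integrable setT (fun y => (f (set_block x y))%:E)}.
Proof.
move=> fi; have mf : measurable_fun setT f by apply/measurable_EFinP; exact: (measurable_int _ fi).
have mn : measurable_fun setT (fun x => `|(f x)%:E|).
  exact/measurable_EFinP/measurableT_comp.
have /integrableP[_] := fi; rewrite (disintegration (@claw m) mn)//.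
move=> foo.
have ii : mu.-integrable setT (inner m (fun x => `|(f x)%:E|)).
  apply/integrableP; split; first exact: measurable_integral_block.
  by under eq_integral do rewrite gee0_abs ?integral_ge0//.
apply: filterS (integrable_ae measurableT ii) => x /(_ I) h.
apply/integrableP; split.
  by apply/measurable_EFinP; exact: measurable_set_block_fun.
by rewrite -ge0_fin_numE// integral_ge0.
Qed.

(** The tower property. Positive and negative parts are disintegrated separately; [cond] is known to
    be their difference where both inner integrals are finite, which is almost everywhere. *)
Lemma integral_cond m (f : X -> R) : mu.-integrable setT (EFin \o f) ->
  mu.-integrable setT (EFin \o cond m f) /\
  (\int[mu]_x cond m f x = \int[mu]_x f x)%R.
Proof.
move=> fi; have mfE := measurable_int _ fi.
have mf : measurable_fun setT f by exact/measurable_EFinP.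
have ip := integrable_funepos measurableT fi.
have in_ := integrable_funeneg measurableT fi.
have int_inner (g : X -> \bar R) : (forall x, 0 <= g x) -> mu.-integrable setT g ->
    mu.-integrable setT (inner m g).
  move=> g0 gi; have mg := measurable_int _ gi.
  apply/integrableP; split; first exact: measurable_integral_block.
  under eq_integral do rewrite gee0_abs ?integral_ge0//.
  rewrite -(disintegration (@claw m))//; have /integrableP[_] := gi.
  by under eq_integral do rewrite gee0_abs//.
have iip := int_inner _ (fun x => funepos_ge0 _ x) ip.
have iin := int_inner _ (fun x => funeneg_ge0 _ x) in_.
have ae_eq : {ae mu, forall x, setT x ->
    inner m ((EFin \o f)^\+) x - inner m ((EFin \o f)^\-) x = (EFin \o cond m f) x}.
  apply: filterS2 (integrable_ae measurableT iip) (integrable_ae measurableT iin) => x /(_ I) h1 /(_ I) h2 _.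
  by rewrite /= condE fineK// fin_numB h1.
have iB := integrableB measurableT iip iin.
have mc : measurable_fun setT (EFin \o cond m f) by apply/measurable_EFinP; apply: measurable_cond.
have e : \int[mu]_x (cond m f x)%:E = \int[mu]_x (f x)%:E.
  rewrite -(ae_eq_integral _ _ _ _ _ ae_eq)//; last exact: (measurable_int _ iB).
  rewrite integralB// [RHS]integralE /inner -!(disintegration (@claw m))//.
  - exact: measurable_funeneg.
  - exact: measurable_funepos.
split; last by rewrite /Rintegral e.
apply/integrableP; split => //.
have iA := integrable_abse iB.
rewrite (@ae_eq_integral _ _ _ _ setT (abse \o (inner m ((EFin \o f)^\+) \- inner m ((EFin \o f)^\-)))).
- by have /integrableP[_] := iB.
- by [].
- exact: measurableT_comp.
- exact: (measurable_int _ iA).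
- by apply: filterS ae_eq => x /(_ I) /= H _ /=; rewrite H.
Qed.


(** Bounded functions are integrable under every conditional law, not just almost every one, so the
    linearization is free of exceptional sets. *)
Definition bmeas d' (T : measurableType d') (f : T -> R) : Prop :=
  measurable_fun setT f /\ exists B, forall x, (`|f x| <= B)%R.

Lemma bmeas_integrable d' (T : measurableType d') (nu : {measure set T -> \bar R})
    (f : T -> R) : nu setT < +oo -> bmeas f -> nu.-integrable setT (EFin \o f).
Proof.
move=> nuoo [mf [B fB]]; apply: measurable_bounded_integrable => //.
exists B; split; first by rewrite num_real.
by move=> r Br x _ /=; exact: (le_trans (fB x) (ltW Br)).
Qed.

Lemma bmeas_block m (f : X -> R) (x : X) : bmeas f ->
  bmeas (fun y : block m => f (set_block x y)).
Proof.
by move=> [mf [B fB]]; split; [exact: measurable_set_block_fun|exists B].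
Qed.

Lemma bmeas_conditional_integrable m (f : X -> R) (x : X) : bmeas f ->
  (K m (drop_block m x)).-integrable setT (fun y => (f (set_block x y))%:E).
Proof.
move=> bf; apply: bmeas_integrable; last exact: bmeas_block.
by have /= -> := @prob_kernel _ _ _ _ _ (K m) (drop_block m x); rewrite ltry.
Qed.

Lemma cond_cst m (c : R) (x : X) : cond m (cst c) x = c.
Proof.
rewrite /cond Rintegral_cst//.
by have /= -> := @prob_kernel _ _ _ _ _ (K m) (drop_block m x); rewrite mulr1.
Qed.

Lemma cond_bound m (f : X -> R) (B : R) (x : X) : measurable_fun setT f ->
  (forall x, (`|f x| <= B)%R) -> (`|cond m f x| <= B)%R.
Proof.
move=> mf fB; have bf : bmeas f by split => //; exists B.
rewrite /cond (le_trans (le_normr_Rintegral _ _))//; first exact: bmeas_conditional_integrable.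
rewrite -[leRHS](cond_cst m B x) /cond; apply: le_Rintegral => //.
- apply: (@bmeas_conditional_integrable m (fun z => `|f z|%R)).
  by split; [exact: measurableT_comp|exists B => z; rewrite normr_id].
- apply: (@bmeas_conditional_integrable m (cst B)); split => //.
  by exists `|B|%R.
Qed.

Lemma bmeas_cond m (f : X -> R) : bmeas f -> bmeas (cond m f).
Proof.
move=> [mf [B fB]]; split; first exact: measurable_cond.
by exists B => x; exact: cond_bound.
Qed.

Lemma condM m (f phi : X -> R) (x : X) :
  (forall x (y : block m), phi (set_block x y) = phi x) ->
  (K m (drop_block m x)).-integrable setT (fun y => (f (set_block x y))%:E) ->
  cond m (fun x => phi x * f x)%R x = (phi x * cond m f x)%R.
Proof.
move=> phiE fi; rewrite /cond -RintegralZl//; apply: eq_Rintegral => y _.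
by rewrite phiE.
Qed.

Lemma condB_cst m (f : X -> R) (c : R) (x : X) : bmeas f ->
  cond m (fun x => f x - c)%R x = (cond m f x - c)%R.
Proof.
move=> bf; rewrite -[in RHS](cond_cst m c x) /cond -RintegralB//.
- exact: bmeas_conditional_integrable.
- by apply: (@bmeas_conditional_integrable m (cst c)); split => //; exists `|c|%R.
Qed.

End conditional_expectation.

(** * Third-order expansions of the logarithm *)

Section log_expansion.
Context (R : realType).

(** The difference k of the two sides, as a function of x = 1 + u, vanishes at 1 and has derivative
    (x - 1)^3 / x, which has the sign of x - 1. *)
Lemma ln_le_cubic (u : R) : -1 < u -> ln (1 + u) <= u - u ^+ 2 / 2 + u ^+ 3 / 3.
Proof.
move=> u1; pose k (x : R) := (x - 1) - (x - 1) ^+ 2 / 2 + (x - 1) ^+ 3 / 3 - ln x.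
have dk (x : R) : 0 < x -> is_derive x 1 k ((x - 1) ^+ 3 / x).
  move=> x0; rewrite /k; have H := is_derive1_ln x0.
  have H2 : is_derive x 1 (fun x : R => (x - 1) - (x - 1) ^+ 2 / 2 + (x - 1) ^+ 3 / 3)
      (1 - (x - 1) + (x - 1) ^+ 2).
    by apply: is_derive_eq; rewrite /GRing.scale/=; field.
  have -> : (x - 1) ^+ 3 / x = 1 - (x - 1) + (x - 1) ^+ 2 - x^-1.
    by field; rewrite gt_eqF.
  exact: is_deriveB.
have k1 : k 1 = 0 by rewrite /k subrr ln1 !expr0n/= !mul0r !subr0 addr0.
have ck a b : 0 < a -> {within `[a, b], continuous k}.
  move=> a0; apply: derivable_within_continuous => x; rewrite in_itv/= => /andP[ax _].
  exact: (@ex_derive _ _ _ _ _ _ _ (dk x (lt_le_trans a0 ax))).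
suff : 0 <= k (1 + u) by rewrite /k [1 + u - 1]addrC addKr; lra.
have x0 : 0 < 1 + u by lra.
have [u0|u0|->] := ltgtP u 0; last by rewrite addr0 k1.
- have [||c] := @MVT R k (fun x => (x - 1) ^+ 3 / x) (1 + u) 1 _ _ (ck _ _ x0).
  + by lra.
  + by move=> x; rewrite in_itv/= => /andP[x1 _]; apply: dk; lra.
  rewrite in_itv/= k1 => /andP[c1 c2] e.
  have c0 : 0 < c by lra.
  have : (c - 1) ^+ 3 / c <= 0.
    rewrite ler_pdivrMr// mul0r exprS mulrC; have := sqr_ge0 (c - 1); nra.
  nra.
- have [||c] := @MVT R k (fun x => (x - 1) ^+ 3 / x) 1 (1 + u) _ _ (ck _ _ ltr01).
  + by lra.
  + by move=> x; rewrite in_itv/= => /andP[x1 _]; apply: dk; lra.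
  rewrite in_itv/= k1 subr0 => /andP[c1 c2] ->.
  by rewrite mulr_ge0 ?divr_ge0 ?exprn_ge0//; lra.
Qed.

Lemma cubic_bounds (u v eta : R) : `|u| <= eta -> `|v| <= eta -> eta <= 1 / 2 ->
  [/\ `|u * v ^+ 2| <= eta ^+ 3, `|v ^+ 3| <= eta ^+ 3 & `|u * v ^+ 3| <= eta ^+ 3 / 2].
Proof.
move=> u1 v1 e1; have e0 : 0 <= eta by rewrite (le_trans _ u1).
have v3 : `|v ^+ 3| <= eta ^+ 3 by rewrite normrX lerXn2r// nnegrE.
split => //.
- by rewrite normrM [leRHS]exprS ler_pM// normrX lerXn2r// nnegrE.
- rewrite normrM mulrC ler_pM//; lra.
Qed.

Lemma entropy_expansion (u eta : R) : `|u| <= eta -> eta <= 1 / 2 ->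
  (1 + u) * ln (1 + u) <= u + u ^+ 2 / 2 + eta ^+ 3.
Proof.
move=> un e1; have [] := cubic_bounds un un e1.
move: un; rewrite !ler_norml => /andP[u1 u2] /andP[b1 b2] /andP[b3 b4] /andP[b5 b6].
have h := @ln_le_cubic u _.
apply: (@le_trans _ _ ((1 + u) * (u - u ^+ 2 / 2 + u ^+ 3 / 3))).
  by rewrite ler_wpM2l ?h//; lra.
have -> : (1 + u) * (u - u ^+ 2 / 2 + u ^+ 3 / 3) =
  u + u ^+ 2 / 2 - u ^+ 3 / 6 + (u * u ^+ 3) / 3 by field.
lra.
Qed.

(** Since ln of the inverse of 1 - v is - ln (1 - v), the lower bound is [ln_le_cubic] taken at - v.
    This is the reason for writing w_m as an inverse. *)
Lemma ln_inv_expansion (u v eta : R) : `|u| <= eta -> `|v| <= eta -> eta <= 1 / 2 ->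
  v + u * v + v ^+ 2 / 2 - eta ^+ 3 <= (1 + u) * ln (1 - v)^-1.
Proof.
move=> un vn e1; have [] := cubic_bounds un vn e1.
move: un vn; rewrite !ler_norml => /andP[u1 u2] /andP[v1 v2].
move=> /andP[b1 b2] /andP[b3 b4] /andP[b5 b6].
have h := @ln_le_cubic (- v) _.
apply: (@le_trans _ _ ((1 + u) * (v + v ^+ 2 / 2 + v ^+ 3 / 3))).
  have -> : (1 + u) * (v + v ^+ 2 / 2 + v ^+ 3 / 3) =
    v + u * v + v ^+ 2 / 2 + (v ^+ 3 / 3 + (u * v ^+ 2) / 2 + (u * v ^+ 3) / 3) by field.
  lra.
rewrite ler_wpM2l//; first by lra.
rewrite lnV ?posrE; last by lra.
by rewrite lerNr (le_trans (h _))//; lra.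
Qed.

(** Multiplying by 1 - v leaves 1 - v^3 + 2 (1 - v) eta^3, and 2 (1 - v) >= 1; hence the factor
    2. *)
Lemma inv_expansion (v eta : R) : `|v| <= eta -> eta <= 1 / 2 ->
  (1 - v)^-1 <= 1 + v + v ^+ 2 + 2 * eta ^+ 3.
Proof.
move=> vn e1; have [_] := cubic_bounds vn vn e1.
move: (vn); rewrite !ler_norml => /andP[v1 v2] /andP[b3 b4] _.
have v0 : 0 < 1 - v by lra.
rewrite -(ler_pM2l v0) mulfV ?gt_eqF//.
have -> : (1 - v) * (1 + v + v ^+ 2 + 2 * eta ^+ 3) = 1 - v ^+ 3 + 2 * (1 - v) * eta ^+ 3 by ring.
have e3 : 0 <= eta ^+ 3 by rewrite exprn_ge0// (le_trans _ vn).
nra.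
Qed.

End log_expansion.

Section sum_integral.
Context d' (T : measurableType d') (R : realType) (mu : {measure set T -> \bar R}).
Variables (I : Type) (r : seq I) (f : I -> T -> R).
Hypothesis fi : forall i, mu.-integrable setT (EFin \o f i).

Let sumE : EFin \o (fun x => \sum_(i <- r) f i x) = fun x => (\sum_(i <- r) (f i x)%:E)%E.
Proof. by apply/funext => x; rewrite /= sumEFin. Qed.

Lemma integrable_real_sum : mu.-integrable setT (EFin \o (fun x => \sum_(i <- r) f i x)).
Proof. by rewrite sumE; apply: integrable_sum => // i _; exact: fi. Qed.

Lemma Rintegral_sum :
  \int[mu]_x (\sum_(i <- r) f i x) = \sum_(i <- r) \int[mu]_x f i x.
Proof.
rewrite /Rintegral -[X in integral _ _ X]/(EFin \o (fun x => \sum_(i <- r) f i x)) sumE.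
rewrite integral_sum// (eq_bigr (fun i => (\int[mu]_x f i x)%:E)) ?sumEFin// => i _.
by rewrite /Rintegral fineK//; exact: integrable_fin_num (fi i).
Qed.

End sum_integral.

Section bounded_functions.
Context d' (T : measurableType d') (R : realType).
Implicit Types f g : T -> R.

Lemma bmeas_cst (c : R) : bmeas (cst c : T -> R).
Proof. by split => //; exists `|c|. Qed.

Lemma bmeasD f g : bmeas f -> bmeas g -> bmeas (fun x => f x + g x).
Proof.
move=> [mf [B fB]] [mg [C gC]]; split; first exact: measurable_funD.
by exists (B + C) => x; rewrite (le_trans (ler_normD _ _))// lerD.
Qed.

Lemma bmeasM f g : bmeas f -> bmeas g -> bmeas (fun x => f x * g x).
Proof.
move=> [mf [B fB]] [mg [C gC]]; split; first exact: measurable_funM.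
by exists (B * C) => x; rewrite normrM ler_pM.
Qed.

Lemma bmeasZ (c : R) f : bmeas f -> bmeas (fun x => c * f x).
Proof. by move=> bf; exact: (bmeasM (bmeas_cst c) bf). Qed.

Lemma bmeasB f g : bmeas f -> bmeas g -> bmeas (fun x => f x - g x).
Proof.
move=> bf bg; have := bmeasD bf (bmeasZ (-1) bg).
by under eq_fun do rewrite mulN1r.
Qed.

Lemma bmeas_sqr f : bmeas f -> bmeas (fun x => f x ^+ 2).
Proof.
by move=> bf; rewrite (_ : (fun x => _) = fun x => f x * f x);
  [exact: bmeasM|apply/funext => x; rewrite expr2].
Qed.

Lemma bmeas_sum (I : Type) (r : seq I) (f : I -> T -> R) : (forall i, bmeas (f i)) ->
  bmeas (fun x => \sum_(i <- r) f i x).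
Proof.
move=> bf; elim: r => [|i r IH].
  by rewrite (_ : (fun x => _) = cst 0); [exact: bmeas_cst|apply/funext => x; rewrite big_nil].
rewrite (_ : (fun x => _) = fun x => f i x + \sum_(j <- r) f j x).
  exact: bmeasD.
by apply/funext => x; rewrite big_cons.
Qed.

Variable mu : probability T R.

Lemma bmeas_prob_integrable f : bmeas f -> mu.-integrable setT (EFin \o f).
Proof. by move=> bf; apply: bmeas_integrable => //; have /= -> := probability_setT mu; rewrite ltry. Qed.

Lemma Rintegral_prob_cst (c : R) : \int[mu]_x c = c.
Proof. by rewrite (Rintegral_cst _ measurableT); have /= -> := probability_setT mu; rewrite mulr1. Qed.

End bounded_functions.

(** * Second-order terms of the entropy inequality *)

Section linearization.
Context (R : realType) (M : nat) (d : 'I_M -> nat).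
Notation X := 'rV[R]_(\sum_m d m).
Notation block m := 'rV[R]_(d m).
Notation rest m := 'rV[R]_(\sum_j others d m j).
Variables (L : 'I_M -> R) (lambda : R) (U : X -> R) (mu : probability X R).
Variable K : forall m, R.-pker (rest m) ~> (block m).
Hypotheses (L0 : forall m, 0 < L m) (l0 : 0 < lambda) (l1 : lambda <= 1) (M0 : (0 < M)%N).
Hypothesis convex_smooth : block_convex_smooth L lambda U.
Hypothesis density : has_density mu (fun x => expR (- U x)).
Hypothesis claw : forall m, conditional_law mu (K m).

Lemma bmeas_cond_mul m (f : X -> R) : bmeas f ->
  \int[mu]_x (cond K m f x * f x) = \int[mu]_x (cond K m f x ^+ 2).
Proof.
move=> bf; have bc := bmeas_cond K m bf.
have [_ <-] := integral_cond claw m (bmeas_prob_integrable mu (bmeasM bc bf)).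
apply: eq_Rintegral => x _.
rewrite (@condM _ _ _ K m f (cond K m f) x) ?expr2//.
  by move=> z y; rewrite cond_set_block.
exact: bmeas_conditional_integrable.
Qed.

(** The entropy inequality at h = 1 + eps g with its cubic error. Each block contributes eta^3 from
    ln w_m and 2 eta^3 from w_m, and the terms in h ln h contribute (M - lambda) eta^3: at most 4 M
    eta^3 together. *)
Lemma small_perturbation (g : X -> R) (B eps : R) : measurable_fun setT g ->
  (forall x, `|g x| <= B) -> \int[mu]_x g x = 0 ->
  0 < eps -> eps * B <= 1 / 2 ->
  eps ^+ 2 / 2 * (\sum_m \int[mu]_x (cond K m g x ^+ 2)
                  - (M%:R - lambda) * \int[mu]_x (g x ^+ 2))
  <= 4 * M%:R * (eps * B) ^+ 3.
Proof.
move=> mg gB g0 e0 eB; set eta := eps * B; have etale : eta <= 1 / 2 by [].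
have bg : bmeas g by split => //; exists B.
pose u x := eps * g x; pose v m x := eps * cond K m g x.
have un x : `|u x| <= eta by rewrite normrM gtr0_norm// ler_wpM2l// ltW.
have vn m x : `|v m x| <= eta.
  by rewrite normrM gtr0_norm// ler_wpM2l ?(ltW e0)//; exact: cond_bound.
have bu : bmeas u by exact: bmeasZ.
have bv m : bmeas (v m) by apply: bmeasZ; exact: bmeas_cond.
have uv x : 0 < 1 + u x by have := un x; rewrite ler_norml => /andP[]; lra.
have vv m x : 0 < 1 - v m x by have := vn m x; rewrite ler_norml => /andP[]; lra.
pose h x := 1 + u x; pose w m x := (1 - v m x)^-1.
have mw m : measurable_fun setT (w m).
  by apply: measurable_fun_inv_gt0 => //; apply: measurable_funB => //; have [] := bv m.
have w0 m x : 0 < w m x by rewrite invr_gt0.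
have bw m : bmeas (w m).
  split => //; exists 2 => x; rewrite gtr0_norm// -[2]invrK lef_pV2 ?posrE// ?invr_gt0//.
  by have := vn m x; rewrite ler_norml => /andP[]; lra.
have Mlam : 0 <= M%:R - lambda.
  by rewrite subr_ge0 (le_trans l1)// ler1n.
(* [Q] plus the sum of the [w m] is the minorant handed to [gibbs_entropy]; the integrals of the
   [w m] cancel and leave that of [Q] at most 0. The terms linear in [u] integrate to 0 because g is
   centred. *)
pose Q x := \sum_m (u x * v m x - v m x ^+ 2 / 2)
  - (M%:R - lambda) * (u x + u x * u x / 2) + M%:R * u x - 4 * M%:R * eta ^+ 3.
pose S x := \sum_m (u x * v m x - v m x ^+ 2 / 2).
pose P x := (M%:R - lambda) * (u x + u x * u x / 2).
have bS : bmeas S.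
  apply: bmeas_sum => m; apply: bmeasB; first exact: bmeasM.
  apply: bmeasM; last exact: bmeas_cst.
  exact: bmeas_sqr.
have bP : bmeas P.
  by apply: bmeasZ; apply: bmeasD => //; apply: bmeasM; [exact: bmeasM|exact: bmeas_cst].
have bMu : bmeas (fun x => M%:R * u x) by exact: bmeasZ.
have bQ : bmeas Q.
  apply: bmeasB; last exact: bmeas_cst.
  by apply: bmeasD => //; exact: bmeasB.
pose q x := Q x + \sum_m w m x.
have bq : bmeas q by apply: bmeasD => //; exact: bmeas_sum.
have qle x : q x <= h x * (\sum_m (ln (w m x) - ln (h x)) + lambda * ln (h x)) + M%:R * h x.
  have e3 : 0 <= eta ^+ 3 by rewrite exprn_ge0// (le_trans _ (un x)).
  have hE := entropy_expansion (un x) etale.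
  have wl m := ln_inv_expansion (un x) (vn m x) etale.
  have wu m := inv_expansion (vn m x) etale.
  have S1 : \sum_m (v m x + u x * v m x + v m x ^+ 2 / 2 - eta ^+ 3) <=
      h x * \sum_m ln (w m x).
    by rewrite mulr_sumr; apply: ler_sum => m _; exact: wl.
  have S2 : \sum_m w m x <= \sum_m (1 + v m x + v m x ^+ 2 + 2 * eta ^+ 3).
    by apply: ler_sum => m _; exact: wu.
  have S3 : S x = \sum_m (v m x + u x * v m x + v m x ^+ 2 / 2 - eta ^+ 3)
      - \sum_m (1 + v m x + v m x ^+ 2 + 2 * eta ^+ 3) + M%:R * (1 + 3 * eta ^+ 3).
    have -> : M%:R * (1 + 3 * eta ^+ 3) = \sum_(m < M) (1 + 3 * eta ^+ 3).
      by rewrite sumr_const card_ord mulr_natl.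
    by rewrite -sumrB -big_split/=; apply: eq_bigr => m _; field.
  have S4 : \sum_m (ln (w m x) - ln (h x)) = \sum_m ln (w m x) - M%:R * ln (h x).
    by rewrite sumrB sumr_const card_ord mulr_natl.
  have S5 : (M%:R - lambda) * (h x * ln (h x)) <=
      (M%:R - lambda) * (u x + u x ^+ 2 / 2 + eta ^+ 3) by rewrite ler_wpM2l.
  have S6 : 0 <= lambda * eta ^+ 3 by rewrite mulr_ge0// ltW.
  have aux (A B1 W LW hl hx y e Mr : R) : hx = 1 + y -> A <= hx * LW -> W <= B1 ->
      (Mr - lambda) * (hx * hl) <= (Mr - lambda) * (y + y ^+ 2 / 2 + e) ->
      0 <= lambda * e ->
      A - B1 + Mr * (1 + 3 * e) - (Mr - lambda) * (y + y * y / 2) + Mr * y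
        - 4 * Mr * e + W <= hx * (LW - Mr * hl + lambda * hl) + Mr * hx.
    by move=> -> a1 a2 a3 a4; lra.
  by rewrite S4 /q /Q -/(S x) S3; exact: aux S1 S2 S5 S6.
have toE (f : X -> R) : bmeas f -> (\int[mu]_x (f x)%:E)%E = (\int[mu]_x f x)%:E.
  move=> bf; rewrite /Rintegral fineK//; apply: integrable_fin_num => //.
  exact: bmeas_prob_integrable.
have Eu : \int[mu]_x u x = 0.
  by rewrite /u RintegralZl ?g0 ?mulr0//; exact: bmeas_prob_integrable.
have h1 : (\int[mu]_x (h x)%:E = 1)%E.
  rewrite toE; last by apply: bmeasD => //; exact: bmeas_cst.
  rewrite /h RintegralD//; last 2 first.
  - by apply: (@bmeas_prob_integrable _ _ _ mu (cst 1)); exact: bmeas_cst.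
  - exact: bmeas_prob_integrable.
  by rewrite Rintegral_prob_cst Eu addr0.
have wE m (x : X) (y : block m) : w m (set_block x y) = w m x.
  by rewrite /w /v cond_set_block.
have [mq _] := bq.
have := gibbs_entropy L0 l0 l1 convex_smooth density
  (measurable_funD (measurable_cst _) (proj1 bu)) uv h1 mw w0 wE mq qle.
rewrite toE// (eq_bigr (fun m => (\int[mu]_x w m x)%:E)); last first.
  by move=> m _; rewrite toE.
have qE : \int[mu]_x q x = \int[mu]_x Q x + \sum_m \int[mu]_x w m x.
  rewrite -(Rintegral_sum (index_enum _) (fun m => bmeas_prob_integrable mu (bw m))) -RintegralD//.
    exact: bmeas_prob_integrable.
  by apply: bmeas_prob_integrable; exact: bmeas_sum.
rewrite sumEFin lee_fin qE => EQ; have {EQ} : \int[mu]_x Q x <= 0 by lra.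
suff -> : \int[mu]_x Q x = eps ^+ 2 / 2 * (\sum_m \int[mu]_x (cond K m g x ^+ 2)
    - (M%:R - lambda) * \int[mu]_x (g x ^+ 2)) - 4 * M%:R * eta ^+ 3 by lra.
have int f : bmeas f -> mu.-integrable setT (EFin \o f) by exact: bmeas_prob_integrable.
have bc m : bmeas (cond K m g) by exact: bmeas_cond.
have ES : \int[mu]_x S x = eps ^+ 2 / 2 * \sum_m \int[mu]_x (cond K m g x ^+ 2).
  rewrite /S Rintegral_sum; last first.
    move=> m; apply: bmeas_prob_integrable; apply: bmeasB; first exact: bmeasM.
    by apply: bmeasM; [exact: bmeas_sqr|exact: bmeas_cst].
  rewrite mulr_sumr; apply: eq_bigr => m _.
  rewrite (_ : (fun x => _) = fun x => eps ^+ 2 * (cond K m g x * g x)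
      + (- (eps ^+ 2 / 2)) * (cond K m g x ^+ 2)); last first.
    by apply/funext => x; rewrite /u /v; field.
  have b1 : bmeas (fun x => cond K m g x * g x) by exact: bmeasM.
  have b2 : bmeas (fun x => cond K m g x ^+ 2) by exact: bmeas_sqr.
  rewrite (RintegralD measurableT (int _ (bmeasZ _ b1)) (int _ (bmeasZ _ b2))).
  rewrite (RintegralZl _ measurableT (int _ b1)) (RintegralZl _ measurableT (int _ b2)).
  by rewrite bmeas_cond_mul//; field.
have EP : \int[mu]_x P x = (M%:R - lambda) * (eps ^+ 2 / 2 * \int[mu]_x (g x ^+ 2)).
  rewrite /P RintegralZl//; last first.
    by apply: int; apply: bmeasD => //; apply: bmeasM; [exact: bmeasM|exact: bmeas_cst].
  congr (_ * _); rewrite RintegralD//; last 2 first.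
  - exact: int.
  - by apply: int; apply: bmeasM; [exact: bmeasM|exact: bmeas_cst].
  rewrite Eu add0r (_ : (fun x => _) = fun x => eps ^+ 2 / 2 * (g x ^+ 2)); last first.
    by apply/funext => x; rewrite /u; field.
  by rewrite RintegralZl//; apply: int; exact: bmeas_sqr.
rewrite /Q RintegralB//; last 2 first.
- by apply: int; apply: bmeasD => //; exact: bmeasB.
- by apply: (int (cst _)); exact: bmeas_cst.
rewrite Rintegral_prob_cst RintegralD//; last 2 first.
- by apply: int; exact: bmeasB.
- exact: int.
rewrite RintegralB; [|by []|exact: int|exact: int].
by rewrite ES EP RintegralZl ?Eu//; [lra|exact: int].
Qed.

Lemma bounded_centered_gap (g : X -> R) : bmeas g -> \int[mu]_x g x = 0 ->
  \sum_m \int[mu]_x (cond K m g x ^+ 2) <= (M%:R - lambda) * \int[mu]_x (g x ^+ 2).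
Proof.
move=> [mg [B0 gB0]] g0; pose B := `|B0| + 1.
have B1 : 0 < B by rewrite ltr_wpDl.
have gB x : `|g x| <= B by rewrite (le_trans (gB0 x))// /B; have := ler_norm B0; lra.
rewrite -subr_le0; set D := (X in X <= 0).
apply/ler_addgt0Pr => e e0; rewrite add0r.
(* The first bound gives eps B <= 1/2. Division of the error 4 M (eps B)^3 by eps^2 / 2 leaves 8 M
   B^3 eps, which the second bound makes at most e. *)
pose eps := Num.min ((1 / 2) / B) (e / (8 * M%:R * B ^+ 3)).
have M1 : 0 < M%:R :> R by rewrite ltr0n.
have B3 : 0 < 8 * M%:R * B ^+ 3 by rewrite mulr_gt0 ?exprn_gt0// mulr_gt0.
have eps0 : 0 < eps by rewrite lt_min !divr_gt0.
have eps1 : eps * B <= 1 / 2 by rewrite -ler_pdivlMr// ge_min lexx.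
have eps2 : eps * (8 * M%:R * B ^+ 3) <= e by rewrite -ler_pdivlMr// ge_min lexx orbT.
have := small_perturbation mg gB g0 eps0 eps1; rewrite -/D => h.
have : eps ^+ 2 / 2 * D <= eps ^+ 2 / 2 * (eps * (8 * M%:R * B ^+ 3)).
  by apply: (le_trans h); rewrite le_eqVlt; apply/orP; left; apply/eqP; field.
by rewrite ler_pM2l ?divr_gt0 ?exprn_gt0// => /le_trans; apply.
Qed.

(** Subtracting the mean c lowers the second moments of f and of each of its M conditional
    expectations by c^2; the difference M - (M - lambda) is the factor lambda in front of c^2. *)
Lemma bounded_gap (f : X -> R) : bmeas f ->
  \sum_m \int[mu]_x (cond K m f x ^+ 2) <=
  (M%:R - lambda) * \int[mu]_x (f x ^+ 2) + lambda * (\int[mu]_x f x) ^+ 2.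
Proof.
move=> bf; pose c := \int[mu]_x f x; pose g x := f x - c.
have int h : bmeas h -> mu.-integrable setT (EFin \o h) by exact: bmeas_prob_integrable.
have bg : bmeas g by apply: bmeasB => //; exact: bmeas_cst.
have icst a : mu.-integrable setT (EFin \o (fun=> a : R)).
  by apply: (int (cst a)); exact: bmeas_cst.
have g0 : \int[mu]_x g x = 0.
  by rewrite /g RintegralB//; [rewrite Rintegral_prob_cst subrr|exact: int].
have := bounded_centered_gap bg g0.
have sq h : bmeas h -> \int[mu]_x h x = c ->
    \int[mu]_x ((h x - c) ^+ 2) = \int[mu]_x (h x ^+ 2) - c ^+ 2.
  move=> bh hc; rewrite (_ : (fun x => _) = fun x => h x ^+ 2 + ((- (2 * c)) * h x + c ^+ 2)); last first.
    by apply/funext => x; ring.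
  rewrite RintegralD//; last 2 first.
  - apply: int; exact: bmeas_sqr.
  - by apply: int; apply: bmeasD; [exact: bmeasZ|exact: bmeas_cst].
  rewrite RintegralD//; last by apply: int; exact: bmeasZ.
  rewrite RintegralZl//; last exact: int.
  by rewrite hc Rintegral_prob_cst; ring.
rewrite sq// (eq_bigr (fun m => \int[mu]_x (cond K m f x ^+ 2) - c ^+ 2)); last first.
  move=> m _; rewrite -sq//; last 2 first.
  - exact: bmeas_cond.
  - by have [_ ->] := integral_cond claw m (int _ bf).
  by apply: eq_Rintegral => x _; rewrite /g condB_cst.
rewrite sumrB sumr_const card_ord -mulr_natl -/c; lra.
Qed.

End linearization.

(** * Square-integrable functions *)

Section truncation.
Context (R : realType).

Definition truncate (k : nat) (a : R) : R := Num.max (- k%:R) (Num.min a k%:R).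

Lemma truncate_le k a : `|truncate k a| <= `|a|.
Proof.
rewrite /truncate; have k0 : 0 <= k%:R :> R by [].
have [a1|a1] := leP a k%:R.
  have [//|a2] := leP (- k%:R) a.
  rewrite normrN ger0_norm// ler0_norm; lra.
by rewrite max_r ?ger0_norm//; lra.
Qed.

Lemma truncate_bound k a : `|truncate k a| <= k%:R.
Proof.
rewrite ler_norml /truncate le_max lexx ge_max ge_min lexx orbT andbT/=.
by rewrite (@le_trans _ _ 0)// oppr_le0.
Qed.

Lemma cvg_sum_seq (I : Type) (r : seq I) (u : I -> nat -> R) (l : I -> R) :
  (forall i, u i k @[k --> \oo] --> l i) ->
  \sum_(i <- r) u i k @[k --> \oo] --> \sum_(i <- r) l i.
Proof.
move=> ul; elim: r => [|i r IH].
  by rewrite big_nil; under eq_fun do rewrite big_nil; exact: cvg_cst.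
by rewrite big_cons; under eq_fun do rewrite big_cons; apply: cvgD; [exact: ul|exact: IH].
Qed.

Lemma truncate_cvg a : truncate k a @[k --> \oo] --> a.
Proof.
apply: cvg_near_cst.
have := nbhs_infty_ger `|a|; apply: filterS => k ak.
move: ak; rewrite /= ler_norml => /andP[a1 a2].
by rewrite /truncate (min_l a2) (max_r a1).
Qed.

Lemma measurable_truncate d (T : measurableType d) k (f : T -> R) :
  measurable_fun setT f -> measurable_fun setT (fun x => truncate k (f x)).
Proof.
move=> mf; apply: measurable_maxr => //; exact: measurable_minr.
Qed.

Lemma Rintegral_dominated d (T : measurableType d) (nu : {measure set T -> \bar R})
    (f_ : nat -> T -> R) (f F : T -> R) : (forall k, measurable_fun setT (f_ k)) ->
  (forall x, f_ k x @[k --> \oo] --> f x) -> (forall k x, `|f_ k x| <= F x) ->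
  measurable_fun setT f ->
  nu.-integrable setT (EFin \o F) ->
  \int[nu]_x f_ k x @[k --> \oo] --> \int[nu]_x f x.
Proof.
move=> mf_ ff fF mf iF.
have mE (h : T -> R) : measurable_fun setT h -> measurable_fun setT (EFin \o h).
  by move=> mh; exact/measurable_EFinP.
have ff' : {ae nu, forall x, setT x -> (EFin \o f_ k) x @[k --> \oo] --> (EFin \o f) x}.
  by apply: aeW => x _; apply: cvg_EFin; [exact: nearW|exact: ff].
have fF' : {ae nu, forall x k, setT x -> (`|(EFin \o f_ k) x| <= (EFin \o F) x)%E}.
  by apply: aeW => x k _; rewrite /= lee_fin.
have [fi _ H] := dominated_convergence measurableT (fun k => mE _ (mf_ k)) (mE _ mf) ff' iF fF'.
apply: fine_cvg; rewrite fineK//; exact: integrable_fin_num.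
Qed.

Lemma truncate_integral_cvg d (T : measurableType d) (nu : {measure set T -> \bar R})
    (f : T -> R) : nu.-integrable setT (EFin \o f) ->
  \int[nu]_x truncate k (f x) @[k --> \oo] --> \int[nu]_x f x.
Proof.
move=> fi; have mf : measurable_fun setT f by apply/measurable_EFinP; exact: (measurable_int _ fi).
apply: (@Rintegral_dominated _ _ nu _ _ (fun x => `|f x|)) => //.
- by move=> k; exact: measurable_truncate.
- by move=> x; exact: truncate_cvg.
- by move=> k x; exact: truncate_le.
- exact: integrable_norm.
Qed.

Lemma truncate_sqr_integral_cvg d (T : measurableType d) (nu : {measure set T -> \bar R})
    (f : T -> R) : measurable_fun setT f ->
  nu.-integrable setT (EFin \o (fun x => f x ^+ 2)) ->
  \int[nu]_x (truncate k (f x) ^+ 2) @[k --> \oo] --> \int[nu]_x (f x ^+ 2).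
Proof.
move=> mf fi.
apply: (@Rintegral_dominated _ _ nu _ _ (fun x => f x ^+ 2)) => //.
- by move=> k; apply: measurable_funX; exact: measurable_truncate.
- move=> x; rewrite expr2; under eq_fun do rewrite expr2.
  by apply: cvgM; exact: truncate_cvg.
- by move=> k x; rewrite normrX -[leRHS]real_normK ?num_real// lerXn2r ?nnegrE// truncate_le.
- exact: measurable_funX.
Qed.

End truncation.

Section square_integrable.
Context (R : realType) (M : nat) (d : 'I_M -> nat).
Notation X := 'rV[R]_(\sum_m d m).
Notation block m := 'rV[R]_(d m).
Notation rest m := 'rV[R]_(\sum_j others d m j).
Variables (L : 'I_M -> R) (lambda : R) (U : X -> R) (mu : probability X R).
Variable K : forall m, R.-pker (rest m) ~> (block m).
Hypotheses (L0 : forall m, 0 < L m) (l0 : 0 < lambda) (l1 : lambda <= 1) (M0 : (0 < M)%N).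
Hypothesis convex_smooth : block_convex_smooth L lambda U.
Hypothesis density : has_density mu (fun x => expR (- U x)).
Hypothesis claw : forall m, conditional_law mu (K m).

Lemma bmeas_truncate k (f : X -> R) : measurable_fun setT f ->
  bmeas (fun x => truncate k (f x)).
Proof.
move=> mf; split; first exact: measurable_truncate.
by exists k%:R => x; exact: truncate_bound.
Qed.

Lemma Lfun2_measurable d' (T : measurableType d') (nu : {measure set T -> \bar R})
    (f : T -> R) : f \in Lfun nu 2%:E -> measurable_fun setT f.
Proof. by case/andP => /set_mem. Qed.

Lemma Lfun2_integrable d' (T : measurableType d') (nu : probability T R)
    (f : T -> R) : f \in Lfun nu 2%:E -> nu.-integrable setT (EFin \o f).
Proof.
by move=> f2; apply/Lfun1_integrable; apply: Lfun_subset12 => //; exact: fin_num_measure.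
Qed.

(** The left side stays one extended integral because square integrability of [cond K m f] is not
    yet available. For almost every x, f is integrable under all the conditional laws and the
    conditional expectations of its truncations converge; Fatou's lemma then passes to the limit. *)
Lemma square_integrable_gap (f : X -> R) : f \in Lfun mu 2%:E ->
  (\int[mu]_x (\sum_m cond K m f x ^+ 2)%:E <=
   ((M%:R - lambda) * \int[mu]_x (f x ^+ 2) + lambda * (\int[mu]_x f x) ^+ 2)%:E)%E.
Proof.
move=> f2; have mf := Lfun2_measurable f2.
have fi := Lfun2_integrable f2; have fsqi := Lfun2_integrable_sqr f2.
pose fk k x := truncate k (f x).
have bfk k : bmeas (fk k) by exact: bmeas_truncate.
pose S k x : \bar R := (\sum_m cond K m (fk k) x ^+ 2)%:E.
pose rhs k := (M%:R - lambda) * \int[mu]_x (fk k x ^+ 2) + lambda * (\int[mu]_x fk k x) ^+ 2.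
set RHS := (X in (_ <= X%:E)%E).
have crhs : rhs k @[k --> \oo] --> RHS.
  apply: cvgD; apply: cvgM; try exact: cvg_cst.
    exact: truncate_sqr_integral_cvg.
  rewrite expr2; under eq_fun do rewrite expr2.
  by apply: cvgM; exact: truncate_integral_cvg.
have bS k : bmeas (fun x => \sum_m cond K m (fk k) x ^+ 2).
  by apply: bmeas_sum => m; apply: bmeas_sqr; exact: bmeas_cond.
have Sle k : (\int[mu]_x S k x <= (rhs k)%:E)%E.
  rewrite /S; have := bounded_gap L0 l0 l1 M0 convex_smooth density claw (bfk k).
  rewrite -Rintegral_sum; last first.
    by move=> m; apply: bmeas_prob_integrable; apply: bmeas_sqr; exact: bmeas_cond.
  rewrite -lee_fin => H; apply: le_trans H.
  by rewrite /Rintegral fineK// integrable_fin_num//; exact: bmeas_prob_integrable.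
have mS k : measurable_fun setT (S k) by apply/measurable_EFinP; have [] := bS k.
have S0 k x : (0 <= S k x)%E by rewrite lee_fin sumr_ge0// => m _; rewrite sqr_ge0.
have mcond : measurable_fun setT (fun x => (\sum_m cond K m f x ^+ 2)%:E).
  apply/measurable_EFinP; apply: measurable_sum => m; apply: measurable_funX.
  exact: measurable_cond.
have aeint : {ae mu, forall x, forall m,
    (K m (drop_block m x)).-integrable setT (fun y => (f (set_block x y))%:E)}.
  by apply: filter_forall => m; exact: (conditional_integrable claw m fi).
have mlim : measurable_fun setT (fun x => limn_einf (S ^~ x)).
  apply: (@measurableT_comp _ _ _ _ _ _ oppe); first exact: oppe_measurable.
  apply: measurable_fun_limn_esup => k.
  by apply: (@measurableT_comp _ _ _ _ _ _ oppe); first exact: oppe_measurable.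
apply: (@le_trans _ _ (\int[mu]_x limn_einf (S ^~ x))%E).
  apply: ae_ge0_le_integral => //.
  - by move=> x _; rewrite lee_fin sumr_ge0// => m _; rewrite sqr_ge0.
  - move=> x _; rewrite limn_einf_lim; apply: lime_ge; first exact: is_cvg_einfs.
    by apply: nearW => k; apply: le_ereal_inf_tmp => _ [n _ <-]; exact: S0.
  apply: filterS aeint => x ix _.
  suff : S k x @[k --> \oo] --> (\sum_m cond K m f x ^+ 2)%:E.
    by move=> /cvg_limn_einf_sup[-> _].
  apply: cvg_EFin; first exact: nearW.
  apply: cvg_sum_seq => m; rewrite expr2.
  rewrite (_ : (fun k => _) = fun k => cond K m (fk k) x * cond K m (fk k) x); last first.
    by apply/funext => k /=; rewrite expr2.
  by apply: cvgM; exact: (truncate_integral_cvg (ix m)).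
apply: (le_trans (fatou _ measurableT mS (fun k x _ => S0 k x))).
have crhsE : (rhs k)%:E @[k --> \oo] --> RHS%:E.
  by apply: cvg_EFin; [exact: nearW|exact: crhs].
rewrite limn_einf_lim -(cvg_lim _ crhsE)//; apply: lee_lim.
- exact: is_cvg_einfs.
- by apply/cvg_ex; exists RHS%:E.
- apply: nearW => k; apply: le_trans (Sle k).
  by apply: ereal_inf_lbound; exists k => /=.
Qed.

End square_integrable.

Section second_moments.
Context d (T : measurableType d) (R : realType).

Lemma Lfun2_sqr (nu : {measure set T -> \bar R}) (f : T -> R) :
  measurable_fun setT f ->
  nu.-integrable setT (EFin \o (fun x => f x ^+ 2)) -> f \in Lfun nu 2%:E.
Proof.
move=> mf fi; rewrite inE/=; apply/andP; split; first exact/mem_set.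
apply/mem_set => /=; rewrite /finite_norm unlock/=; apply: poweR_lty.
have /integrableP[_] := fi; congr (_ < _)%E; apply: eq_integral => x _ /=.
by rewrite powR_mulrn// normrX.
Qed.

Lemma variance_moments (nu : probability T R) (f : T -> R) : f \in Lfun nu 2%:E ->
  'V_nu[f] = (\int[nu]_x (f x ^+ 2) - (\int[nu]_x f x) ^+ 2)%:E.
Proof.
move=> f2; rewrite varianceE// unlock EFinB EFin_expe /Rintegral !fineK//.
- exact: integrable_fin_num (Lfun2_integrable f2).
- exact: integrable_fin_num (Lfun2_integrable_sqr f2).
Qed.

End second_moments.

Section conditional_moments.
Context (R : realType) (M : nat) (d : 'I_M -> nat).
Notation X := 'rV[R]_(\sum_m d m).
Notation block m := 'rV[R]_(d m).
Notation rest m := 'rV[R]_(\sum_j others d m j).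
Variables (mu : probability X R) (K : forall m, R.-pker (rest m) ~> (block m)).
Hypothesis claw : forall m, conditional_law mu (K m).
Variables (m : 'I_M) (f : X -> R).
Hypotheses (f2 : f \in Lfun mu 2%:E) (c2 : cond K m f \in Lfun mu 2%:E).

Lemma integrable_mul_cond : mu.-integrable setT (EFin \o (fun x => cond K m f x * f x)).
Proof. exact/Lfun1_integrable/Lfun2_mul_Lfun1. Qed.

(** The conditional expectation is an orthogonal projection: [cond K m f] depends on x_{-m} only and
    leaves the inner integral wherever f is conditionally integrable. *)
Lemma integral_mul_cond :
  \int[mu]_x (f x * cond K m f x) = \int[mu]_x (cond K m f x ^+ 2).
Proof.
under eq_Rintegral do rewrite mulrC.
have [ic <-] := integral_cond claw m integrable_mul_cond.
congr fine; apply: ae_eq_integral => //.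
- exact: (measurable_int _ ic).
- by apply/measurable_EFinP; apply: measurable_funX; exact: Lfun2_measurable c2.
apply: filterS (conditional_integrable claw m (Lfun2_integrable f2)) => x ix _.
congr EFin; rewrite (condM (phi := cond K m f))// ?expr2// => z y.
exact: cond_set_block.
Qed.

Let F x : \bar R := ((f x - cond K m f x) ^+ 2)%:E.

Let mF : measurable_fun setT F.
Proof.
apply/measurable_EFinP; apply: measurable_funX; apply: measurable_funB.
  exact: Lfun2_measurable f2.
exact: Lfun2_measurable c2.
Qed.

Let F0 x : (0 <= F x)%E.
Proof. by rewrite lee_fin sqr_ge0. Qed.

Lemma cond_varianceE x :
  cond_variance K m f x = (\int[K m (drop_block m x)]_y F (set_block x y))%E.
Proof.
rewrite /cond_variance /variance unlock /= unlock; apply: eq_integral => y _.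
by rewrite /F cond_set_block expr2.
Qed.

Lemma measurable_cond_variance : measurable_fun setT (cond_variance K m f).
Proof.
rewrite (_ : cond_variance K m f = fun x => \int[K m (drop_block m x)]_y F (set_block x y))%E.
  exact: measurable_integral_block.
by apply/funext => x; exact: cond_varianceE.
Qed.

Lemma cond_variance_ge0 x : (0 <= cond_variance K m f x)%E.
Proof. exact: variance_ge0. Qed.

(** By [disintegration] the left side is the integral of (f - cond f)^2; expand the square and use
    [integral_mul_cond] for the cross term. *)
Lemma integral_cond_variance : (\int[mu]_x cond_variance K m f x =
  (\int[mu]_x (f x ^+ 2) - \int[mu]_x (cond K m f x ^+ 2))%:E)%E.
Proof.
under eq_integral do rewrite cond_varianceE.
rewrite -(disintegration (@claw m) mF F0).
have fi := Lfun2_integrable_sqr f2; have ci := Lfun2_integrable_sqr c2.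
have fc1 : mu.-integrable setT (EFin \o (f \* cond K m f)).
  exact/Lfun1_integrable/Lfun2_mul_Lfun1.
have fci : mu.-integrable setT (EFin \o (fun x => 2 * (f x * cond K m f x))).
  exact: (integrableZl measurableT 2 fc1).
have e : F = (fun x => (((f x ^+ 2 - 2 * (f x * cond K m f x)) + cond K m f x ^+ 2)%:E)).
  by apply/funext => x; congr EFin; ring.
have iB : mu.-integrable setT (EFin \o (fun x => f x ^+ 2 - 2 * (f x * cond K m f x))).
  exact: (integrableB measurableT fi fci).
have iF : mu.-integrable setT F by rewrite e; exact: (integrableD measurableT iB ci).
rewrite -[LHS]fineK; last exact: integrable_fin_num.
congr EFin; rewrite -/(Rintegral mu setT (fun x => (f x - cond K m f x) ^+ 2)).
transitivity (\int[mu]_x ((f x ^+ 2 - 2 * (f x * cond K m f x)) + cond K m f x ^+ 2)).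
  by apply: eq_Rintegral => x _; ring.
rewrite (RintegralD measurableT iB ci) (RintegralB measurableT fi fci) (RintegralZl _ measurableT fc1).
by rewrite integral_mul_cond; ring.
Qed.

End conditional_moments.

Section sum_cond.
Context (R : realType) (M : nat) (d : 'I_M -> nat).
Notation X := 'rV[R]_(\sum_m d m).
Notation block m := 'rV[R]_(d m).
Notation rest m := 'rV[R]_(\sum_j others d m j).
Variables (L : 'I_M -> R) (lambda : R) (U : X -> R) (mu : probability X R).
Variable K : forall m, R.-pker (rest m) ~> (block m).
Hypotheses (L0 : forall m, 0 < L m) (l0 : 0 < lambda) (l1 : lambda <= 1) (M0 : (0 < M)%N).
Hypothesis convex_smooth : block_convex_smooth L lambda U.
Hypothesis density : has_density mu (fun x => expR (- U x)).
Hypothesis claw : forall m, conditional_law mu (K m).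

Let gap_sum := square_integrable_gap L0 l0 l1 M0 convex_smooth density claw.

(** Read off the gap inequality itself, in place of conditional Jensen: one square is at most the
    sum of squares, whose integral is finite. *)
Lemma cond_Lfun2 m (f : X -> R) : f \in Lfun mu 2%:E -> cond K m f \in Lfun mu 2%:E.
Proof.
move=> f2; have mf := Lfun2_measurable f2.
have mc k : measurable_fun setT (cond K k f) by exact: measurable_cond.
apply: Lfun2_sqr => //; apply/integrableP; split.
  by apply/measurable_EFinP; exact: measurable_funX.
apply: le_lt_trans (ltry _); apply: le_trans (gap_sum f2).
apply: ge0_le_integral => //.
- by apply: measurableT_comp => //; apply/measurable_EFinP; exact: measurable_funX.
- by apply/measurable_EFinP; apply: measurable_sum => k; exact: measurable_funX.
move=> x Tx; rewrite lee_fin /=.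
have le_sum (a : 'I_M -> R) : (forall k, 0 <= a k) -> a m <= \sum_k a k.
  by move=> a0; rewrite (bigD1 m)//= lerDl sumr_ge0.
rewrite ger0_norm ?sqr_ge0//.
by apply: (le_sum (fun k => cond K k f x ^+ 2)) => k; exact: sqr_ge0.
Qed.

Lemma sum_cond_sqr_le (f : X -> R) : f \in Lfun mu 2%:E ->
  \sum_m \int[mu]_x (cond K m f x ^+ 2) <=
  (M%:R - lambda) * \int[mu]_x (f x ^+ 2) + lambda * (\int[mu]_x f x) ^+ 2.
Proof.
move=> f2; have ci m := Lfun2_integrable_sqr (cond_Lfun2 m f2).
rewrite -lee_fin; apply: le_trans (gap_sum f2); rewrite -sumEFin.
under [leRHS]eq_integral do rewrite -sumEFin.
rewrite integral_sum//; apply: lee_sum => m _.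
by rewrite /Rintegral fineK//; exact: integrable_fin_num (ci m).
Qed.

End sum_cond.

(** * The Gibbs operator *)

Section gibbs_operator.
Context (R : realType) (M : nat) (d : 'I_M -> nat).
Notation X := 'rV[R]_(\sum_m d m).
Notation block m := 'rV[R]_(d m).
Notation rest m := 'rV[R]_(\sum_j others d m j).
Variable K : forall m, R.-pker (rest m) ~> (block m).

Lemma integral_gibbs_block m (x : X) (F : X -> \bar R) : measurable_fun setT F ->
  (forall y, 0 <= F y)%E ->
  (\int[gibbs_block K m x]_y F y = \int[K m (drop_block m x)]_y F (set_block x y))%E.
Proof.
move=> mF F0.
rewrite (@ge0_integral_density _ _ _ _ R (K m (drop_block m x)) (gibbs_block K m x)
  (fun y => set_block x y) (cst 1))//.
- by apply: eq_integral => y _; rewrite mule1.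
- exact: measurable_set_blockr.
move=> A mA; rewrite /= /gibbs_block [RHS]integral_mkcond.
apply: eq_integral => y _; rewrite patchE indicE.
have -> : (y \in (fun y => set_block x y) @^-1` A) = (set_block x y \in A).
  by apply/idP/idP => /set_mem h; exact/mem_set.
by case: ifP.
Qed.

Lemma integral_gibbs (x : X) (F : X -> \bar R) : measurable_fun setT F ->
  (forall y, 0 <= F y)%E ->
  (\int[gibbs_kernel K x]_y F y =
   (M%:R^-1)%:E * \sum_m \int[K m (drop_block m x)]_y F (set_block x y))%E.
Proof.
move=> mF F0.
have r0 : 0 <= M%:R^-1 :> R by rewrite invr_ge0.
pose mu_ (k : nat) : {measure set X -> \bar R} :=
  if insub k is Some m then gibbs_block K m x else mzero.
have gE A : gibbs K x A = mscale (NngNum r0) (msum mu_ M) A.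
  rewrite /gibbs /mscale /msum/=; congr (_ * _)%E.
  by apply: eq_bigr => m _; rewrite /mu_ valK.
rewrite (eq_measure_integral (mscale (NngNum r0) (msum mu_ M)))//.
rewrite ge0_integral_mscale// ge0_integral_measure_sum//; congr (_ * _)%E.
by apply: eq_bigr => m _; rewrite /mu_ valK integral_gibbs_block.
by move=> A _ _; exact: gE.
Qed.

Let average (F : X -> \bar R) (x : X) : \bar R :=
  ((M%:R^-1)%:E * \sum_m \int[K m (drop_block m x)]_y F (set_block x y))%E.

Let kernel_op_gibbsE (f : X -> R) : measurable_fun setT f ->
  kernel_op (gibbs_kernel K) f =
  fun x => fine (average ((EFin \o f)^\+)%E x - average ((EFin \o f)^\-)%E x).
Proof.
move=> mf; have mfE : measurable_fun setT (EFin \o f) by exact/measurable_EFinP.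
apply/funext => x; rewrite /kernel_op /Rintegral integralE !integral_gibbs//.
- exact: measurable_funeneg.
- exact: measurable_funepos.
Qed.

Lemma measurable_kernel_op_gibbs (f : X -> R) : measurable_fun setT f ->
  measurable_fun setT (kernel_op (gibbs_kernel K) f).
Proof.
move=> mf; have mfE : measurable_fun setT (EFin \o f) by exact/measurable_EFinP.
have mavg F : measurable_fun setT F -> (forall x, 0 <= F x)%E ->
    measurable_fun setT (average F).
  move=> mF F0; apply: measurable_funeM; apply: emeasurable_fun_sum => m.
  exact: measurable_integral_block.
rewrite kernel_op_gibbsE//.
apply: (measurableT_comp (fine_measurable _)) => //; apply: emeasurable_funB.
- by apply: mavg => //; exact: measurable_funepos.
- by apply: mavg => //; exact: measurable_funeneg.
Qed.

(** [cond] applies [fine] block by block, [kernel_op] only after averaging; integrability makes the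
    positive and negative parts finite, so the two orders agree. *)
Lemma kernel_op_gibbs_cond (f : X -> R) (x : X) : measurable_fun setT f ->
  (forall m, (K m (drop_block m x)).-integrable setT (fun y => (f (set_block x y))%:E)) ->
  kernel_op (gibbs_kernel K) f x = M%:R^-1 * \sum_m cond K m f x.
Proof.
move=> mf fi; rewrite kernel_op_gibbsE// /average.
pose a m := fine (\int[K m (drop_block m x)]_y ((EFin \o f)^\+ (set_block x y))).
pose b m := fine (\int[K m (drop_block m x)]_y ((EFin \o f)^\- (set_block x y))).
have aE m : (\int[K m (drop_block m x)]_y ((EFin \o f)^\+ (set_block x y)) = (a m)%:E)%E.
  rewrite fineK//; have := integrable_fin_num measurableT (integrable_funepos measurableT (fi m)).
  by congr (_ \is a fin_num); apply: eq_integral => y _; rewrite !funeposE.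
have bE m : (\int[K m (drop_block m x)]_y ((EFin \o f)^\- (set_block x y)) = (b m)%:E)%E.
  rewrite fineK//; have := integrable_fin_num measurableT (integrable_funeneg measurableT (fi m)).
  by congr (_ \is a fin_num); apply: eq_integral => y _; rewrite !funenegE.
have cE m : cond K m f x = a m - b m.
  rewrite -[RHS]/(fine (a m)%:E - fine (b m)%:E) -fineB// -aE -bE.
  rewrite /cond /Rintegral integralE; congr (fine (_ - _)); apply: eq_integral => y _.
    by rewrite !funeposE.
  by rewrite !funenegE.
have avgE (A B : 'I_M -> \bar R) (c : 'I_M -> R) :
    (forall m, A m = (a m)%:E) -> (forall m, B m = (b m)%:E) -> (forall m, c m = a m - b m) ->
    fine ((M%:R^-1)%:E * (\sum_m A m) - (M%:R^-1)%:E * (\sum_m B m))%E =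
    M%:R^-1 * \sum_m c m.
  move=> AE BE CE; rewrite (eq_bigr _ (fun m _ => AE m)) (eq_bigr _ (fun m _ => BE m)).
  by rewrite (eq_bigr _ (fun m _ => CE m)) !sumEFin -!EFinM -EFinB /= -mulrBr -sumrB.
exact: avgE aE bE cE.
Qed.

End gibbs_operator.

(** * From the second-moment bound to the spectral gap and the conditional variances *)

Section spectral_gap_bounds.
Context (R : realType) (M : nat) (d : 'I_M -> nat).
Notation X := 'rV[R]_(\sum_m d m).
Notation block m := 'rV[R]_(d m).
Notation rest m := 'rV[R]_(\sum_j others d m j).
Variables (L : 'I_M -> R) (lambda : R) (U : X -> R) (mu : probability X R).
Variable K : forall m, R.-pker (rest m) ~> (block m).
Hypotheses (L0 : forall m, 0 < L m) (l0 : 0 < lambda) (l1 : lambda <= 1) (M0 : (0 < M)%N).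
Hypothesis convex_smooth : block_convex_smooth L lambda U.
Hypothesis density : has_density mu (fun x => expR (- U x)).
Hypothesis claw : forall m, conditional_law mu (K m).

Let cond2 m (f : X -> R) := cond_Lfun2 L0 l0 l1 M0 convex_smooth density claw m (f := f).

(** The inner product of f with its average over block m is the squared norm of the projection, by
    [integral_mul_cond]. *)
Lemma dirichlet_form (f : X -> R) : f \in Lfun mu 2%:E ->
  inner mu f (f \- kernel_op (gibbs_kernel K) f) =
  \int[mu]_x (f x ^+ 2) - M%:R^-1 * \sum_m \int[mu]_x (cond K m f x ^+ 2).
Proof.
move=> f2; have mf := Lfun2_measurable f2.
have fi := Lfun2_integrable_sqr f2.
have ci m : mu.-integrable setT (EFin \o (fun x => f x * cond K m f x)).
  exact/Lfun1_integrable/(Lfun2_mul_Lfun1 f2 (cond2 m f2)).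
have si : mu.-integrable setT (EFin \o (fun x => \sum_m (f x * cond K m f x))).
  exact: integrable_real_sum.
have msi : mu.-integrable setT (EFin \o (fun x => M%:R^-1 * \sum_m (f x * cond K m f x))).
  exact: (integrableZl measurableT _ si).
transitivity (\int[mu]_x (f x ^+ 2 - M%:R^-1 * \sum_m (f x * cond K m f x))).
  rewrite /inner; congr fine; apply: ae_eq_integral => //.
  - apply/measurable_EFinP; apply: measurable_funM => //; apply: measurable_funB => //.
    exact: measurable_kernel_op_gibbs.
  - exact: measurable_int (integrableB measurableT fi msi).
  have aeint : {ae mu, forall x, forall m,
      (K m (drop_block m x)).-integrable setT (fun y => (f (set_block x y))%:E)}.
    by apply: filter_forall => m; exact: (conditional_integrable claw m (Lfun2_integrable f2)).
  apply: filterS aeint => x ix _; congr EFin.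
  rewrite [(f \- _) x]/= kernel_op_gibbs_cond//.
  by rewrite mulrBr -mulr_sumr expr2 mulrCA.
rewrite (RintegralB measurableT fi msi) (RintegralZl _ measurableT si); congr (_ - _ * _).
rewrite Rintegral_sum//; apply: eq_bigr => m _.
exact: integral_mul_cond (cond2 m f2).
Qed.

(** The common source of both conclusions: division by M yields the Dirichlet form bound, and
    subtraction from M E f^2 yields the bound on conditional variances. *)
Let gap_le (f : X -> R) (f2 : f \in Lfun mu 2%:E) :
  \sum_m \int[mu]_x (cond K m f x ^+ 2) <=
  M%:R * \int[mu]_x (f x ^+ 2) - lambda * fine 'V_mu[f].
Proof.
rewrite variance_moments//=.
have := sum_cond_sqr_le L0 l0 l1 M0 convex_smooth density claw f2; lra.
Qed.

Lemma Gap_gibbs_ge : ((lambda / M%:R)%:E <= Gap mu (gibbs_kernel K))%E.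
Proof.
apply: le_ereal_inf_tmp => _ [f [f2 V0] <-]; rewrite lee_fin.
have Vfin : 'V_mu[f] \is a fin_num by exact: variance_fin_num.
have V0' : 0 < fine 'V_mu[f] by rewrite fine_gt0// V0 ltey_eq Vfin.
rewrite ler_pdivlMr// dirichlet_form// mulrAC ler_pdivrMr ?ltr0n// mulrBl.
rewrite mulrAC mulVf ?pnatr_eq0 ?lt0n_neq0//.
have := gap_le f2; lra.
Qed.

Lemma sum_cond_variance_ge (f : X -> R) : f \in Lfun mu 2%:E ->
  (lambda%:E * 'V_mu[f] <= \sum_m \int[mu]_x cond_variance K m f x)%E.
Proof.
move=> f2.
have cvE m : (\int[mu]_x cond_variance K m f x =
    (\int[mu]_x (f x ^+ 2) - \int[mu]_x (cond K m f x ^+ 2))%:E)%E.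
  exact: (integral_cond_variance claw f2 (cond2 m f2)).
rewrite (eq_bigr _ (fun m _ => cvE m)) sumEFin sumrB sumr_const card_ord.
rewrite -[_ *+ M]mulr_natl -(fineK (variance_fin_num f2)) -EFinM lee_fin.
have := gap_le f2; lra.
Qed.

End spectral_gap_bounds.

(** * Transfer to a random variable with law [mu] *)

Section image_law.
Context d d' (T : measurableType d) (T' : measurableType d') (R : realType).
Variables (P : probability T R) (mu : probability T' R) (X : {RV P >-> T'}).
Hypothesis law : forall A, measurable A -> distribution P X A = mu A.

Lemma ge0_integral_law (F : T' -> \bar R) : measurable_fun setT F ->
  (forall y, 0 <= F y)%E -> (\int[P]_w F (X w) = \int[mu]_y F y)%E.
Proof.
move=> mF F0; rewrite -[LHS](ge0_integral_distribution X mF F0).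
by apply: eq_measure_integral => A mA _; exact: law.
Qed.

Lemma Rintegral_law (f : T' -> R) : measurable_fun setT f ->
  \int[P]_w f (X w) = \int[mu]_y f y.
Proof.
move=> mf; have mfE : measurable_fun setT (EFin \o f) by exact/measurable_EFinP.
rewrite /Rintegral integralE [in RHS]integralE -!ge0_integral_law//.
- by congr (fine (_ - _)); apply: eq_integral => w _; rewrite ?funeposE ?funenegE.
- exact: measurable_funeneg.
- exact: measurable_funepos.
Qed.

Lemma Lfun2_law (f : T' -> R) : f \in Lfun mu 2%:E -> f \o X \in Lfun P 2%:E.
Proof.
move=> f2; have mf := Lfun2_measurable f2.
have /integrableP[mf2 foo] := Lfun2_integrable_sqr f2.
apply: Lfun2_sqr; first exact: measurableT_comp.
apply/integrableP; split; first exact: (measurableT_comp mf2).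
rewrite (ge0_integral_law (F := fun y => `|(f y ^+ 2)%:E|%E))//.
exact: measurableT_comp.
Qed.

Lemma variance_law (f : T' -> R) : f \in Lfun mu 2%:E -> 'V_P[f \o X] = 'V_mu[f].
Proof.
move=> f2; have mf := Lfun2_measurable f2.
rewrite !variance_moments ?Lfun2_law//; congr ((_ - _ ^+ 2)%:E).
- by rewrite -(@Rintegral_law (fun x => f x ^+ 2))//; exact: measurable_funX.
- exact: Rintegral_law.
Qed.

End image_law.

Lemma blocks_eq0 (R : realType) (M : nat) (d : 'I_M -> nat) :
  (forall m, d m = 0%N) -> forall x y : 'rV[R]_(\sum_m d m), x = y.
Proof.
move=> d0 x y; apply: eq_blocks => m; apply/rowP => i.
by have := ltn_ord i; rewrite [X in (_ < X)%N]d0.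
Qed.

Theorem corollary3p7 (R : realType) (M : nat) (d : 'I_M -> nat)
    (L : 'I_M -> R) (lambda kappa : R) (U : 'rV[R]_(\sum_m d m) -> R)
    (mu : probability 'rV[R]_(\sum_m d m) R)
    (K : forall m, R.-pker 'rV[R]_(\sum_j others d m j) ~> 'rV[R]_(d m)) :
  (0 < M)%N ->
  (forall m, 0 < L m) ->
  0 < lambda ->
  kappa = 1 / lambda ->
  block_convex_smooth L lambda U ->
  has_density mu (fun x => expR (- U x)) ->
  (forall m, conditional_law mu (K m)) ->
  ((1 / (kappa * M%:R))%:E <= Gap mu (gibbs_kernel K))%E
  /\
  (forall (dO : measure_display) (Omega : measurableType dO)
      (P : probability Omega R) (X : {RV P >-> 'rV[R]_(\sum_m d m)})
      (f : 'rV[R]_(\sum_m d m) -> R),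
    (forall A, measurable A -> distribution P X A = mu A) ->
    f \in Lfun mu 2%:E ->
    ((1 / kappa)%:E * 'V_P[f \o X]
     <= \sum_(m < M) \int[P]_w cond_variance K m f (X w))%E).
Proof.
move=> M0 L0 l0 -> cs dens claw.
have [[m dm]|d0] := pselect (exists m, (0 < d m)%N); last first.
  (* In dimension 0 lambda may exceed 1, but every function is constant. *)
  have fcst (f : 'rV[R]_(\sum_m d m) -> R) : f = cst (f 0).
    apply/funext => x; congr f; apply: blocks_eq0 => m.
    by apply/eqP; rewrite -leqn0 leqNgt; apply/negP => dm; apply: d0; exists m.
  split=> [|dO Omega P X f _ _].
    (* No function has positive variance, so the infimum is taken over the empty set. *)
    apply: le_ereal_inf_tmp; rewrite /lbound => _ [f [_ V0] <-]; move: V0.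
    by rewrite (fcst f) variance_cst ltxx.
  rewrite [f in 'V_P[f \o X]]fcst (_ : _ \o X = cst (f 0))// variance_cst mule0.
  by apply: sume_ge0 => m _; apply: integral_ge0 => w _; exact: cond_variance_ge0.
have l1 := block_convexity_le1 dm L0 cs.
have kE : 1 / (1 / lambda) = lambda by rewrite !div1r invrK.
split=> [|dO Omega P X f law f2].
  rewrite (_ : 1 / _ = lambda / M%:R); last by rewrite !div1r invfM invrK.
  exact: Gap_gibbs_ge L0 l0 l1 M0 cs dens claw.
rewrite kE (variance_law law f2).
have c2 k := cond_Lfun2 L0 l0 l1 M0 cs dens claw k f2.
have cvE k : (\int[P]_w cond_variance K k f (X w) = \int[mu]_x cond_variance K k f x)%E.
  apply: (ge0_integral_law law); first exact: measurable_cond_variance f2 (c2 k).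
  exact: cond_variance_ge0.
rewrite (eq_bigr _ (fun k _ => cvE k)).
by apply: le_trans (sum_cond_variance_ge L0 l0 l1 M0 cs dens claw f2) _; apply: lee_sum => k _; rewrite lexx.
Qed.
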